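(* Let $n\in\mathbb Z$, $n\neq0$, and suppose $(p,q,c)$ lies on the surface $\Sigma_{N,n}$ defined by $(-p^{1/2})^n=q^{-c-N}$. Then the operators $t(z)=\mathrm{Tr}\big[a^{-n}L^+(q^{c/2}z)L^-(z)^{-1}\big]$ of ${\cal A}_{q,p}(\widehat{sl}(N)_c)$ satisfy $$t(z)\,t(w)={\cal Y}_N(n,w/z)\,t(w)\,t(z),$$ where $${\cal Y}_N(r,x)=\begin{cases}\displaystyle\prod_{k=1}^{r}\frac{\Theta_{q^{2N}}^2(x^2p^{-k})\,\Theta_{q^{2N}}(x^2q^2p^k)\,\Theta_{q^{2N}}(x^2q^{-2}p^k)}{\Theta_{q^{2N}}^2(x^2p^k)\,\Theta_{q^{2N}}(x^2q^2p^{-k})\,\Theta_{q^{2N}}(x^2q^{-2}p^{-k})}& r>0,\\[3mm]\displaystyle\prod_{k=0}^{|r|-1}\frac{\Theta_{q^{2N}}^2(x^2p^{-k})\,\Theta_{q^{2N}}(x^2q^2p^k)\,\Theta_{q^{2N}}(x^2q^{-2}p^k)}{\Theta_{q^{2N}}^2(x^2p^k)\,\Theta_{q^{2N}}(x^2q^2p^{-k})\,\Theta_{q^{2N}}(x^2q^{-2}p^{-k})}& r<0.\end{cases}$$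
   Context: Parameters. $N\ge 2$ is an integer; $q,p,c$ are generic complex parameters for which the expressions below make sense (for the infinite products: $|q|<1$, $|p|<1$), with fixed logarithms so that fractional powers are defined. Put $p^*=pq^{-2c}$ and $(p^* )^{1/2}=p^{1/2}q^{-c}$. Notation: $(x;a)_\infty=\prod_{m\ge0}(1-xa^m)$, $(x;a,b)_\infty=\prod_{m,l\ge0}(1-xa^mb^l)$, $\Theta_a(x)=(x;a)_\infty(ax^{-1};a)_\infty(a;a)_\infty$. $R$-matrix. Write $z=e^{i\pi\xi}$, $q=e^{i\pi\zeta}$, $p=e^{2i\pi\tau}$, $\omega=e^{2i\pi/N}$, $\vartheta\left[{\gamma_1\atop\gamma_2}\right](\xi,\tau)=\sum_{m\in\mathbb Z}\exp\big(i\pi(m+\gamma_1)^2\tau+2i\pi(m+\gamma_1)(\xi+\gamma_2)\big)$. Let $g,h$ be the $N\times N$ matrices $g_{ij}=\omega^i\delta_{ij}$, $h_{ij}=\delta_{i+1,j}$ (indices mod $N$), $I_{(\alpha_1,\alpha_2)}=g^{\alpha_2}h^{\alpha_1}$, $g^{1/2}$ a fixed diagonal square root of $g$, $a=g^{1/2}hg^{1/2}$, and $$W_{(\alpha_1,\alpha_2)}(\xi,\zeta,\tau)=\frac1N\,\frac{\vartheta\left[{1/2+\alpha_1/N\atop 1/2+\alpha_2/N}\right](\xi+\zeta/N,\tau)}{\vartheta\left[{1/2+\alpha_1/N\atop 1/2+\alpha_2/N}\right](\zeta/N,\tau)},$$ $$\frac1{\kappa(z^2)}=\frac{(q^{2N}z^{-2};p,q^{2N})_\infty(q^2z^2;p,q^{2N})_\infty(pz^{-2};p,q^{2N})_\infty(pq^{2N-2}z^2;p,q^{2N})_\infty}{(q^{2N}z^2;p,q^{2N})_\infty(q^2z^{-2};p,q^{2N})_\infty(pz^2;p,q^{2N})_\infty(pq^{2N-2}z^{-2};p,q^{2N})_\infty},$$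 $$\widetilde R(z,q,p)=z^{2/N-2}\frac1{\kappa(z^2)}\frac{\vartheta\left[{1/2\atop1/2}\right](\zeta,\tau)}{\vartheta\left[{1/2\atop1/2}\right](\xi+\zeta,\tau)}\sum_{\alpha_1,\alpha_2\in\mathbb Z_N}W_{(\alpha_1,\alpha_2)}(\xi,\zeta,\tau)\,I_{(\alpha_1,\alpha_2)}\otimes I_{(\alpha_1,\alpha_2)}^{-1},$$ $R(z)=R(z,q,p)=(g^{1/2}\otimes g^{1/2})\widetilde R(z,q,p)(g^{-1/2}\otimes g^{-1/2})$. Further $\tau_N(z)=z^{2/N-2}\Theta_{q^{2N}}(qz^2)/\Theta_{q^{2N}}(qz^{-2})$ (it satisfies $\tau_N(q^Nz)=\tau_N(z)$, $\tau_N(z^{-1})=\tau_N(z)^{-1}$), $\widehat R_{12}(x)=\tau_N(q^{1/2}x^{-1})R_{12}(x)$, $\widehat R^*_{12}(x)=\widehat R_{12}(x,q,p^* )$. Subscripts denote the tensor factors of copies of $\mathbb C^N$ acted on ($R_{21}$ is $R_{12}$ with the two spaces exchanged) and $t_i$ denotes transposition in space $i$. Known properties: $R_{12}(z)R_{13}(w)R_{23}(w/z)=R_{23}(w/z)R_{13}(w)R_{12}(z)$; $R_{12}(z)R_{21}(z^{-1})=1$; $R_{12}(z)^{t_2}R_{21}(q^{-N}z^{-1})^{t_2}=1$; $R_{12}(-z)=\omega(g^{-1}\otimes 1)R_{12}(z)(g\otimes1)$; $\widehat R_{12}(-p^{1/2}z)=(a\otimes1)^{-1}\widehat R_{21}(z^{-1})^{-1}(a\otimes1)$.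 Algebra. ${\cal A}_{q,p}(\widehat{gl}(N)_c)$ is the algebra generated by the entries (modes) of $L(z)=(L_{ij}(z))_{1\le i,j\le N}$, $L_{ij}(z)=\sum_{n\in\mathbb Z}L_{ij}(n)z^n$, with relations $\widehat R_{12}(z/w)L_1(z)L_2(w)=L_2(w)L_1(z)\widehat R^*_{12}(z/w)$, where $L_1=L\otimes 1$, $L_2=1\otimes L$; ${\cal A}_{q,p}(\widehat{sl}(N)_c)$ is its quotient by $q\text{-}\det L(z)=q^{c/2}$, where $q\text{-}\det L(z)=\sum_{\sigma\in{\mathfrak S}_N}\varepsilon(\sigma)\prod_{i=1}^NL_{i,\sigma(i)}(zq^{i-N-1})$ is central. The relations are understood as analytic (not merely formal series) relations in the spectral parameters. Derived operators. $L^+(z)=L(q^{c/2}z)$, $L^-(z)=a\,L(-p^{1/2}z)\,a^{-1}$ (assumed invertible). $\mathrm{Tr}$ is the trace over the auxiliary space $\mathbb C^N$.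
   Formalization: For N>2, R(z) depends on the logarithm of z (it is a function of z^{2/N}), so the surface equation (-p^{1/2})^n=q^{-c-N} is required also for the 2/N-th powers of both sides computed with the fixed logarithms. *)

(* Defs.v *)
(* MathComp / MathComp-Analysis; complex numbers are R[i] for R : realType.

   Spectral parameters are written additively: z, w, q, p stand for
   exp(i pi xi), exp(i pi eta), exp(i pi zeta), exp(2 i pi tau), and functions
   of z are functions of xi.  This is what fixes the logarithms: for N > 2 the
   R-matrix is a single-valued function of z^(2/N), not of z, so that only the
   logarithm xi determines R(z).  All fractional powers are powers of these
   exponentials:
     q^s = exp(i pi zeta s),  p^(1/2) = exp(i pi tau),  -1 = exp(i pi),
     p' = p q^(-2c) = exp(2 i pi tau') with tau' = tau - zeta c.
   In particular z |-> q^s z is xi |-> xi + zeta s, and z |-> - p^(1/2) z is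
   xi |-> xi + tau + 1. *)
From HB Require Import structures.
From mathcomp Require Import all_boot all_order all_algebra all_fingroup.
From mathcomp Require Import all_classical all_reals all_analysis.
From mathcomp Require Import complex mxtens.

Set Implicit Arguments.
Unset Strict Implicit.
Unset Printing Implicit Defensive.

Import Order.TTheory GRing.Theory Num.Theory.
Import numFieldNormedType.Exports.
Local Open Scope ring_scope.
Local Open Scope complex_scope.

Section SpecialFunctions.
Context {R : realType}.
Local Notation C := R[i].

Definition cexp (z : C) : C :=
  let: a +i* b := z in (expR a)%:C * (cos b +i* sin b).

Definition Ipi : C := 0 +i* pi.

Definition epi (x : C) : C := cexp (Ipi * x).

(* R[i] carries its topology through the alias R[i]^o. *)
Definition clim (u : nat -> C) : C := limn (u : nat -> C^o).

(* (x; a)_oo *)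
Definition qpoch (x a : C) : C :=
  clim (fun n => \prod_(m < n) (1 - x * a ^+ m)).

(* (x; a, b)_oo *)
Definition qpoch2 (x a b : C) : C :=
  clim (fun n => \prod_(m < n) \prod_(l < n) (1 - x * a ^+ m * b ^+ l)).

Definition Theta (a x : C) : C :=
  qpoch x a * qpoch (a * x^-1) a * qpoch a a.

(* The sum over m in Z is the limit of the sums over -n <= m <= n. *)
Definition theta (g1 g2 xi tau : C) : C :=
  clim (fun n => \sum_(k < n.*2.+1)
    (let m : C := k%:R - n%:R in
     cexp (Ipi * (m + g1) ^+ 2 * tau + 2 * Ipi * (m + g1) * (xi + g2)))).

End SpecialFunctions.

Section IntegerPowers.
Context {K : comUnitRingType} {N : nat}.

Definition mxpowz (A : 'M[K]_N) (n : int) : 'M[K]_N :=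
  match n with
  | Posz k => A ^+ k
  | Negz k => invmx A ^+ k.+1
  end.

End IntegerPowers.

Section RMatrix.
Context {R : realType}.
Local Notation C := R[i].
Variable N : nat.

Definition omega : C := epi (2 / N%:R).

(* The row and column labels 1, .., N are i.+1 for i : 'I_N. *)
Definition gmx : 'M[C]_N := \matrix_(i, j) (omega ^+ i.+1 *+ (i == j)).

Definition hmx : 'M[C]_N := \matrix_(i, j) (ordS i == j)%:R.

Definition Imx (a1 a2 : nat) : 'M[C]_N := gmx ^+ a2 *m hmx ^+ a1.

Definition W (a1 a2 : nat) (xi zeta tau : C) : C :=
  let g1 := 2^-1 + a1%:R / N%:R in
  let g2 := 2^-1 + a2%:R / N%:R in
  N%:R^-1 * (theta g1 g2 (xi + zeta / N%:R) tau / theta g1 g2 (zeta / N%:R) tau).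

(* 1 / kappa(u), to be taken at u = z^2 *)
Definition kappa_inv (q p u : C) : C :=
  let Q := q ^+ (2 * N) in
  (qpoch2 (Q * u^-1) p Q * qpoch2 (q ^+ 2 * u) p Q
   * qpoch2 (p * u^-1) p Q * qpoch2 (p * q ^+ (2 * N - 2) * u) p Q)
  / (qpoch2 (Q * u) p Q * qpoch2 (q ^+ 2 * u^-1) p Q
     * qpoch2 (p * u) p Q * qpoch2 (p * q ^+ (2 * N - 2) * u^-1) p Q).

Definition Rtilde (zeta tau xi : C) : 'M[C]_(N * N) :=
  (epi (xi * (2 / N%:R - 2))
   * kappa_inv (epi zeta) (epi (2 * tau)) (epi xi ^+ 2)
   * (theta 2^-1 2^-1 zeta tau / theta 2^-1 2^-1 (xi + zeta) tau))
  *: \sum_(a1 < N) \sum_(a2 < N)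
       W a1 a2 xi zeta tau *: tensmx (Imx a1 a2) (invmx (Imx a1 a2)).

(* gh is the chosen diagonal square root g^(1/2). *)
Definition Rmx (gh : 'M[C]_N) (zeta tau xi : C) : 'M[C]_(N * N) :=
  tensmx gh gh *m Rtilde zeta tau xi *m tensmx (invmx gh) (invmx gh).

Definition tauN (zeta xi : C) : C :=
  let q := epi zeta in let z := epi xi in
  epi (xi * (2 / N%:R - 2))
  * (Theta (q ^+ (2 * N)) (q * z ^+ 2) / Theta (q ^+ (2 * N)) (q * z ^- 2)).

Definition Rhat (gh : 'M[C]_N) (zeta tau xi : C) : 'M[C]_(N * N) :=
  tauN zeta (zeta / 2 - xi) *: Rmx gh zeta tau xi.

Definition amx (gh : 'M[C]_N) : 'M[C]_N := gh *m hmx *m gh.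

End RMatrix.

Section Surfaces.
Context {R : realType}.
Local Notation C := R[i].

Definition taustar (zeta tau c : C) : C := tau - zeta * c.

(* The values for which R(z, q, p) and R(z, q, p') make sense: the infinite
   products and theta series converge, and (last two conditions) the
   z-independent denominators of the W's do not vanish. *)
Definition admissible (zeta tau c : C) : Prop :=
  let q := epi zeta in let p := epi (2 * tau) in
  let ps := epi (2 * taustar zeta tau c) in
  [/\ `|q| < 1, `|p| < 1, `|ps| < 1,
      (forall k : int, q ^+ 2 <> p ^ k) &
      (forall k : int, q ^+ 2 <> ps ^ k)].

(* The square of x = exp(i pi xi) avoids the countable subgroup generated by
   q, p and p'.  All zeros and poles in x of the structure functions (entries
   and determinants of R-hat(x), R-hat(x) at p', and of their shifts by powers of
   q^c and p^(1/2); factors Theta of the exchange functions) are excluded, so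
   identities between meromorphic functions of x are stated for such x. *)
Definition generic_ratio (zeta tau c xi : C) : Prop :=
  forall i j k : int,
    epi xi ^+ 2 <>
    epi zeta ^ i * epi (2 * tau) ^ j * epi (2 * taustar zeta tau c) ^ k.

(* The surface (- p^(1/2))^n = q^(-c-N).  As R is a function of z^(2/N), the
   equation is also required for the 2/N-th powers of both sides computed with
   the fixed logarithms; for N = 2 the second equation is the first one. *)
Definition on_surface (N : nat) (n : int) (zeta tau c : C) : Prop :=
  epi ((tau + 1) * n%:~R) = epi (zeta * (- c - N%:R))
  /\ epi ((tau + 1) * n%:~R * (2 / N%:R))
     = epi (zeta * (- c - N%:R) * (2 / N%:R)).

Definition Yfactor (zeta tau : C) (N k : nat) (x : C) : C :=
  let q := epi zeta in let p := epi (2 * tau) in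
  let T := Theta (q ^+ (2 * N)) in
  (T (x ^+ 2 * p ^- k) ^+ 2 * T (x ^+ 2 * q ^+ 2 * p ^+ k)
   * T (x ^+ 2 * q ^- 2 * p ^+ k))
  / (T (x ^+ 2 * p ^+ k) ^+ 2 * T (x ^+ 2 * q ^+ 2 * p ^- k)
     * T (x ^+ 2 * q ^- 2 * p ^- k)).

Definition YN (zeta tau : C) (N : nat) (r : int) (x : C) : C :=
  if 0 < r then \prod_(1 <= k < `|r|%N.+1) Yfactor zeta tau N k x
  else \prod_(0 <= k < `|r|%N) Yfactor zeta tau N k x.

End Surfaces.

(* A realization of the algebras: a unital associative algebra A over C with
   operators L_ij(z) in A, xi |-> L xi being L(z).  An identity holds in the
   algebra presented by generators and relations iff it holds in every
   realization.  No convergence of a mode expansion in powers of z is required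
   of L, so operator functions given by such expansions are included. *)
Section Algebra.
Context {R : realType} {A : algType R[i]}.
Local Notation C := R[i].
Variable N : nat.

Definition scal {m n : nat} (M : 'M[C]_(m, n)) : 'M[A]_(m, n) :=
  map_mx (fun x => x%:A) M.

Definition sp1 (X : 'M[A]_N) : 'M[A]_(N * N) := tensmx X (1%:M : 'M[A]_N).
Definition sp2 (X : 'M[A]_N) : 'M[A]_(N * N) := tensmx (1%:M : 'M[A]_N) X.

Definition Aqp_gl (gh : 'M[C]_N) (zeta tau c : C) (L : C -> 'M[A]_N) : Prop :=
  forall xi eta : C, generic_ratio zeta tau c (xi - eta) ->
    scal (Rhat gh zeta tau (xi - eta)) *m sp1 (L xi) *m sp2 (L eta)
    = sp2 (L eta) *m sp1 (L xi)
      *m scal (Rhat gh zeta (taustar zeta tau c) (xi - eta)).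

Definition qdet (zeta : C) (L : C -> 'M[A]_N) (xi : C) : A :=
  \sum_(s : 'S_N) (-1) ^+ s *
    \prod_(i < N) L (xi + zeta * (i.+1%:R - N%:R - 1)) i (s i).

Definition Aqp_sl (gh : 'M[C]_N) (zeta tau c : C) (L : C -> 'M[A]_N) : Prop :=
  Aqp_gl gh zeta tau c L
  /\ forall xi : C, qdet zeta L xi = (epi (zeta * c / 2))%:A.

Definition Lplus (zeta c : C) (L : C -> 'M[A]_N) (xi : C) : 'M[A]_N :=
  L (xi + zeta * c / 2).

Definition Lminus (gh : 'M[C]_N) (tau : C) (L : C -> 'M[A]_N) (xi : C) :
    'M[A]_N :=
  scal (amx gh) *m L (xi + tau + 1) *m scal (invmx (amx gh)).

(* Lminv xi is the inverse matrix of L^-(z) over the noncommutative ring A. *)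
Definition Lminus_inverse (gh : 'M[C]_N) (tau : C) (L Lminv : C -> 'M[A]_N) :
    Prop :=
  forall xi : C, Lminus gh tau L xi *m Lminv xi = 1%:M
              /\ Lminv xi *m Lminus gh tau L xi = 1%:M.

Definition tgen (gh : 'M[C]_N) (n : int) (zeta c : C)
    (L Lminv : C -> 'M[A]_N) (xi : C) : A :=
  \tr (scal (mxpowz (amx gh) (- n))
       *m Lplus zeta c L (xi + zeta * c / 2) *m Lminv xi).

End Algebra.

(* Main.v *)
(* Put D = a^(-n-1), l = L(q^c z) and m = a^(-1) L^-(z)^(-1) a, the inverse of
   L(-p^(1/2) z); then t(z) = Tr[D l a m].  In t(z) t(w) the factors m (in z)
   and l' (in w) are exchanged by an inverted RLL relation; contracting with
   the crossing-shifted R-matrix, which on the surface is R-hat at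
   (-p^(1/2))^(n+1) z/w, turns the product into one trace over two auxiliary
   spaces.  Iterated quasi-periodicity R-hat(-p^(1/2) x) = f(x^2) a_1^(-1)
   R-hat(x) a_1 brings this trace to scalar * Tr[D1 D2 l'_2 l_1 a1 a2 m_1 m'_2].
   For t(w) t(z) the same argument, with the two spaces exchanged and one more
   use of the RLL relation, gives another scalar times the same trace.  The
   quotient of the scalars is the product of f(x^2 p^k) / f(x^2 p^(-k)).

   The properties of R used here are proved from the theta series.  The
   three-term (Pluecker) identity gives a partial fraction expansion, which gives
   a duality for the discrete Fourier transforms of W exchanging xi with zeta.
   Crossing is this duality applied to each factor.  For unitarity, duality makes
   the entries of R(z) R_21(1/z) antisymmetric in (xi, zeta) up to a scalar, so
   they vanish at xi = zeta, and the three-term identity carries this to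
   all xi. *)
Require Import Defs.
From HB Require Import structures.
From mathcomp Require Import all_boot all_order all_algebra all_fingroup.
From mathcomp Require Import all_classical all_reals all_analysis.
From mathcomp Require Import complex mxtens.
From mathcomp Require Import ring lra zify.

Set Implicit Arguments.
Unset Strict Implicit.
Unset Printing Implicit Defensive.

Import Order.TTheory GRing.Theory Num.Theory.
Import numFieldNormedType.Exports.
Import ComplexField.Normc.
Local Open Scope ring_scope.
Local Open Scope complex_scope.

(** * Limits and infinite products in R[i] *)

(** The factor [f] ([qfactor]) of the quasi-periodicity involves [q] but neither nome, so a step in
    [p] and a step in [p'] produce the same function. Both kinds occur: the crossed matrices at [p]
    are [n + 1] steps in [p] away, those at [p'] a single step in [p']. On the surface
    [p' = p^(n+1) q^(2N)], and [f] is invariant under [u -> q^(2N) u]; thus all scalars become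
    values of [f] at points [p^j u], and can be compared.

    Every identity is proved pointwise, from the series, at arguments where the denominators do not
    vanish; there is no continuation and no counting of zeros. Hence the zeros of theta must be
    known exactly. They come from Jacobi's triple product, which also identifies theta with [Theta]
    at base [p], the function produced by the double products of 1/kappa. For the same reason
    unitarity takes a second route at points where the three-term identity degenerates. *)

Section ComplexLimits.
Context {R : realType}.
Local Notation C := R[i].

(** The wrapper hides the alias [C^o] that carries the topology, so that limits are stated for
    sequences of plain complex numbers. *)
Variant ccvg (u : nat -> C) (l : C) : Prop :=
  Ccvg of ((u : nat -> C^o) @ \oo --> (l : C^o))%classic.

Lemma normc_lt (z : C) (e : R) : (normc z < e) = (`|z| < e%:C).
Proof. by rewrite ltcR. Qed.

Lemma ccvgP (u : nat -> C) (l : C) :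
  ccvg u l <-> forall e : R, 0 < e ->
    exists n0, forall n, (n0 <= n)%N -> normc (u n - l) < e.
Proof.
split=> [[h] e e0|h].
  have e0' : 0 < e%:C :> C by rewrite ltcR.
  move/cvgrPdist_lt : h => /(_ _ e0')[n0 _ hn0].
  by exists n0 => n hn; rewrite normc_lt distrC; apply: hn0.
constructor; apply/cvgrPdist_lt => e e0.
have er : e = (complex.Re e)%:C by rewrite RRe_real // gtr0_real.
have [n0 hn0] := h (complex.Re e) ltac:(by move: e0; rewrite {1}er ltcR).
exists n0 => // n /= hn; rewrite distrC er -normc_lt; exact: hn0.
Qed.

Lemma ccvg_clim u l : ccvg u l -> clim u = l.
Proof.
have C_hausdorff : hausdorff_space C^o by apply: norm_hausdorff.
by case; apply: (cvg_lim C_hausdorff).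
Qed.

Lemma ccvg_unique u l l' : ccvg u l -> ccvg u l' -> l = l'.
Proof. by move=> /ccvg_clim <- /ccvg_clim. Qed.

Lemma ccvgD u v a b : ccvg u a -> ccvg v b -> ccvg (fun n => u n + v n) (a + b).
Proof. by move=> [h1] [h2]; constructor; apply: (cvgD h1 h2). Qed.

Lemma ccvgB u v a b : ccvg u a -> ccvg v b -> ccvg (fun n => u n - v n) (a - b).
Proof. by case=> h1 [h2]; constructor; apply: (cvgB h1 h2). Qed.

Lemma ccvgM u v a b : ccvg u a -> ccvg v b -> ccvg (fun n => u n * v n) (a * b).
Proof. by case=> h1 [h2]; constructor; apply: (cvgM h1 h2). Qed.

Lemma ccvg_cst a : ccvg (fun=> a) a.
Proof. by constructor; apply: cvg_cst. Qed.

Lemma ccvgZ u a b : ccvg u b -> ccvg (fun n => a * u n) (a * b).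
Proof. by apply: ccvgM; apply: ccvg_cst. Qed.

Lemma ccvg_eq u v l : u =1 v -> ccvg u l -> ccvg v l.
Proof. by move=> /funext ->. Qed.

Lemma ccvg_shift u l : ccvg (fun n => u n.+1) l <-> ccvg u l.
Proof. by split=> -[h]; constructor; move: h; rewrite -(cvg_shiftS (u : nat -> C^o)). Qed.

Lemma ccvg_sub0 u v l : ccvg u l -> ccvg (fun n => v n - u n) 0 -> ccvg v l.
Proof.
move=> h1 /(ccvgD h1); rewrite addr0.
by apply: ccvg_eq => n; rewrite addrC subrK.
Qed.

Lemma normcB (x y : C) : normc (x - y) = normc (y - x).
Proof. by rewrite -normcN opprB. Qed.

Lemma normc_ge0 (x : C) : 0 <= normc x.
Proof. by case: x => a b; apply: sqrtr_ge0. Qed.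

Lemma normc_sum (I : Type) (s : seq I) (P : pred I) (F : I -> C) :
  normc (\sum_(i <- s | P i) F i) <= \sum_(i <- s | P i) normc (F i).
Proof.
elim/big_rec2 : _ => [|i y z _ h]; first by rewrite normc0.
exact: le_trans (le_normcD _ _) (lerD _ _).
Qed.

Lemma normc_prod (I : Type) (s : seq I) (P : pred I) (F : I -> C) :
  normc (\prod_(i <- s | P i) F i) = \prod_(i <- s | P i) normc (F i).
Proof.
by elim/big_rec2 : _ => [|i y z _ h]; rewrite ?normc1 // normcM h.
Qed.

Lemma normcX (x : C) n : normc (x ^+ n) = normc x ^+ n.
Proof. by elim: n => [|n ih]; rewrite ?expr0 ?normc1 // !exprS normcM ih. Qed.

Lemma normc_Re (z : C) : `|complex.Re z| <= normc z.
Proof.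
case: z => a b /=; rewrite -sqrtr_sqr ler_wsqrtr //.
by rewrite lerDl sqr_ge0.
Qed.

Lemma normc_Im (z : C) : `|complex.Im z| <= normc z.
Proof.
case: z => a b /=; rewrite -sqrtr_sqr ler_wsqrtr //.
by rewrite lerDr sqr_ge0.
Qed.

Lemma normc_ReIm (z : C) : normc z <= `|complex.Re z| + `|complex.Im z|.
Proof.
case: z => a b /=.
have ab : 0 <= `|a| * `|b| by apply: mulr_ge0.
rewrite -(ger0_norm (addr_ge0 (normr_ge0 a) (normr_ge0 b))) -sqrtr_sqr.
rewrite ler_wsqrtr // sqrrD !real_normK ?num_real //; lra.
Qed.

Lemma ReB (x y : C) : complex.Re (x - y) = complex.Re x - complex.Re y.
Proof. by case: x y => [a b] [c d]. Qed.

Lemma ImB (x y : C) : complex.Im (x - y) = complex.Im x - complex.Im y.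
Proof. by case: x y => [a b] [c d]. Qed.

(* Both [Q] and [u + Q] are nondecreasing, so the difference converges. *)
Lemma dominated_real_cvg (u Q : nat -> R) (B : R) :
  (forall n k, (n <= k)%N -> `|u k - u n| <= Q k - Q n) ->
  (forall n, Q n <= B) -> exists l : R, (u @ \oo --> l)%classic.
Proof.
move=> h hB.
have Qm : nondecreasing_seq Q.
  by move=> n k nk; rewrite -subr_ge0; apply: le_trans (h _ _ nk).
have cQ : cvgn Q.
  by apply: nondecreasing_is_cvgn => //; exists B => _ [n _ <-].
have cu : cvgn (u \+ Q).
  apply: nondecreasing_is_cvgn.
    move=> n k nk; have := h _ _ nk; rewrite ler_norml => /andP[h1 _].
    rewrite /=; lra.
  exists (u 0%N + (B - Q 0%N) + B) => _ [n _ <-] /=.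
  have := h _ _ (leq0n n); rewrite ler_norml => /andP[_ h2].
  have := hB n; lra.
exists (limn (u \+ Q) - limn Q).
have uE : (u \+ Q) \- Q = u by apply/funext => n; apply: addrK.
by rewrite -{1}uE; apply: (cvgB cu cQ).
Qed.

(** Increments are compared, not terms. This covers series, with [Q] the partial sums of a majorant,
    and also products, with [Q] the products of [1 + |a_i|]. *)
Lemma dominated_ccvg (u : nat -> C) (Q : nat -> R) (B : R) :
  (forall n k, (n <= k)%N -> normc (u k - u n) <= Q k - Q n) ->
  (forall n, Q n <= B) -> exists l, ccvg u l.
Proof.
move=> h hB.
have [a ha] : exists l : R, ((@complex.Re R \o u) @ \oo --> l)%classic.
  apply: dominated_real_cvg hB => n k nk /=; rewrite -ReB.
  exact: le_trans (normc_Re _) (h _ _ nk).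
have [b hb] : exists l : R, ((@complex.Im R \o u) @ \oo --> l)%classic.
  apply: dominated_real_cvg hB => n k nk /=; rewrite -ImB.
  exact: le_trans (normc_Im _) (h _ _ nk).
exists (a +i* b); apply/ccvgP => e e0.
have e2 : 0 < e / 2 by lra.
move/cvgrPdist_lt : ha => /(_ _ e2)[n1 _ hn1].
move/cvgrPdist_lt : hb => /(_ _ e2)[n2 _ hn2].
exists (maxn n1 n2) => n; rewrite geq_max => /andP[k1 k2].
apply: le_lt_trans (normc_ReIm _) _; rewrite ReB ImB /=.
have := hn1 n k1; have := hn2 n k2; rewrite /= (distrC a) (distrC b).
lra.
Qed.

End ComplexLimits.

(** * Absolutely convergent sums and products over countable index sets *)

Section DominatedSums.
Context {R : realType} {I : choiceType}.
Local Notation C := R[i].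

Definition exhausts (E : nat -> seq I) : Prop :=
  (forall n, uniq (E n)) /\
  (forall i, exists n0, forall n, (n0 <= n)%N -> i \in E n).

Definition summable_by (g : I -> R) : Prop :=
  (forall i, 0 <= g i) /\
  exists B, forall F : seq I, uniq F -> \sum_(i <- F) g i <= B.

Lemma exhausts_sub E (F : seq I) : exhausts E ->
  exists n0, forall n, (n0 <= n)%N -> {subset F <= E n}.
Proof.
move=> [_ hE]; elim: F => [|i F [n0 h0]]; first by exists 0%N.
have [n1 h1] := hE i; exists (maxn n0 n1) => n; rewrite geq_max => /andP[k0 k1] j.
by rewrite inE => /orP[/eqP->|]; [apply: h1|apply: h0].
Qed.

Lemma big_subset (T : Type) (idx : T) (op : Monoid.com_law idx)
    (E F : seq I) (f : I -> T) :
  uniq E -> uniq F -> {subset F <= E} ->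
  \big[op/idx]_(i <- E) f i =
  op (\big[op/idx]_(i <- F) f i) (\big[op/idx]_(i <- E | i \notin F) f i).
Proof.
move=> uE uF sFE; rewrite (bigID (mem F)) /=; congr (op _ _).
rewrite -big_filter; apply: perm_big; apply: uniq_perm => //.
  exact: filter_uniq.
by move=> i; rewrite mem_filter /=; case iF: (i \in F) => //=; apply: sFE.
Qed.

Lemma dominated_tail (g : I -> R) : summable_by g ->
  forall e, 0 < e -> exists F, uniq F /\
    forall E, uniq E -> {subset F <= E} ->
      \sum_(i <- E | i \notin F) g i < e.
Proof.
move=> [g0 [B hB]] e e0.
pose S := [set x : R | exists F, uniq F /\ x = \sum_(i <- F) g i]%classic.
have hS : has_sup S.
  split; first by exists 0, [::]; rewrite big_nil.
  by exists B => _ [F [uF ->]]; apply: hB.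
have [_ [F [uF ->]] hF] := sup_adherent e0 hS.
exists F; split=> // E uE sFE.
have : \sum_(i <- E) g i <= sup S by apply: (ub_le_sup (proj2 hS)); exists E.
rewrite (big_subset _ _ uE uF sFE) /=; lra.
Qed.

(** Once both lists contain a finite set outside which [g] sums to less than [e / 2], the two sums
    differ only by tails. This is what permits substitutions of summation indices in bilateral and
    double series. *)
Lemma dominated_exhaust (h : I -> C) (g : I -> R) (E E' : nat -> seq I) :
  summable_by g -> (forall i, normc (h i) <= g i) ->
  exhausts E -> exhausts E' ->
  ccvg (fun n => \sum_(i <- E n) h i - \sum_(i <- E' n) h i) 0.
Proof.
move=> hg hh eE eE'; apply/ccvgP => e e0.
have [F [uF hF]] := dominated_tail hg (ltac:(lra) : 0 < e / 2).
have [n1 h1] := exhausts_sub F eE; have [n2 h2] := exhausts_sub F eE'.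
exists (maxn n1 n2) => n; rewrite geq_max => /andP[k1 k2].
rewrite subr0 (big_subset _ _ (proj1 eE n) uF (h1 _ k1)).
rewrite (big_subset _ _ (proj1 eE' n) uF (h2 _ k2)) /= opprD addrACA subrr add0r.
apply: le_lt_trans (le_normcD _ _) _; rewrite normcN.
have t1 := hF _ (proj1 eE n) (h1 _ k1); have t2 := hF _ (proj1 eE' n) (h2 _ k2).
have l1 := normc_sum (E n) (fun i => i \notin F) h.
have l2 := normc_sum (E' n) (fun i => i \notin F) h.
have m1 : \sum_(i <- E n | i \notin F) normc (h i) <=
  \sum_(i <- E n | i \notin F) g i by apply: ler_sum.
have m2 : \sum_(i <- E' n | i \notin F) normc (h i) <=
  \sum_(i <- E' n | i \notin F) g i by apply: ler_sum.
apply: le_lt_trans (lerD (le_trans l1 m1) (le_trans l2 m2)) _.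
by rewrite [ltRHS]splitr; apply: ltrD.
Qed.

(** Tannery's theorem, dominated convergence for sums whose terms vary with [n]: a finite set
    carries all of [g] up to [e / 3], termwise convergence handles that set, and outside it the
    difference is at most [2 * g]. *)
Lemma tannery (h : I -> C) (hn : nat -> I -> C) (g : I -> R) (E : nat -> seq I) :
  summable_by g -> (forall i, normc (h i) <= g i) ->
  (forall n i, i \in E n -> normc (hn n i) <= g i) ->
  (forall i, ccvg (hn^~ i) (h i)) -> exhausts E ->
  ccvg (fun n => \sum_(i <- E n) hn n i - \sum_(i <- E n) h i) 0.
Proof.
move=> hg hh hhn hlim eE; apply/ccvgP => e e0.
have [F [uF hF]] := dominated_tail hg (ltac:(lra) : 0 < e / 3).
have [n1 h1] := exhausts_sub F eE.
have hF0 : ccvg (fun n => \sum_(i <- F) (hn n i - h i)) 0.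
  elim: F {uF hF h1} => [|i F ih].
    by apply: ccvg_eq (ccvg_cst 0) => n; rewrite big_nil.
  have := ccvgD (ccvgB (hlim i) (ccvg_cst (h i))) ih; rewrite subrr addr0.
  by apply: ccvg_eq => n; rewrite big_cons.
have [n2 h2] := (ccvgP _ _).1 hF0 (e / 3) (ltac:(lra)).
exists (maxn n1 n2) => n; rewrite geq_max => /andP[k1 k2].
rewrite subr0 -sumrB (big_subset _ _ (proj1 eE n) uF (h1 _ k1)) /=.
apply: le_lt_trans (le_normcD _ _) _.
have := h2 _ k2; rewrite subr0 => l1.
have t1 := hF _ (proj1 eE n) (h1 _ k1).
have l2 := normc_sum (E n) (fun i => i \notin F) (fun i => hn n i - h i).
have m2 : \sum_(i <- E n | i \notin F) normc (hn n i - h i) <=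
  2 * \sum_(i <- E n | i \notin F) g i.
  rewrite mulr_sumr [leLHS]big_seq_cond [leRHS]big_seq_cond; apply: ler_sum => i /andP[iE _].
  have a1 := le_normcD (hn n i) (- h i); rewrite normcN in a1.
  have := hhn _ _ iE; have := hh i => b1 b2.
  apply: le_trans a1 _; apply: le_trans (lerD b2 b1) _.
  by rewrite mulr_natl mulr2n.
apply: lt_le_trans (ltr_leD l1 (le_trans l2 m2)) _.
rewrite [leRHS](_ : _ = e / 3 + 2 * (e / 3)); last by field.
by rewrite lerD2l ler_pM2l ?ltr0n //; apply: ltW.
Qed.

Lemma dominated_sum_ccvg (h : I -> C) (g : I -> R) (E : nat -> seq I) :
  summable_by g -> (forall i, normc (h i) <= g i) ->
  (forall n, uniq (E n)) -> (forall n k, (n <= k)%N -> {subset E n <= E k}) ->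
  exists l, ccvg (fun n => \sum_(i <- E n) h i) l.
Proof.
move=> [g0 [B hB]] hh uE sE.
apply: (dominated_ccvg (Q := fun n => \sum_(i <- E n) g i)) => [n k nk|n].
  rewrite !(big_subset _ _ (uE k) (uE n) (sE _ _ nk)) /= !(addrC (\sum_(i <- E n) _)).
  rewrite !addrK; apply: le_trans (normc_sum _ _ _) _; exact: ler_sum.
exact: hB.
Qed.

(** After expansion, each monomial is bounded by its absolute value. This puts products of [1 + a i]
    in the form required by [dominated_ccvg]. *)
Lemma prod1_le (s : seq I) (P : pred I) (a : I -> C) :
  normc (\prod_(i <- s | P i) (1 + a i) - 1)
  <= \prod_(i <- s | P i) (1 + normc (a i)) - 1.
Proof.
elim: s => [|i s ih]; first by rewrite !big_nil !subrr normc0.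
rewrite !big_cons; case: ifP => // _.
set p := \prod_(j <- s | P j) _ in ih *.
set q := \prod_(j <- s | P j) _ in ih *.
have -> : (1 + a i) * p - 1 = (p - 1) + (a i * (p - 1) + a i) by ring.
have n0 := normc_ge0 (a i).
apply: le_trans (le_normcD _ _) _; have := le_normcD (a i * (p - 1)) (a i).
rewrite normcM; have := ler_wpM2l n0 ih; lra.
Qed.

Lemma prod1_le_norm (s : seq I) (P : pred I) (a : I -> C) :
  normc (\prod_(i <- s | P i) (1 + a i)) <= \prod_(i <- s | P i) (1 + normc (a i)).
Proof.
rewrite normc_prod; apply: ler_prod => i _; rewrite normc_ge0 /=.
by apply: le_trans (le_normcD _ _) _; rewrite normc1.
Qed.

(** Weierstrass' inequality; it keeps the tail of an infinite product away from zero. *)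
Lemma prod1_ge (s : seq I) (P : pred I) (a : I -> C) :
  (forall i, i \in s -> P i -> normc (a i) <= 1) ->
  1 - \sum_(i <- s | P i) normc (a i) <= normc (\prod_(i <- s | P i) (1 + a i)).
Proof.
elim: s => [|i s ih] ha; first by rewrite !big_nil subr0 normc1.
have {}ih := ih (fun j js => ha j (mem_behead (s := i :: s) js)).
rewrite !big_cons; case: ifP => // Pi.
have a1 : normc (a i) <= 1 by apply: ha; rewrite ?mem_head.
have n0 := normc_ge0 (a i).
rewrite normcM.
have h1 : 1 - normc (a i) <= normc (1 + a i).
  have := le_normcD (1 + a i) (- a i); rewrite addrK normcN normc1; lra.
set S := \sum_(j <- s | _) _ in ih *; set p := normc (\prod_(j <- s | _) _) in ih *.
have S0 : 0 <= S by apply: sumr_ge0 => j _; apply: normc_ge0.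
have p0 : 0 <= p by apply: normc_ge0.
have h2 : (1 - normc (a i)) * p <= normc (1 + a i) * p by apply: ler_wpM2r.
have h3 : (1 - normc (a i)) * (1 - S) <= (1 - normc (a i)) * p.
  by apply: ler_wpM2l => //; lra.
have h4 : 0 <= normc (a i) * S by apply: mulr_ge0.
lra.
Qed.

Lemma prod_le_exp (s : seq I) (a : I -> C) :
  \prod_(i <- s) (1 + normc (a i)) <= expR (\sum_(i <- s) normc (a i)).
Proof.
rewrite expR_sum; apply: ler_prod => i _; rewrite expR_ge1Dx andbT.
have := normc_ge0 (a i); lra.
Qed.

Lemma prod_ccvg (E : nat -> seq I) (a : I -> C) (M : R) :
  (forall n, uniq (E n)) -> (forall n k, (n <= k)%N -> {subset E n <= E k}) ->
  (forall n, \sum_(i <- E n) normc (a i) <= M) ->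
  exists l, ccvg (fun n => \prod_(i <- E n) (1 + a i)) l.
Proof.
move=> uE sE hM.
apply: (dominated_ccvg (Q := fun n => \prod_(i <- E n) (1 + normc (a i)))
  (B := expR M)) => [n k nk|n].
  rewrite !(big_subset _ _ (uE k) (uE n) (sE _ _ nk)) /=.
  set p := \prod_(i <- E n) (1 + a i); set q := \prod_(i <- E n) (1 + normc _).
  set p' := \prod_(i <- E k | _) _; set q' := \prod_(i <- E k | _) _.
  have -> : p * p' - p = p * (p' - 1) by ring.
  have -> : q * q' - q = q * (q' - 1) by ring.
  rewrite normcM; apply: ler_pM; rewrite ?normc_ge0 //.
    exact: prod1_le_norm.
  exact: prod1_le.
by apply: le_trans (prod_le_exp _ _) _; rewrite ler_expR.
Qed.

(** Beyond some [n0] the remaining [|a i|] sum to less than 1/2, so by [prod1_ge] every later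
    product is at least half of the nonzero product at [n0] in absolute value. *)
Lemma prod_ccvg_neq0 (E : nat -> seq I) (a : I -> C) (M : R) l :
  (forall n, uniq (E n)) -> (forall n k, (n <= k)%N -> {subset E n <= E k}) ->
  (forall n, \sum_(i <- E n) normc (a i) <= M) ->
  (forall i, 1 + a i != 0) ->
  ccvg (fun n => \prod_(i <- E n) (1 + a i)) l -> l != 0.
Proof.
move=> uE sE hM a0 hl; apply/negP => /eqP l0; rewrite {}l0 in hl.
pose S n := \sum_(i <- E n) normc (a i).
have SD n k : (n <= k)%N ->
    S k = S n + \sum_(i <- E k | i \notin E n) normc (a i).
  by move=> nk; rewrite /S (big_subset _ _ (uE k) (uE n) (sE _ _ nk)).
have Sm : nondecreasing_seq S.
  by move=> n k nk; rewrite (SD _ _ nk) lerDl sumr_ge0 // => i _; apply: normc_ge0.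
have cS : cvgn S by apply: nondecreasing_is_cvgn => //; exists M => _ [n _ <-]; apply: hM.
have le_S n : S n <= limn S by apply: nondecreasing_cvgn_le.
have [n0 _ hn0] : (\forall n \near \oo, `|limn S - S n| < 1 / 2)%classic.
  by move/cvgrPdist_lt : cS; apply; lra.
have S0 : limn S - S n0 < 1 / 2.
  by have := hn0 n0 (leqnn _); apply: le_lt_trans; apply: ler_norm.
pose p := normc (\prod_(i <- E n0) (1 + a i)).
have p0 : 0 < p.
  rewrite lt_def normc_ge0 andbT; apply/eqP => /eq0_normc /eqP.
  by rewrite prodf_seq_eq0 => /hasP[i _]; rewrite (negbTE (a0 i)).
have [n1 hn1] := (ccvgP _ _).1 hl (p / 2) (ltac:(lra)).
have k0 : (n0 <= maxn n0 n1)%N by apply: leq_maxl.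
have := hn1 (maxn n0 n1) (leq_maxr _ _).
rewrite subr0 (big_subset _ _ (uE _) (uE n0) (sE _ _ k0)) /= normcM -/p.
have small : \sum_(i <- E (maxn n0 n1) | i \notin E n0) normc (a i) < 1 / 2.
  have := SD _ _ k0; have := le_S (maxn n0 n1); lra.
have small1 i : i \in E (maxn n0 n1) -> i \notin E n0 -> normc (a i) <= 1.
  move=> iE iE0; move: small; rewrite (big_rem i) //= iE0.
  have : 0 <= \sum_(j <- rem i (E (maxn n0 n1)) | j \notin E n0) normc (a j).
    by apply: sumr_ge0 => j _; apply: normc_ge0.
  lra.
move: (prod1_ge small1).
move=> h1 h2; have : p * (1 / 2) < p * (1/2); last by rewrite ltxx.
apply: le_lt_trans (_ : _ <= p * normc _) _; last by rewrite mul1r; apply: h2.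
rewrite ler_pM2l //; lra.
Qed.

End DominatedSums.

Section Exponential.
Context {R : realType}.
Local Notation C := R[i].

Lemma cexpD (x y : C) : cexp (x + y) = cexp x * cexp y.
Proof.
case: x y => [a b] [c d]; rewrite /cexp /= expRD cosD sinD.
by apply/eqP; rewrite eq_complex /=; apply/andP; split; apply/eqP; ring.
Qed.

Lemma epiD (x y : C) : epi (x + y) = epi x * epi y.
Proof. by rewrite /epi mulrDr cexpD. Qed.

Lemma epi0 : epi (0 : C) = 1.
Proof.
rewrite /epi mulr0 /cexp /= expR0 cos0 sin0.
by apply/eqP; rewrite eq_complex /=; apply/andP; split; apply/eqP; ring.
Qed.

Lemma epi1 : epi (1 : C) = -1.
Proof.
rewrite /epi mulr1 /Ipi /cexp expR0 cospi sinpi.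
by apply/eqP; rewrite eq_complex /=; apply/andP; split; apply/eqP; ring.
Qed.

Lemma epi2 : epi (2 : C) = 1.
Proof. by rewrite -[2%:R]/(1 + 1) epiD epi1 mulrNN mul1r. Qed.

Lemma epi_neq0 (x : C) : epi x != 0.
Proof.
apply/negP => /eqP h; have : epi (x - x) = 0 by rewrite epiD h mul0r.
by rewrite subrr epi0 => /eqP; rewrite oner_eq0.
Qed.

Lemma epiN (x : C) : epi (- x) = (epi x)^-1.
Proof.
by apply: (mulIf (epi_neq0 x)); rewrite -epiD addNr epi0 mulVf ?epi_neq0.
Qed.

Lemma epiB (x y : C) : epi (x - y) = epi x / epi y.
Proof. by rewrite epiD epiN. Qed.

Lemma epiMn (x : C) n : epi (x *+ n) = epi x ^+ n.
Proof. by elim: n => [|n ih]; rewrite ?mulr0n ?epi0 // mulrS epiD ih exprS. Qed.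

Lemma epiXn (x : C) n : epi (x * n%:R) = epi x ^+ n.
Proof. by rewrite mulr_natr epiMn. Qed.

Lemma epiXz (x : C) (n : int) : epi (x * n%:~R) = epi x ^ n.
Proof.
case: n => n; first by rewrite -pmulrn epiXn.
by rewrite NegzE mulrNz mulrN epiN -pmulrn epiXn exprnN.
Qed.

Lemma epi_sqr (x : C) : epi (2 * x) = epi x ^+ 2.
Proof. by rewrite mulr2n mulrDl mul1r epiD. Qed.

Lemma epi2z (n : int) : epi (2 * n%:~R : C) = 1.
Proof. by rewrite epiXz epi2 exp1rz. Qed.

Lemma epi_mod2 (m : int) (x y : C) : x = y + 2 * m%:~R -> epi x = epi y.
Proof. by move=> ->; rewrite epiD epi2z mulr1. Qed.

Lemma epi_odd (m : int) (x y : C) : x = y + 1 + 2 * m%:~R -> epi x = - epi y.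
Proof. by move=> ->; rewrite !epiD epi2z mulr1 epi1 mulrN1. Qed.

Lemma normc_cexp (x : C) : normc (cexp x) = expR (complex.Re x).
Proof.
case: x => a b; rewrite /cexp normcM /=.
by rewrite expr0n /= addr0 sqrtr_sqr cos2Dsin2 sqrtr1 mulr1 ger0_norm ?expR_ge0.
Qed.

Lemma normc_epi (x : C) : normc (epi x) = expR (- (pi * complex.Im x)).
Proof. by case: x => a b; rewrite normc_cexp /= mul0r sub0r. Qed.

Lemma ltr_norm1 (x : C) : (`|x| < 1) = (normc x < 1).
Proof. by rewrite -ltcR. Qed.

Lemma Im_double (x : C) : complex.Im (2 * x) = 2 * complex.Im x.
Proof. by case: x => a b /=; rewrite mulr2n; ring. Qed.

Lemma epi_lt1_Im (tau : C) : `|epi (2 * tau)| < 1 -> 0 < complex.Im tau.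
Proof.
rewrite ltr_norm1 normc_epi -[ltRHS]expR0 ltr_expR oppr_lt0 Im_double.
by rewrite !pmulr_rgt0 ?pi_gt0.
Qed.

End Exponential.

Section BilateralSums.
Context {R : realType}.
Local Notation C := R[i].

Definition zr (n : nat) : seq int := [seq (k%:Z - n%:Z)%R | k <- iota 0 n.*2.+1].

Lemma mem_zr n (m : int) : (m \in zr n) = (`|m| <= n)%N.
Proof.
apply/mapP/idP => [[k]|h].
  by rewrite mem_iota => /andP[_ hk] ->; lia.
exists (absz (m + n%:Z)); last by lia.
by rewrite mem_iota; lia.
Qed.

Lemma zr_uniq n : uniq (zr n).
Proof. by rewrite map_inj_uniq ?iota_uniq // => a b; lia. Qed.

Lemma zr_sub n k : (n <= k)%N -> {subset zr n <= zr k}.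
Proof. by move=> nk m; rewrite !mem_zr => h; apply: leq_trans h nk. Qed.

Lemma zr_exhausts : exhausts zr.
Proof.
split=> [n|m]; first exact: zr_uniq.
by exists `|m|%N => n h; rewrite mem_zr.
Qed.

Lemma exhausts_map (I J : choiceType) (f : I -> J) (E : nat -> seq I) :
  bijective f -> exhausts E -> exhausts (fun n => [seq f i | i <- E n]).
Proof.
move=> bf [uE hE]; split=> [n|j]; first by rewrite map_inj_uniq //; apply: bij_inj.
have [g fK gK] := bf; have [n0 h0] := hE (g j); exists n0 => n hn.
by rewrite -(gK j) map_f // h0.
Qed.

Lemma le_subset_sum (I : choiceType) (g : I -> R) (E F : seq I) :
  (forall i, 0 <= g i) -> uniq E -> uniq F -> {subset F <= E} ->
  \sum_(i <- F) g i <= \sum_(i <- E) g i.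
Proof.
move=> g0 uE uF sFE; rewrite (big_subset _ _ uE uF sFE) /= lerDl.
by apply: sumr_ge0.
Qed.

Lemma geometric_le (r : R) n : 0 <= r -> r < 1 ->
  \sum_(i <- iota 0 n) r ^+ i <= (1 - r)^-1.
Proof.
move=> r0 r1; have d : 0 < 1 - r by lra.
rewrite -[leRHS]mul1r ler_pdivlMr // mulrC.
have -> : iota 0 n = index_iota 0 n by rewrite /index_iota subn0.
rewrite big_mkord.
have -> : (1 - r) * (\sum_(i < n) r ^+ i) = 1 - r ^+ n.
  by rewrite -[RHS]opprB subrX1 -mulNr opprB.
by rewrite gerBl exprn_ge0.
Qed.

Lemma summable_geometric (r : R) : 0 <= r -> r < 1 ->
  summable_by (fun n : nat => r ^+ n).
Proof.
move=> r0 r1; split=> [n|]; first exact: exprn_ge0.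
exists (1 - r)^-1 => F uF.
apply: le_trans (geometric_le (\max_(i <- F) i).+1 r0 r1).
apply: le_subset_sum => [i|||i iF]; rewrite ?iota_uniq ?exprn_ge0 //.
by rewrite mem_iota /= add0n ltnS; apply: leq_bigmax_seq.
Qed.

Lemma summableZ (I : choiceType) (g : I -> R) (K : R) :
  0 <= K -> summable_by g -> summable_by (fun i => K * g i).
Proof.
move=> K0 [g0 [B hB]]; split=> [i|]; first exact: mulr_ge0.
by exists (K * B) => F uF; rewrite -mulr_sumr; apply: ler_wpM2l => //; apply: hB.
Qed.

Lemma summable_bound_ge0 (I : choiceType) (g : I -> R) : summable_by g ->
  exists B, 0 <= B /\ forall F : seq I, uniq F -> \sum_(i <- F) g i <= B.
Proof.
move=> [g0 [B hB]]; exists B; split=> //.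
by have := hB [::] isT; rewrite big_nil.
Qed.

Lemma summable_prod (I J : choiceType) (g : I -> R) (h : J -> R) :
  summable_by g -> summable_by h ->
  summable_by (fun ij : I * J => g ij.1 * h ij.2).
Proof.
move=> sg sh; have [Bg [Bg0 hBg]] := summable_bound_ge0 sg.
have [Bh [Bh0 hBh]] := summable_bound_ge0 sh.
move: sg sh => [g0 _] [h0 _]; split=> [ij|]; first exact: mulr_ge0.
exists (Bg * Bh) => F uF.
pose E := [seq (i, j) | i <- undup (unzip1 F), j <- undup (unzip2 F)].
apply: le_trans (_ : _ <= \sum_(ij <- E) g ij.1 * h ij.2) _.
  apply: le_subset_sum => // [ij||ij ijF]; first exact: mulr_ge0.
    by apply: allpairs_uniq; rewrite ?undup_uniq // => -[a b] [c d] _ _ [-> ->].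
  case: ij ijF => i j ijF; apply: allpairs_f; rewrite mem_undup.
    by apply/mapP; exists (i, j).
  by apply/mapP; exists (i, j).
rewrite big_allpairs /=.
under eq_bigr do rewrite -mulr_sumr.
rewrite -mulr_suml; apply: ler_pM; rewrite ?sumr_ge0 //.
  by apply: hBg; apply: undup_uniq.
by apply: hBh; apply: undup_uniq.
Qed.

(** One fixed exponential majorant serves all theta series: Gaussian terms lie below a constant
    multiple of it, and its products over pairs of integers are again summable. *)
Definition decay (m : int) : R := expR (-1) ^+ `|m|%N.

Lemma decay_gt0 m : 0 < decay m.
Proof. by apply: exprn_gt0; apply: expR_gt0. Qed.

Lemma summable_decay : summable_by decay.
Proof.
have r0 : 0 <= expR (-1) :> R by apply: expR_ge0.
have r1 : expR (-1) < 1 :> R by rewrite -[ltRHS]expR0 ltr_expR; lra.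
split=> [m|]; first exact: ltW (decay_gt0 m).
have [_ [B hB]] := summable_geometric r0 r1.
exists (B + B) => F uF; rewrite (bigID (fun m : int => 0 <= m)) /=.
have half (P : pred int) : (forall a b, P a -> P b -> `|a|%N = `|b|%N -> a = b) ->
    \sum_(m <- F | P m) decay m <= B.
  move=> inj; rewrite -big_filter -(big_map absz xpredT (fun n => expR (-1) ^+ n)).
  apply: hB; rewrite map_inj_in_uniq ?filter_uniq // => a b.
  by rewrite !mem_filter => /andP[Pa _] /andP[Pb _]; apply: inj.
by apply: lerD; apply: half => a b; lia.
Qed.

Definition zlim (t : int -> C) (l : C) : Prop :=
  ccvg (fun n => \sum_(m <- zr n) t m) l.

Definition rapid (t : int -> C) : Prop :=
  exists K, 0 <= K /\ forall m, normc (t m) <= K * decay m.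

Lemma rapid_zlim t : rapid t -> exists l, zlim t l.
Proof.
move=> [K [K0 hK]]; apply: dominated_sum_ccvg hK zr_uniq zr_sub.
exact: summableZ K0 summable_decay.
Qed.

(** A bijection such as [m + 1] does not preserve the symmetric ranges [zr n], so the truncated sums
    differ; absolute convergence makes the difference tend to zero. *)
Lemma rapid_reindex t l (f : int -> int) :
  rapid t -> bijective f -> zlim t l -> zlim (t \o f) l.
Proof.
move=> [K [K0 hK]] bf hl; apply: ccvg_sub0 hl _.
have := dominated_exhaust (summableZ K0 summable_decay) hK
  (exhausts_map bf zr_exhausts) zr_exhausts.
by apply: ccvg_eq => n; rewrite big_map.
Qed.

Lemma zlim_eq t t' l : t =1 t' -> zlim t l -> zlim t' l.
Proof. by move=> /funext ->. Qed.

Lemma zlimZ a t l : zlim t l -> zlim (fun m => a * t m) (a * l).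
Proof.
move=> /(ccvgZ a); apply: ccvg_eq => n; exact: mulr_sumr.
Qed.

Lemma rapid_eq t t' : t =1 t' -> rapid t -> rapid t'.
Proof. by move=> /funext ->. Qed.

Lemma rapidZ a t : rapid t -> rapid (fun m => a * t m).
Proof.
move=> [K [K0 hK]]; exists (normc a * K); split; first exact: mulr_ge0 (normc_ge0 a) K0.
by move=> m; rewrite normcM -mulrA ler_wpM2l // normc_ge0.
Qed.

(* Completing the square: a quadratic exponent beats any linear one. *)
Lemma rapid_gauss (A B : C) : 0 < complex.Im A ->
  rapid (fun m : int => epi (A * m%:~R ^+ 2 + B * m%:~R)).
Proof.
move=> A0; pose b := pi * `|complex.Im B| + 1; pose a : R := pi * complex.Im A.
have a0 : 0 < a by rewrite mulr_gt0 // pi_gt0.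
exists (expR (b ^+ 2 / (4 * a))); split=> [|m]; first exact: expR_ge0.
rewrite normc_epi /decay -expRM_natl -expRD ler_expR.
have mE : m%:~R = (m%:~R : R)%:C :> C by rewrite rmorph_int.
have -> : complex.Im (A * m%:~R ^+ 2 + B * m%:~R) =
    complex.Im A * m%:~R ^+ 2 + complex.Im B * m%:~R.
  rewrite mE -rmorphXn /=; case: (A) (B) => x y [u v] /=; ring.
have mn : `|m%:~R : R| = `|m|%N%:R by rewrite -intr_norm natr_absz.
rewrite -[m%:~R ^+ 2]real_normK ?num_real // mn.
have : - (complex.Im B * m%:~R) <= `|complex.Im B| * `|m|%N%:R.
  by rewrite -mn -normrM -normrN ler_norm.
set y : R := `|m|%N%:R; set w := complex.Im B * _ => hw.
have hw' : - (pi * w) <= (b - 1) * y.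
  by rewrite /b addrK -mulrN -mulrA ler_wpM2l // pi_ge0.
suff : b * y <= a * y ^+ 2 + b ^+ 2 / (4 * a) by rewrite /a; lra.
rewrite -subr_ge0 (_ : _ - _ = (2 * a * y - b) ^+ 2 / (4 * a)).
  by apply: divr_ge0; rewrite ?sqr_ge0 //; lra.
by field; rewrite gt_eqF.
Qed.

End BilateralSums.

Section InfiniteProducts.
Context {R : realType}.
Local Notation C := R[i].

Lemma ccvg_sub (u : nat -> C) (l : C) (phi : nat -> nat) :
  (forall n, (n <= phi n)%N) -> ccvg u l -> ccvg (u \o phi) l.
Proof.
move=> hphi /ccvgP hu; apply/ccvgP => e /hu[n0 hn0]; exists n0 => n hn.
by apply: hn0; apply: leq_trans (hphi n).
Qed.

Lemma ccvgV (u : nat -> C) (l : C) : l != 0 -> ccvg u l ->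
  ccvg (fun n => (u n)^-1) l^-1.
Proof. by move=> l0 [h]; constructor; apply: (cvgV l0 h). Qed.

Lemma ccvg_bounded (u : nat -> C) (l : C) : ccvg u l ->
  exists B, 0 <= B /\ forall n, normc (u n) <= B.
Proof.
move=> /ccvgP /(_ 1 ltr01)[n0 h].
have S0 k : 0 <= \sum_(i < k) normc (u i) by apply: sumr_ge0 => i _; apply: normc_ge0.
have l0 := normc_ge0 l.
exists (\sum_(i < n0) normc (u i) + normc l + 1); split; first by have := S0 n0; lra.
move=> n; have [hn|hn] := ltnP n n0.
  have : normc (u n) <= \sum_(i < n0) normc (u i).
    rewrite (bigD1 (Ordinal hn)) //= lerDl; apply: sumr_ge0 => i _; exact: normc_ge0.
  lra.
have := h _ hn; have := le_normcD (u n - l) l; rewrite subrK; have := S0 n0; lra.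
Qed.

Section OneBase.
Variables (x a : C).
Hypothesis a1 : `|a| < 1.

Let a1' : normc a < 1. Proof. by rewrite -ltr_norm1. Qed.

Let qpoch_bound n :
  \sum_(i <- iota 0 n) normc (- (x * a ^+ i)) <= normc x * (1 - normc a)^-1.
Proof.
under eq_bigr do rewrite normcN normcM normcX.
rewrite -mulr_sumr ler_wpM2l ?normc_ge0 //.
exact: geometric_le (normc_ge0 _) a1'.
Qed.

Let iota_subset n k : (n <= k)%N -> {subset iota 0 n <= iota 0 k}.
Proof. by move=> nk i; rewrite !mem_iota /= !add0n => h; apply: leq_trans h nk. Qed.

Lemma qpoch_ccvg : ccvg (fun n => \prod_(m < n) (1 - x * a ^+ m)) (qpoch x a).
Proof.
have [l hl] := prod_ccvg (fun n => iota_uniq 0 n) iota_subset qpoch_bound.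
suff h : ccvg (fun n => \prod_(m < n) (1 - x * a ^+ m)) l.
  by rewrite /qpoch (ccvg_clim h).
apply: ccvg_eq hl => n.
by rewrite -(big_mkord xpredT (fun m => 1 - x * a ^+ m)) /index_iota subn0.
Qed.

Lemma qpoch_neq0 : (forall m, x * a ^+ m != 1) -> qpoch x a != 0.
Proof.
move=> h; apply: (prod_ccvg_neq0 (fun n => iota_uniq 0 n) iota_subset qpoch_bound).
  by move=> i; rewrite subr_eq0 eq_sym.
apply: ccvg_eq qpoch_ccvg => n.
by rewrite -(big_mkord xpredT (fun m => 1 - x * a ^+ m)) /index_iota subn0.
Qed.

End OneBase.

Lemma qpochS (x a : C) : `|a| < 1 -> qpoch x a = (1 - x) * qpoch (x * a) a.
Proof.
move=> a1; have h := proj2 (ccvg_shift _ _) (qpoch_ccvg x a1); apply: (ccvg_unique h).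
apply: ccvg_eq (ccvgZ (1 - x) (qpoch_ccvg (x * a) a1)) => n.
rewrite [RHS]big_ord_recl expr0 mulr1; congr (_ * _); apply: eq_bigr => i _.
by rewrite exprS mulrA.
Qed.

Section TwoBases.
Variables (x a b : C).
Hypotheses (a1 : `|a| < 1) (b1 : `|b| < 1).

Let a1' : normc a < 1. Proof. by rewrite -ltr_norm1. Qed.
Let b1' : normc b < 1. Proof. by rewrite -ltr_norm1. Qed.

Let box n k : seq (nat * nat) := [seq (i, j) | i <- iota 0 n, j <- iota 0 k].

Let mem_box n k i j : ((i, j) \in box n k) = (i < n)%N && (j < k)%N.
Proof.
apply/allpairsP/idP => [[[u v] /= [+ + [-> ->]]]|/andP[h1 h2]].
  by rewrite !mem_iota /= !add0n => -> ->.
by exists (i, j); rewrite /= !mem_iota /= !add0n.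
Qed.

Let box_uniq n k : uniq (box n k).
Proof. by apply: allpairs_uniq; rewrite ?iota_uniq // => -[? ?] [? ?] _ _ [-> ->]. Qed.

Let box_sub n k n' k' : (n <= n')%N -> (k <= k')%N -> {subset box n k <= box n' k'}.
Proof.
move=> h1 h2 [i j]; rewrite !mem_box => /andP[h3 h4].
by rewrite (leq_trans h3 h1) (leq_trans h4 h2).
Qed.

Let boxE n k (F : nat -> nat -> C) :
  \prod_(ij <- box n k) F ij.1 ij.2 = \prod_(m < n) \prod_(l < k) F m l.
Proof.
rewrite big_allpairs -(big_mkord xpredT (fun m => \prod_(l < k) F m l)).
rewrite /index_iota subn0; apply: eq_bigr => m _ /=.
by rewrite -(big_mkord xpredT (F m)) /index_iota subn0.
Qed.

Let term (ij : nat * nat) : C := - (x * a ^+ ij.1 * b ^+ ij.2).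

Let box_bound n k : \sum_(ij <- box n k) normc (term ij)
  <= normc x * ((1 - normc a)^-1 * (1 - normc b)^-1).
Proof.
rewrite (eq_bigr (fun ij => normc x * (normc a ^+ ij.1 * normc b ^+ ij.2))); last first.
  by move=> ij _; rewrite normcN !normcM !normcX mulrA.
rewrite -mulr_sumr ler_wpM2l ?normc_ge0 //.
rewrite big_allpairs /=; under eq_bigr do rewrite -mulr_sumr.
have e0 (r : R) m : 0 <= r -> 0 <= \sum_(i <- iota 0 m) r ^+ i.
  by move=> r0; apply: sumr_ge0 => i _; apply: exprn_ge0.
by rewrite -mulr_suml; apply: ler_pM; rewrite ?e0 ?normc_ge0 //;
  apply: geometric_le => //; apply: normc_ge0.
Qed.

(* The boxes n x n and n x (n+1) are interleaved into one increasing family. *)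
Let stair n := box n./2 (uphalf n).

Let stair_sub n k : (n <= k)%N -> {subset stair n <= stair k}.
Proof.
move=> nk; apply: box_sub; first exact: half_leq.
by rewrite !uphalf_half; lia.
Qed.

Let stair_ccvg : exists l, ccvg (fun n => \prod_(ij <- stair n) (1 + term ij)) l.
Proof.
exact: (prod_ccvg (fun n => box_uniq _ _) stair_sub (fun n => box_bound _ _)).
Qed.

(** The rectangles serve the functional equations: a square of size n+1 without its first row is an
    n by n+1 rectangle, and its products must have the same limit as those of the squares. *)
Lemma qpoch2_ccvg :
  ccvg (fun n => \prod_(m < n) \prod_(l < n) (1 - x * a ^+ m * b ^+ l)) (qpoch2 x a b)
  /\ ccvg (fun n => \prod_(m < n) \prod_(l < n.+1) (1 - x * a ^+ m * b ^+ l))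
       (qpoch2 x a b).
Proof.
have [l hl] := stair_ccvg.
have h1 : ccvg (fun n => \prod_(m < n) \prod_(l < n) (1 - x * a ^+ m * b ^+ l)) l.
  apply: ccvg_eq (ccvg_sub (phi := double) _ hl) => n; last by lia.
  rewrite /= /stair doubleK uphalf_double; exact: (boxE _ _ (fun m l => 1 - x * a ^+ m * b ^+ l)).
rewrite /qpoch2 (ccvg_clim h1); split=> //.
apply: ccvg_eq (ccvg_sub (phi := fun n => n.*2.+1) _ hl) => n; last by lia.
rewrite /= /stair /= uphalf_double doubleK; exact: (boxE _ _ (fun m l => 1 - x * a ^+ m * b ^+ l)).
Qed.

Lemma qpoch2_neq0 : (forall m l, x * a ^+ m * b ^+ l != 1) -> qpoch2 x a b != 0.
Proof.
move=> h; have [h1 _] := qpoch2_ccvg.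
apply: (prod_ccvg_neq0 (E := fun n => box n n) (fun n => box_uniq n n)
  (fun n k nk => box_sub nk nk) (fun n => box_bound n n)) => [i|].
  by rewrite subr_eq0 eq_sym.
by apply: ccvg_eq h1 => n; rewrite -(boxE _ _ (fun m l => 1 - x * a ^+ m * b ^+ l)).
Qed.

End TwoBases.

Lemma qpoch2Sl (x a b : C) : `|a| < 1 -> `|b| < 1 ->
  qpoch2 x a b = qpoch x b * qpoch2 (x * a) a b.
Proof.
move=> a1 b1; have [/(proj2 (ccvg_shift _ _)) h _] := qpoch2_ccvg x a1 b1.
have [_ h2] := qpoch2_ccvg (x * a) a1 b1.
have h1 := proj2 (ccvg_shift _ _) (qpoch_ccvg x b1).
apply: (ccvg_unique h); apply: ccvg_eq (ccvgM h1 h2) => n.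
rewrite [RHS]big_ord_recl; congr (_ * _).
  by apply: eq_bigr => i _; rewrite expr0 mulr1.
apply: eq_bigr => i _; apply: eq_bigr => j _.
by rewrite exprS mulrA.
Qed.

Lemma qpoch2C (x a b : C) : qpoch2 x a b = qpoch2 x b a.
Proof.
apply: (congr1 clim); apply/funext => n; rewrite [LHS]exchange_big.
by apply: eq_bigr => i _; apply: eq_bigr => j _; rewrite [in LHS]mulrAC.
Qed.

Lemma qpoch2Sr (x a b : C) : `|a| < 1 -> `|b| < 1 ->
  qpoch2 x a b = qpoch x a * qpoch2 (x * b) a b.
Proof.
move=> a1 b1; have h := qpoch2Sl x b1 a1.
by rewrite (qpoch2C x a b) (qpoch2C (x * b) a b).
Qed.

End InfiniteProducts.

(** * The theta function *)

Section Theta.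
Context {R : realType}.
Local Notation C := R[i].
Variable tau : C.
Hypothesis tau0 : 0 < complex.Im tau.

Definition theta_term (g1 g2 x : C) (m : int) : C :=
  epi ((m%:~R + g1) ^+ 2 * tau + 2 * (m%:~R + g1) * (x + g2)).

Lemma theta_partial g1 g2 x n :
  \sum_(k < n.*2.+1)
    (let m : C := k%:R - n%:R in
     cexp (Ipi * (m + g1) ^+ 2 * tau + 2 * Ipi * (m + g1) * (x + g2)))
  = \sum_(m <- zr n) theta_term g1 g2 x m.
Proof.
rewrite big_map -(big_mkord xpredT (fun k => let m : C := k%:R - n%:R in
   cexp (Ipi * (m + g1) ^+ 2 * tau + 2 * Ipi * (m + g1) * (x + g2)))).
rewrite /index_iota subn0; apply: eq_bigr => k _ /=.
rewrite /theta_term /epi intrB !pmulrn; congr cexp; ring.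
Qed.

Lemma theta_termE g1 g2 x m : theta_term g1 g2 x m =
  epi (g1 ^+ 2 * tau + 2 * g1 * (x + g2))
  * epi (tau * m%:~R ^+ 2 + (2 * g1 * tau + 2 * (x + g2)) * m%:~R).
Proof. by rewrite -epiD /theta_term; congr epi; ring. Qed.

Lemma rapid_theta g1 g2 x : rapid (theta_term g1 g2 x).
Proof.
apply: rapid_eq (fun m => esym (theta_termE g1 g2 x m)) _.
by apply: rapidZ; apply: rapid_gauss.
Qed.

Lemma theta_zlim g1 g2 x : zlim (theta_term g1 g2 x) (theta g1 g2 x tau).
Proof.
have [l hl] := rapid_zlim (rapid_theta g1 g2 x).
have h := ccvg_eq (fun n => esym (theta_partial g1 g2 x n)) hl.
by rewrite /theta (ccvg_clim h).
Qed.

Lemma zlim_unique (t : int -> C) l l' : zlim t l -> zlim t l' -> l = l'.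
Proof. exact: ccvg_unique. Qed.

(** The odd Jacobi theta function; [theta_char] reduces all other characteristics to it. *)
Definition th (x : C) : C := theta 2^-1 2^-1 x tau.

Definition th_term := theta_term 2^-1 2^-1.

Lemma theta_char a b x : theta (2^-1 + a) (2^-1 + b) x tau =
  epi (a ^+ 2 * tau + 2 * a * (x + 2^-1 + b)) * th (x + a * tau + b).
Proof.
apply: (zlim_unique (theta_zlim _ _ _)).
apply: zlim_eq (zlimZ _ (theta_zlim _ _ _)) => m.
by rewrite /theta_term -epiD; congr epi; ring.
Qed.

Lemma th1 x : th (x + 1) = - th x.
Proof.
apply: (zlim_unique (theta_zlim _ _ _)); rewrite -(mulN1r (th x)).
apply: zlim_eq (zlimZ _ (theta_zlim _ _ _)) => m.
by rewrite mulN1r /theta_term; apply/esym/(@epi_odd _ m); field.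
Qed.

Lemma thtau x : th (x + tau) = - epi (- tau - 2 * x) * th x.
Proof.
have bf : bijective (fun m : int => m + 1).
  by exists (fun m => m - 1) => m; rewrite ?addrK ?subrK.
apply: (zlim_unique (theta_zlim _ _ _)).
have h := rapid_reindex (rapid_theta 2^-1 2^-1 x) bf (theta_zlim 2^-1 2^-1 x).
apply: zlim_eq (zlimZ _ h) => m.
rewrite /theta_term /= mulNr -epiD; apply/esym/(@epi_odd _ (-1)).
by rewrite intrD mulrN1z; field.
Qed.

Lemma thN x : th (- x) = - th x.
Proof.
have bf : bijective (fun m : int => - 1 - m).
  by exists (fun m => - 1 - m) => m; rewrite opprB addrCA subrr addr0.
apply: (zlim_unique (theta_zlim _ _ _)); rewrite -(mulN1r (th x)).
have h := rapid_reindex (rapid_theta 2^-1 2^-1 x) bf (theta_zlim 2^-1 2^-1 x).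
apply: zlim_eq (zlimZ _ h) => m.
rewrite /theta_term /= mulN1r; apply/esym/(@epi_odd _ m).
by rewrite intrB mulrN1z; field.
Qed.

Lemma th0 : th 0 = 0.
Proof.
have : th 0 *+ 2 = 0 by rewrite mulr2n -{1}oppr0 thN addNr.
by move/eqP; rewrite mulrn_eq0 => /eqP.
Qed.

(** If [s] and [d] are the sum and the difference of the two half-integer summation indices, a term
    of [th (a + b) * th (a - b)] is [(-1)^s * F s a * F d b]. As [s] and [d] have opposite parity,
    the even part [Fe] and the odd part [Fo] suffice. *)
Let F (s a : C) : C := epi (tau * (s ^+ 2 / 2) + 2 * s * a).
Let Fe a (j : int) := F (2 * j%:~R) a.
Let Fo a (j : int) := F (2 * j%:~R + 1) a.

Let rapid_Fe a : rapid (Fe a).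
Proof.
have h : 0 < complex.Im (2 * tau) by rewrite Im_double mulr_gt0.
apply: rapid_eq (rapid_gauss (4 * a) h) => m.
by rewrite /Fe /F; congr epi; field.
Qed.

Let rapid_Fo a : rapid (Fo a).
Proof.
have h : 0 < complex.Im (2 * tau) by rewrite Im_double mulr_gt0.
apply: rapid_eq (rapidZ (epi (tau / 2 + 2 * a)) (rapid_gauss (2 * tau + 4 * a) h)) => m.
by rewrite /Fo /F -epiD; congr epi; field.
Qed.

Let diag (n : nat) : seq (int * int) :=
  [seq (i + j, i - j - 1) | i <- zr n, j <- zr n]
  ++ [seq (i + j, i - j) | i <- zr n, j <- zr n].

Let square (n : nat) : seq (int * int) := [seq (i, j) | i <- zr n, j <- zr n].

Let square_exhausts : exhausts square.
Proof.
split=> [n|[i j]].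
  by apply: allpairs_uniq; rewrite ?zr_uniq // => -[? ?] [? ?] _ _ [-> ->].
exists (`|i| + `|j|)%N => n hn; apply: allpairs_f; rewrite mem_zr; lia.
Qed.

Let diag_exhausts : exhausts diag.
Proof.
split=> [n|[a b]].
  rewrite cat_uniq !allpairs_uniq ?zr_uniq //; last 2 first.
  - by move=> [a b] [c d] _ _ /= [h1 h2]; congr (_, _); lia.
  - by move=> [a b] [c d] _ _ /= [h1 h2]; congr (_, _); lia.
  rewrite andbT; apply/hasPn => -[a b] /allpairsP[[i j] /= [_ _ [-> ->]]].
  apply/negP => h.
  have /allpairsP[[k l] /= [_ _ []]] :
    (i + j, i - j) \in [seq (i + j, i - j - 1) | i <- zr n, j <- zr n] := h.
  lia.
exists (`|a| + `|b|).+2 => n hn; rewrite mem_cat.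
have [k [hk|hk]] : exists k : int, a - b = 2 * k + 1 \/ a - b = 2 * k.
  exists ((a - b) %/ 2)%Z; lia.
- apply/orP; left; apply/allpairsP; exists (a - k, k); rewrite /= !mem_zr.
  by split; try congr (_, _); lia.
- apply/orP; right; apply/allpairsP; exists (a - k, k); rewrite /= !mem_zr.
  by split; try congr (_, _); lia.
Qed.

(* The summation indices of the product of two series are [i + j] and [i - j]
   when they have the same parity, [i + j] and [i - j - 1] otherwise. *)
Lemma th_plucker : exists f g : C -> C,
  forall a b, th (a + b) * th (a - b) = f a * g b - g a * f b.
Proof.
have he a := rapid_zlim (rapid_Fe a); have ho a := rapid_zlim (rapid_Fo a).
pose f a := xget 0 [set l | zlim (Fe a) l]%classic.
pose g a := xget 0 [set l | zlim (Fo a) l]%classic.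
have hf a : zlim (Fe a) (f a).
  by have [l hl] := he a; apply: (@xgetPex _ 0 [set l | zlim (Fe a) l]%classic); exists l.
have hg a : zlim (Fo a) (g a).
  by have [l hl] := ho a; apply: (@xgetPex _ 0 [set l | zlim (Fo a) l]%classic); exists l.
exists f, g => a b.
pose T (ij : int * int) := th_term (a + b) ij.1 * th_term (a - b) ij.2.
have h1 := ccvgM (theta_zlim 2^-1 2^-1 (a + b)) (theta_zlim 2^-1 2^-1 (a - b)).
have h2 := ccvgB (ccvgM (hf a) (hg b)) (ccvgM (hg a) (hf b)).
apply: (ccvg_unique h1); apply: ccvg_sub0 h2 _.
have [K [K0 hK]] := rapid_theta 2^-1 2^-1 (a + b).
have [K' [K0' hK']] := rapid_theta 2^-1 2^-1 (a - b).
have hT ij : normc (T ij) <= K * K' * (decay ij.1 * decay ij.2).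
  rewrite /T normcM [leRHS]mulrACA; apply: ler_pM; rewrite ?normc_ge0 //.
have sT := summableZ (mulr_ge0 K0 K0') (summable_prod (@summable_decay R) (@summable_decay R)).
apply: ccvg_eq (dominated_exhaust sT hT square_exhausts diag_exhausts) => n.
congr (_ - _).
  rewrite big_allpairs mulr_suml; apply: eq_bigr => i _.
  by rewrite mulr_sumr.
rewrite big_cat !big_allpairs_dep /=.
have TE1 (i j : int) : T (i + j, i - j - 1) = Fe a i * Fo b j.
  rewrite /T /th_term /theta_term /Fe /Fo /F /= -!epiD; apply: (@epi_mod2 _ i).
  by rewrite !intrB !intrD; field.
have TE2 (i j : int) : T (i + j, i - j) = - (Fo a i * Fe b j).
  rewrite /T /th_term /theta_term /Fe /Fo /F /= -!epiD; apply: (@epi_odd _ i).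
  by rewrite !intrB !intrD; field.
congr (_ + _).
  by rewrite mulr_suml; apply: eq_bigr => i _; rewrite mulr_sumr; apply: eq_bigr.
rewrite mulr_suml -sumrN; apply: eq_bigr => i _; rewrite mulr_sumr -sumrN.
exact: eq_bigr.
Qed.

(** By [th_plucker] each [th (x + y) * th (x - y)] is a 2 by 2 minor of the 2 by 4 matrix with
    columns [(f, g)] at [a, b, c, d]; the claim is the Plücker relation between these minors. *)
Lemma th_three_term a b c d :
  th (a + b) * th (a - b) * (th (c + d) * th (c - d))
  - th (a + c) * th (a - c) * (th (b + d) * th (b - d))
  + th (a + d) * th (a - d) * (th (b + c) * th (b - c)) = 0.
Proof. have [f [g h]] := th_plucker; rewrite !h; ring. Qed.

End Theta.

(** * Jacobi's triple product and the zeros of theta *)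

Section TripleProduct.
Context {R : realType}.
Local Notation C := R[i].
Variable tau : C.
Let p : C := epi (2 * tau).
Hypothesis p1 : `|p| < 1.

Let pf (k : nat) : C := \prod_(i < k) (1 - p * p ^+ i).

Let pX_neq1 k : p * p ^+ k != 1.
Proof.
rewrite -exprS; apply/eqP => /(congr1 (@normc R)).
rewrite normcX normc1 => /eqP; rewrite lt_eqF //.
by apply: exprn_ilt1; rewrite ?normc_ge0 // -ltr_norm1.
Qed.

Let pfS k : pf k.+1 = pf k * (1 - p * p ^+ k).
Proof. by rewrite /pf big_ord_recr. Qed.

Let pf0 : pf 0 = 1. Proof. exact: big_ord0. Qed.

Let pf_neq0 k : pf k != 0.
Proof.
apply/prodf_neq0 => i _; rewrite subr_eq0 eq_sym; exact: pX_neq1.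
Qed.

Let pf_lim : ccvg pf (qpoch p p). Proof. exact: qpoch_ccvg. Qed.

Let P_neq0 : qpoch p p != 0. Proof. by apply: qpoch_neq0. Qed.

(** The Gaussian binomial coefficient at base [p]. Its value 0 beyond [M] makes the Pascal rule
    [gbinS] hold also at [j = M]. *)
Let gbin (M j : nat) : C :=
  if (j <= M)%N then pf M / (pf j * pf (M - j)) else 0.

Let gbin0 M : gbin M 0 = 1.
Proof. by rewrite /gbin /= subn0 pf0 mul1r divff. Qed.

Let gbinS M j : (j <= M)%N ->
  gbin M.+1 j.+1 = gbin M j.+1 + p ^+ (M - j) * gbin M j.
Proof.
move=> jM; rewrite /gbin ltnS jM subSS.
have fS k : 1 - p * p ^+ k != 0 by rewrite subr_eq0 eq_sym.
have [->|jM'] := eqVneq j M.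
  by rewrite ltnn subnn expr0 mul1r add0r pf0 !mulr1 !divff.
have {jM jM'} jM : (j < M)%N by rewrite ltn_neqAle jM'.
rewrite jM; have -> : (M - j = (M - j.+1).+1)%N by lia.
have pE : p ^+ M = p ^+ (M - j.+1).+1 * p ^+ j by rewrite -exprD; congr (_ ^+ _); lia.
rewrite !pfS pE; move: (fS j) (fS (M - j.+1)%N) (pf_neq0 j) (pf_neq0 (M - j.+1)).
rewrite exprS; set a := pf j; set b := pf (M - j.+1); set x := p ^+ j.
set y := p ^+ (M - j.+1) => *; field.
by do !(apply/andP; split).
Qed.

(** The q-binomial theorem at base [p], with powers written as exponents of [epi]. *)
Let gbin_thm M (y : C) :
  \prod_(k < M) (1 + epi (y + 2 * tau * k%:R)) =
  \sum_(j < M.+1) gbin M j * epi (tau * (j%:R ^+ 2 - j%:R) + j%:R * y).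
Proof.
elim: M => [|M ih].
  rewrite big_ord0 big_ord_recl big_ord0 gbin0 /= addr0 mul1r mulr0n expr0n /=.
  by rewrite subrr mulr0 mul0r addr0 epi0.
rewrite big_ord_recr ih /= [RHS]big_ord_recl gbin0.
under [X in _ = _ + X]eq_bigr => j _.
  rewrite lift0 gbinS; last by rewrite -ltnS.
  rewrite mulrDl; over.
rewrite /= big_split /= addrA mulrDr mulr1; congr (_ + _).
  rewrite big_ord_recl gbin0; congr (_ + _); rewrite [RHS]big_ord_recr /=.
  have g0 : gbin M (bump 0 M) = 0 by rewrite /gbin /bump /= add1n ltnn.
  rewrite g0 mul0r addr0; apply: eq_bigr => j _.
  by rewrite ?/bump /= ?add1n.
rewrite mulr_suml; apply: eq_bigr => j _.
rewrite -[LHS]mulrA [X in _ = X * _]mulrC -[RHS]mulrA; congr (_ * _).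
rewrite /p -epiXn -!epiD; congr epi; rewrite natrB; last by rewrite -ltnS.
by rewrite -natr1; ring.
Qed.

Section AtPoint.
Variable x : C.
Let u := epi (2 * x).

Let E (m : int) : C := epi (tau * (m%:~R ^+ 2 + m%:~R) + (2 * x + 1) * m%:~R).

Let prefix n : \prod_(e < n) epi (2 * x + 1 - 2 * tau * e%:R) =
  epi (n%:R * (2 * x + 1) - tau * (n%:R ^+ 2 - n%:R)).
Proof.
elim: n => [|n ih]; first by rewrite big_ord0 -[LHS]epi0; congr epi; ring.
by rewrite big_ord_recr /= ih -epiD; congr epi; rewrite -natr1; ring.
Qed.

Let finite_triple n :
  (\prod_(e < n) (1 - u^-1 * p ^+ e)) * \prod_(k < n) (1 - p * u * p ^+ k)
  = \sum_(m <- zr n) gbin n.*2 (absz (m + n%:Z)) * E m.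
Proof.
(* With this [y] the [k]-th of the [2n] factors is [1 - u * p^(k + 1 - n)]. The last [n] factors are
   already those wanted; the first [n], read backwards, are monomials times [1 - u^-1 * p^e], and
   the monomials are collected by [prefix]. *)
have := gbin_thm n.*2 (2 * x + 1 + 2 * tau * (1 - n%:R)).
rewrite -addnn big_split_ord /=.
pose G (e : nat) := epi (2 * x + 1 - 2 * tau * e%:R) * (1 - u^-1 * p ^+ e).
under [X in X * _]eq_bigr => k _.
  rewrite (_ : 1 + _ = G (n - k.+1)%N); last first.
    rewrite /G [RHS]mulrBr mulr1 /u /p -epiXn -epiN -!epiD [LHS]addrC natrB //.
    congr (_ + _); first by congr epi; rewrite -natr1; ring.
    by rewrite -[LHS]epi0; apply: (@epi_odd _ (-1)); rewrite mulrN1z; ring.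
  over.
have -> : \prod_(k < n) G (n - k.+1)%N = \prod_(k < n) G k.
  by rewrite [RHS](reindex_inj rev_ord_inj).
rewrite /G big_split /= prefix.
have -> : \prod_(k < n) (1 + epi (2 * x + 1 + 2 * tau * (1 - n%:R) +
    2 * tau * (n + k)%:R)) = \prod_(k < n) (1 - p * u * p ^+ k).
  apply: eq_bigr => k _; congr (1 + _); rewrite /u /p -epiXn -!epiD.
  by apply: (@epi_odd _ 0); rewrite mulr0z natrD; ring.
move=> /= h.
set A := epi _ in h; have A0 : A != 0 by apply: epi_neq0.
apply: (mulfI A0); rewrite mulrA h big_map mulr_sumr addnn.
rewrite -(big_mkord xpredT (fun j => gbin n.*2 j * epi (tau * (j%:R ^+ 2 - j%:R) +
  j%:R * (2 * x + 1 + 2 * tau * (1 - n%:R))))).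
rewrite /index_iota subn0; apply: eq_bigr => k _.
rewrite subrK /= mulrCA; congr (_ * _); rewrite /A /E -epiD; congr epi.
rewrite intrB -!pmulrn; ring.
Qed.

Let tau0 : 0 < complex.Im tau. Proof. exact: epi_lt1_Im. Qed.

Let E_rapid : rapid E.
Proof.
apply: rapid_eq (rapid_gauss (tau + 2 * x + 1) tau0) => m.
by rewrite /E; congr epi; ring.
Qed.

Let gbin_bound : exists B, 0 <= B /\ forall M j, normc (gbin M j) <= B.
Proof.
have [B1 [B10 h1]] := ccvg_bounded pf_lim.
have [B2 [B20 h2]] := ccvg_bounded (ccvgV P_neq0 pf_lim).
exists (B1 * (B2 * B2)); split=> [|M j]; first by rewrite !mulr_ge0.
rewrite /gbin; case: ifP => _; last by rewrite normc0 !mulr_ge0.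
rewrite invfM !normcM; apply: ler_pM; rewrite ?mulr_ge0 ?normc_ge0 //.
by apply: ler_pM; rewrite ?normc_ge0.
Qed.

Let gbin_lim (m : int) :
  ccvg (fun n => gbin n.*2 (absz (m + n%:Z))) (qpoch p p)^-1.
Proof.
have hP := ccvgV P_neq0 pf_lim.
have shifted (f : nat -> nat) : (forall n, (n <= f n + `|m|)%N) -> forall (v : nat -> C) l,
    ccvg v l -> ccvg (fun n => v (f n)) l.
  move=> hf v l /ccvgP hv; apply/ccvgP => e /hv[n0 h0].
  exists (n0 + `|m|)%N => n hn; apply: h0; have := hf n; lia.
have h1 := shifted double (fun n => ltac:(lia)) _ _ pf_lim.
have h2 := shifted (fun n => absz (m + n%:Z)) (fun n => ltac:(lia)) _ _ hP.
have h3 := shifted (fun n => (n.*2 - absz (m + n%:Z)%R)%N) (fun n => ltac:(lia)) _ _ hP.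
have := ccvgM h1 (ccvgM h2 h3); rewrite mulrA divff // mul1r.
move=> /ccvgP h; apply/ccvgP => e /h[n0 h0].
exists (n0 + `|m|)%N => n hn; rewrite /gbin ifT; last by lia.
by rewrite invfM; apply: h0; lia.
Qed.

(** Jacobi's triple product: in [finite_triple] the Gaussian binomials stay bounded and tend to
    [1 / (p; p)_oo], so [tannery] takes the limit inside the sum. *)
Lemma th_product : th tau x = epi (tau / 4 + x + 2^-1) *
  (qpoch p p * (qpoch u^-1 p * qpoch (p * u) p)).
Proof.
have [S hS] := rapid_zlim E_rapid.
have -> : th tau x = epi (tau / 4 + x + 2^-1) * S.
  apply: (zlim_unique (theta_zlim tau0 _ _ _)); apply: zlim_eq (zlimZ _ hS) => m.
  by rewrite /E /theta_term -epiD; congr epi; field.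
congr (_ * _); rewrite -[LHS]mul1r -(divff P_neq0) -mulrA; congr (_ * _).
have [K [K0 hK]] := E_rapid; have [B [B0 hB]] := gbin_bound.
have sg := summableZ (mulr_ge0 B0 K0) (@summable_decay R).
have bnd n m : normc (gbin n.*2 (absz (m + n%:Z)) * E m) <= B * K * decay m.
  by rewrite normcM -mulrA; apply: ler_pM; rewrite ?normc_ge0.
(* The limiting terms inherit the bound of the terms that converge to them; [tannery] asks for both
   bounds. *)
have bnd' m : normc ((qpoch p p)^-1 * E m) <= B * K * decay m.
  rewrite leNgt; apply/negP => lt.
  have e0 : 0 < normc ((qpoch p p)^-1 * E m) - B * K * decay m by rewrite subr_gt0.
  have /ccvgP /(_ _ e0)[n0 /(_ n0 (leqnn _))] := ccvgM (gbin_lim m) (ccvg_cst (E m)).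
  set a := gbin _ _ * _; set b := _^-1 * _ => hab.
  have := le_normcD (b - a) a; rewrite subrK normcB.
  have : normc a <= B * K * decay m by apply: bnd.
  move=> h1 h2; move: (le_lt_trans h2 (ltr_leD hab h1)).
  by rewrite subrK ltxx.
have T := tannery sg bnd' (fun n m _ => bnd n m)
  (fun m => ccvgM (gbin_lim m) (ccvg_cst (E m))) zr_exhausts.
apply: (ccvg_unique _ (ccvgM (qpoch_ccvg u^-1 p1) (qpoch_ccvg (p * u) p1))).
have /(ccvgZ (qpoch p p)^-1) hS' := hS.
have := ccvgD hS' T; rewrite addr0; apply: ccvg_eq => n.
by rewrite finite_triple mulr_sumr addrC subrK.
Qed.

End AtPoint.

Lemma pz_iff (v : C) : (forall k : int, v != p ^ k) ->
  (forall m, v^-1 * p ^+ m != 1) /\ (forall m, p * v * p ^+ m != 1).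
Proof.
move=> h; split=> m.
  apply: contra (h m%:Z) => /eqP e.
  have v0 : v != 0 by apply/eqP => v0; move/eqP: e; rewrite v0 invr0 mul0r eq_sym oner_eq0.
  by apply/eqP; rewrite -[LHS]mulr1 -e mulrA divff // mul1r.
apply: contra (h (- m.+1%:Z)) => /eqP e; apply/eqP.
have pm : p ^+ m.+1 != 0 by rewrite expf_neq0 // epi_neq0.
by apply: (mulIf pm); rewrite -exprnN mulVf // -e exprS; ring.
Qed.

Lemma th_neq0 x : (forall k : int, epi (2 * x) != p ^ k) -> th tau x != 0.
Proof.
move=> /pz_iff[h1 h2]; rewrite th_product mulf_neq0 ?epi_neq0 // mulf_neq0 //.
by rewrite mulf_neq0 // qpoch_neq0.
Qed.

Lemma th_eq0P x : th tau x = 0 -> exists k : int, epi (2 * x) = p ^ k.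
Proof.
move=> h; apply: contrapT => hn.
have : th tau x != 0 by apply: th_neq0 => k; apply/eqP => e; apply: hn; exists k.
by rewrite h eqxx.
Qed.

End TripleProduct.

(** * Elliptic partial fractions from the three-term identity *)

Section PartialFractions.
Context {K : fieldType}.
Variable t : K -> K.
Hypothesis t0 : t 0 = 0.
Hypothesis t_fay : forall z a b x y : K,
  t (x + y - a - b) * t (x - y) * (t (z - a) * t (z - b)) =
  t (z + y - a - b) * t (z - y) * (t (x - a) * t (x - b))
  - t (z + x - a - b) * t (z - x) * (t (y - a) * t (y - b)).
Hypothesis tN : forall x, t (- x) = - t x.
Hypothesis t_zeroB : forall x y, t x = 0 -> t y = 0 -> t (x - y) = 0.

Let residue (xs ys : seq K) (x : K) : K :=
  (\prod_(y <- ys) t (x - y)) / \prod_(x' <- xs | x' != x) t (x - x').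

(** Partial fractions for a quotient with poles [xs] and zeros [ys]. With [t u] kept on the left the
    statement also covers [t u = 0]; [u] is unchanged when a common pole and zero are removed. *)
Let expansion (xs ys : seq K) : Prop :=
  let u := \sum_(x <- xs) x - \sum_(y <- ys) y in
  forall z, {in xs, forall x, t (z - x) != 0} ->
  t u * ((\prod_(y <- ys) t (z - y)) / \prod_(x <- xs) t (z - x)) =
  \sum_(x <- xs) t (z - x + u) / t (z - x) * residue xs ys x.

(** A zero that sits on a pole cancels it, and the residue there vanishes because [t 0 = 0]. *)
Let expansion_cancel (xs ys : seq K) (a : K) :
  uniq xs -> a \in xs -> {in xs &, forall x y, x != y -> t (x - y) != 0} ->
  expansion (rem a xs) ys -> expansion xs (a :: ys).
Proof.
move=> uxs axs hxs ih u z hz.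
have zr : {in rem a xs, forall x, t (z - x) != 0}.
  by move=> x /mem_rem; apply: hz.
have uE : u = \sum_(x <- rem a xs) x - \sum_(y <- ys) y.
  by rewrite /u (big_rem a axs) big_cons /= opprD addrACA subrr add0r.
have {ih} := ih z zr; rewrite -uE => ih.
rewrite (big_rem a axs) /= [in RHS](big_rem a axs) /= big_cons.
have -> : residue xs (a :: ys) a = 0.
  by rewrite /residue big_cons subrr t0 !mul0r.
rewrite mulr0 add0r invfM mulrACA divff ?hz // mul1r ih.
rewrite [LHS]big_seq [RHS]big_seq; apply: eq_bigr => x xr; congr (_ * _).
have xa : x != a by move: xr; rewrite (mem_rem_uniq _ uxs) inE => /andP[].
rewrite /residue (big_rem a axs) /= eq_sym xa big_cons invfM mulrACA divff ?mul1r //.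
by apply: hxs => //; apply: mem_rem xr.
Qed.

(** For a fixed sum [a + b], the functions [t (w - a) * t (w - b)] of [w] span at most two
    dimensions, by the three-term identity. The zeros [a, b] can therefore be traded for a pair
    containing [x] and a pair containing [y]; taking [x] and [y] among the poles makes both
    cancel. *)
Let expansion_swap (xs ys : seq K) (a b x x' y y' : K) :
  x + x' = a + b -> y + y' = a + b ->
  t (x + y - a - b) * t (x - y) != 0 ->
  expansion xs (x :: x' :: ys) -> expansion xs (y :: y' :: ys) ->
  expansion xs (a :: b :: ys).
Proof.
move=> ex ey c0 hx hy u z hz; have := hx z hz; have := hy z hz.
have uE (v v' : K) : v + v' = a + b ->
    \sum_(x <- xs) x - \sum_(y <- v :: v' :: ys) y = u.
  by move=> e; rewrite /u !big_cons !addrA e.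
rewrite !uE //; set c := _ * _ in c0.
pose cx := t (x - a) * t (x - b); pose cy := t (y - a) * t (y - b).
have fay w : t (w - a) * t (w - b) =
    c^-1 * (cx * (t (w - y) * t (w - y')) - cy * (t (w - x) * t (w - x'))).
  have := t_fay w a b x y; rewrite -/c -/cx -/cy => e; apply: (mulfI c0).
  have -> : w - x' = w + x - a - b by rewrite -addrA -opprD -ex; ring.
  have -> : w - y' = w + y - a - b by rewrite -addrA -opprD -ey; ring.
  by rewrite e mulVKf //; ring.
have resE w : residue xs (a :: b :: ys) w =
    c^-1 * (cx * residue xs (y :: y' :: ys) w - cy * residue xs (x :: x' :: ys) w).
  by rewrite /residue !big_cons !mulrA fay; ring.
rewrite !big_cons; set P := \prod_(y <- ys) _; set Q := (\prod_(x <- xs) _)^-1.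
move=> hy' hx'; under [in RHS]eq_bigr do rewrite resE.
have -> : t u * (t (z - a) * (t (z - b) * P) * Q) =
    c^-1 * (cx * (t u * (t (z - y) * (t (z - y') * P) * Q)) -
            cy * (t u * (t (z - x) * (t (z - x') * P) * Q))).
  by rewrite [t (z - a) * _]mulrA fay; ring.
rewrite hx' hy' !mulr_sumr -sumrB mulr_sumr; apply: eq_bigr => w _; ring.
Qed.

(** Induction on the number of poles by [expansion_swap] and [expansion_cancel]. The swap requires
    [t (x + y - a - b) != 0] for some pair of poles. With three poles, failure for two pairs sharing
    a pole would make the other two poles congruent, by [t_zeroB]. With two poles the claim is the
    three-term identity itself. *)
Lemma partial_fractions (xs ys : seq K) :
  size xs = size ys -> uniq xs -> {in xs &, forall x y, x != y -> t (x - y) != 0} ->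
  let u := \sum_(x <- xs) x - \sum_(y <- ys) y in
  forall z, {in xs, forall x, t (z - x) != 0} ->
  t u * ((\prod_(y <- ys) t (z - y)) / \prod_(x <- xs) t (z - x)) =
  \sum_(x <- xs) t (z - x + u) / t (z - x) *
    ((\prod_(y <- ys) t (x - y)) / \prod_(x' <- xs | x' != x) t (x - x')).
Proof.
move: ys; have [n] := ubnP (size xs); elim: n xs => // n ih xs hn ys sz uxs hxs.
rewrite -/(expansion xs ys).
have ih' (a : K) (ys' : seq K) : a \in xs -> size xs = (size ys').+1 ->
    expansion xs (a :: ys').
  move=> axs sz'; apply: expansion_cancel => //; apply: ih.
  - by rewrite size_rem // sz' /=; move: hn; rewrite sz' ltnS.
  - by rewrite size_rem // sz'.
  - exact: rem_uniq.
  - by move=> x y /mem_rem xx /mem_rem yy; apply: hxs.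
case: ys sz => [|a [|b ys]] sz.
- move: sz; case: xs {hn uxs hxs ih'} => // _ u z hz.
  by rewrite /u !big_nil subrr t0 mul0r.
- move: sz; case: xs {hn uxs hxs ih'} => [|x []] // _ u z hz.
  rewrite /u /residue !big_cons !big_nil eqxx !addr0 !mulr1 invr1 mulr1 addrA subrK.
  by ring.
case: xs hn uxs hxs ih' sz => [|x [|y xs]] hn uxs hxs ih' //= sz.
have xy : x != y by move: uxs; rewrite /= inE negb_or -andbA => /andP[].
have txy : t (x - y) != 0 by apply: hxs => //; rewrite !inE eqxx ?orbT.
have swap v w : v \in x :: y :: xs -> w \in x :: y :: xs -> v != w ->
    t (v + w - a - b) != 0 -> expansion (x :: y :: xs) (a :: b :: ys).
  move=> vx wx vw h; apply: (expansion_swap (x := v) (x' := a + b - v)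
    (y := w) (y' := a + b - w)); rewrite ?subrKC //.
  - by rewrite mulf_neq0 // hxs.
  - by apply: ih'; rewrite //= -sz.
  - by apply: ih'; rewrite //= -sz.
case: xs hn uxs hxs ih' sz swap => [|x' xs] hn uxs hxs ih' sz swap.
  case: ys sz ih' swap => // _ _ _.
  move=> z hz; set u := \sum_(x' <- _) x' - \sum_(y' <- _) y'.
  have tx : t (z - x) != 0 by apply: hz; rewrite !inE eqxx.
  have ty : t (z - y) != 0 by apply: hz; rewrite !inE eqxx orbT.
  have := t_fay z a b x y.
  rewrite /residue !big_cons !big_nil !mulr1 !addr0 !eqxx eq_sym xy /=.
  rewrite -(opprB x y) tN.
  have -> : z - x + u = z + y - a - b by rewrite /u !big_cons !big_nil; ring.
  have -> : z - y + u = z + x - a - b by rewrite /u !big_cons !big_nil; ring.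
  have -> : u = x + y - a - b by rewrite /u !big_cons !big_nil; ring.
  move=> e.
  have -> : forall w, t (x + y - a - b) * w = (t (x + y - a - b) * t (x - y) * w) / t (x - y).
    by move=> w; field.
  rewrite mulrA e; field.
  by rewrite oppr_eq0 tx ty txy.
have [h1|h1] := eqVneq (t (x + y - a - b)) 0; last first.
  by apply: (swap x y); rewrite ?inE ?eqxx ?orbT.
have [h2|h2] := eqVneq (t (x + x' - a - b)) 0; last first.
  apply: (swap x x'); rewrite ?inE ?eqxx ?orbT //.
  by move: uxs; rewrite /= !inE !negb_or => /andP[/and3P[]].
have := t_zeroB h1 h2; have -> : x + y - a - b - (x + x' - a - b) = y - x' by ring.
move=> h; have yx' : y != x' by move: uxs; rewrite /= !inE !negb_or => /and3P[_ /andP[]].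
have : t (y - x') != 0 by apply: hxs; rewrite ?inE ?eqxx ?orbT.
by rewrite h eqxx.
Qed.

End PartialFractions.

Section RootsOfUnity.
Context {R : realType}.
Local Notation C := R[i].
Variable N : nat.
Hypothesis N_gt0 : (0 < N)%N.
Local Notation om := (@omega R N).

Lemma NC_neq0 : N%:R != 0 :> C.
Proof. by rewrite pnatr_eq0 -lt0n. Qed.

Lemma omegaX j : om ^+ j = epi (2 * (j%:R / N%:R)).
Proof. by rewrite /omega -epiXn; congr epi; ring. Qed.

Lemma Im_epi_real (r : R) : complex.Im (epi (r%:C)) = sin (pi * r).
Proof.
rewrite /epi (_ : Ipi * r%:C = 0 +i* (pi * r)).
  by rewrite /cexp expR0 /=; ring.
by apply/eqP; rewrite eq_complex /=; apply/andP; split; apply/eqP; ring.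
Qed.

Lemma omegaXN : om ^+ N = 1.
Proof. by rewrite omegaX divff ?NC_neq0 // mulr1 epi2. Qed.

(** [om ^+ j] is the square of [epi (j / N)], whose imaginary part [sin (pi j / N)] is positive; so
    that number is neither 1 nor -1. *)
Lemma omega_neq1 j : (0 < j)%N -> (j < N)%N -> om ^+ j != 1.
Proof.
move=> j0 jN; rewrite omegaX epi_sqr sqrf_eq1 negb_or.
pose r : R := j%:R / N%:R.
have N0 : 0 < N%:R :> R by rewrite ltr0n.
have rE : j%:R / N%:R = r%:C :> C by rewrite /r rmorphM /= fmorphV !rmorph_nat.
have im : complex.Im (epi (j%:R / N%:R : C)) != 0.
  rewrite rE Im_epi_real gt_eqF // sin_gt0_pi // mulr_gt0 ?pi_gt0 ?divr_gt0 ?ltr0n //=.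
  by rewrite gtr_pMr ?pi_gt0 // ltr_pdivrMr // mul1r ltr_nat.
by apply/andP; split; apply: contra im => /eqP ->; rewrite /= ?oppr0.
Qed.

Lemma normc_omegaX j : normc (om ^+ j) = 1.
Proof.
have : normc om ^+ N = 1 by rewrite -normcX omegaXN normc1.
rewrite normcX; move/eqP; rewrite pexprn_eq1 ?normc_ge0 // -leqn0 leqNgt N_gt0 /=.
by move=> /eqP ->; rewrite expr1n.
Qed.

End RootsOfUnity.

Section ThetaDuality.
Context {R : realType}.
Local Notation C := R[i].
Variable tau : C.
Local Notation p := (epi (2 * tau)).
Hypothesis p1 : `|p| < 1.
Local Notation t := (th tau).

Let tau0 : 0 < complex.Im tau. Proof. exact: epi_lt1_Im. Qed.

Lemma qpoch_eq0 (x a : C) m : `|a| < 1 -> x * a ^+ m = 1 -> qpoch x a = 0.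
Proof.
move=> a1 e; apply: (ccvg_unique (qpoch_ccvg x a1)).
apply/ccvgP => d d0; exists m.+1 => n hn.
by rewrite (bigD1 (Ordinal hn)) //= e subrr mul0r subrr normc0.
Qed.

Lemma th_eq0 x (k : int) : epi (2 * x) = p ^ k -> t x = 0.
Proof.
move=> e; rewrite th_product //; case: k e => [m|m] e.
  rewrite (qpoch_eq0 (x := (epi (2 * x))^-1) (m := m)) ?mul0r ?mulr0 //.
  by rewrite e mulVf // expf_neq0 // epi_neq0.
rewrite (qpoch_eq0 (x := p * epi (2 * x)) (m := m)) ?mulr0 //.
by rewrite e NegzE mulrAC -exprS -exprnN divff // expf_neq0 // epi_neq0.
Qed.

(** The zeros are the points where [epi (2 * x)] is a power of [p], hence a subgroup. *)
Lemma th_zeroB x y : t x = 0 -> t y = 0 -> t (x - y) = 0.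
Proof.
move=> /(th_eq0P p1)[k hk] /(th_eq0P p1)[l hl]; apply: (@th_eq0 _ (k - l)).
by rewrite mulrBr epiB hk hl expfzDr ?epi_neq0 // invr_expz.
Qed.

(** The three-term identity with all variables centred at [(a + b) / 2]. *)
Lemma th_fay (z a b x y : C) :
  t (x + y - a - b) * t (x - y) * (t (z - a) * t (z - b)) =
  t (z + y - a - b) * t (z - y) * (t (x - a) * t (x - b))
  - t (z + x - a - b) * t (z - x) * (t (y - a) * t (y - b)).
Proof.
have := th_three_term tau0 (z - (a + b) / 2) ((a - b) / 2) (x - (a + b) / 2) (y - (a + b) / 2).
rewrite (_ : z - (a + b) / 2 + (a - b) / 2 = z - b); last by field.
rewrite (_ : z - (a + b) / 2 - (a - b) / 2 = z - a); last by field.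
rewrite (_ : x - (a + b) / 2 + (y - (a + b) / 2) = x + y - a - b); last by field.
rewrite (_ : x - (a + b) / 2 - (y - (a + b) / 2) = x - y); last by field.
rewrite (_ : z - (a + b) / 2 + (x - (a + b) / 2) = z + x - a - b); last by field.
rewrite (_ : z - (a + b) / 2 - (x - (a + b) / 2) = z - x); last by field.
rewrite (_ : z - (a + b) / 2 + (y - (a + b) / 2) = z + y - a - b); last by field.
rewrite (_ : z - (a + b) / 2 - (y - (a + b) / 2) = z - y); last by field.
rewrite (_ : (a - b) / 2 + (y - (a + b) / 2) = y - b); last by field.
rewrite (_ : (a - b) / 2 - (y - (a + b) / 2) = - (y - a)); last by field.
rewrite (_ : (a - b) / 2 + (x - (a + b) / 2) = x - b); last by field.
rewrite (_ : (a - b) / 2 - (x - (a + b) / 2) = - (x - a)); last by field.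
rewrite !(thN tau0) => h; apply/eqP; rewrite -subr_eq0 -h; apply/eqP; ring.
Qed.

Lemma thtauMn x n : t (x + tau * n%:R) =
  (-1) ^+ n * epi (- (n%:R ^+ 2 * tau) - 2 * n%:R * x) * t x.
Proof.
elim: n => [|n ih].
  by rewrite mulr0 addr0 expr0 mul1r (_ : _ - _ = 0) ?epi0 ?mul1r //; ring.
have -> : x + tau * n.+1%:R = x + tau * n%:R + tau by rewrite -natr1; ring.
rewrite thtau // ih [(-1) ^+ n.+1]exprS.
rewrite (_ : epi (- (n.+1%:R ^+ 2 * tau) - 2 * n.+1%:R * x) =
  epi (- tau - 2 * (x + tau * n%:R)) * epi (- (n%:R ^+ 2 * tau) - 2 * n%:R * x)).
  by ring.
by rewrite -epiD -natr1; congr epi; ring.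
Qed.

Section EquallySpaced.
Variable N : nat.
Hypothesis N_gt0 : (0 < N)%N.
Local Notation om := (@omega R N).
Local Notation NC := (N%:R : C).

Let N0 : NC != 0 := NC_neq0 N_gt0.

Lemma th_divN_neq0 x (a c : int) : (forall k : int, epi (2 * x) != p ^ k) ->
  t ((x + tau * a%:~R + c%:~R) / NC) != 0.
Proof.
move=> hx; apply: th_neq0 => // k; apply/eqP => e.
have /eqP := hx (k * N%:Z - a); apply.
have : epi (2 * (x + tau * a%:~R + c%:~R)) = p ^ (k * N%:Z).
  by rewrite -exprz_exp -e -[RHS]epiXn; congr epi; field.
rewrite !mulrDr !epiD epi2z mulr1 mulrA epiXz => h.
by rewrite expfzDr ?epi_neq0 // -h -invr_expz mulfK // expfz_neq0 // epi_neq0.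
Qed.

Lemma th_rat_neq0 j : (0 < j)%N -> (j < N)%N -> t (j%:R / NC) != 0.
Proof.
move=> j0 jN; apply: th_neq0 => // k; rewrite -omegaX //; apply/eqP => e.
have p1' : normc p < 1 by rewrite -ltr_norm1.
case: k e => [[|m]|m] e.
- by have := @omega_neq1 R _ N_gt0 _ j0 jN; rewrite e eqxx.
- have := @normc_omegaX R _ N_gt0 j; rewrite e normcX => /eqP.
  by rewrite lt_eqF // exprn_ilt1 ?normc_ge0.
- have : om ^+ j * p ^+ m.+1 = 1 by rewrite e NegzE -exprnN mulVf // expf_neq0 // epi_neq0.
  move=> /(congr1 (@normc R)); rewrite normcM normc_omegaX // mul1r normcX normc1 => /eqP.
  by rewrite lt_eqF // exprn_ilt1 ?normc_ge0.
Qed.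

(** Up to a constant, the theta function of nome [p^N] in the variable [N * x]; hence the antiperiod
    [1 / N] of [hthS]. *)
Definition hth (x : C) : C := \prod_(l < N) t (x + l%:R / NC).

Lemma hthS x : hth (x + NC^-1) = - hth x.
Proof.
rewrite /hth; move: N0; case: N => [|n] n0; first by rewrite eqxx in n0.
rewrite [LHS]big_ord_recr [in RHS]big_ord_recl /= mul0r addr0.
rewrite (_ : x + _ + n%:R / _ = x + 1); last by rewrite -addrA -[X in x + (X + _)]mul1r -mulrDl nat1r divff.
rewrite th1 // mulrN mulrC; congr (- (_ * _)); apply: eq_bigr => i _.
by congr t; rewrite /bump /= -nat1r; ring.
Qed.

Lemma hthB x k : hth (x - k%:R / NC) = (-1) ^+ k * hth x.
Proof.
elim: k => [|k ih]; first by rewrite mul0r subr0 mul1r.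
rewrite exprS mulN1r mulNr -ih -[LHS]opprK -hthS; congr (- hth _).
by rewrite -natr1; field.
Qed.

(** The denominator of the residue at the pole [- k / N]. *)
Definition hthD (k : nat) : C := \prod_(j < N | j != k :> nat) t ((j%:R - k%:R) / NC).

Let hthDS k : (k.+1 < N)%N -> hthD k.+1 = - hthD k.
Proof.
rewrite /hthD; move: N0; case: N => [|n] n0 kn //.
have e : t ((n%:R - k%:R) / n.+1%:R) = - t ((0%:R - k.+1%:R) / n.+1%:R).
  by rewrite -th1 //; congr t; rewrite -!natr1; field; rewrite natr1.
rewrite big_mkcond [in RHS]big_mkcond big_ord_recl [in RHS]big_ord_recr /=.
rewrite (_ : n != k); last by move: kn; rewrite ltnS; case: ltngtP.
rewrite e mulrN opprK mulrC; congr (_ * _); apply: eq_bigr => i _.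
rewrite /bump /= add1n eqSS; case: ifP => // _; congr t.
by rewrite -!natr1; ring.
Qed.

Let hthD_E k : (k < N)%N -> hthD k = (-1) ^+ k * hthD 0.
Proof.
elim: k => [|k ih] kN; first by rewrite mul1r.
by rewrite hthDS // ih 1?ltnW // exprS mulN1r mulNr.
Qed.

Lemma hthD0_neq0 : hthD 0 != 0.
Proof.
apply/prodf_neq0 => j j0; rewrite subr0; apply: th_rat_neq0 => //.
by rewrite lt0n.
Qed.

(** Partial fractions with poles [- k / N] and zeros [- (v + k) / N]. The numerator and the
    denominator of the [k]-th residue both equal [(-1) ^+ k] times their values at [k = 0], so all
    residues coincide and leave the sum. *)
Lemma th_partial_fractions z v : (forall k, (k < N)%N -> t (z + k%:R / NC) != 0) ->
  hthD 0 * (t v * (hth (z + v / NC) / hth z)) =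
  hth (v / NC) * \sum_(k < N) t (z + k%:R / NC + v) / t (z + k%:R / NC).
Proof.
move=> hz; pose xs := [seq - (k%:R / NC) | k <- iota 0 N].
pose ys := [seq - ((v + k%:R) / NC) | k <- iota 0 N].
have inj : {in iota 0 N &, injective (fun k : nat => - (k%:R / NC))}.
  move=> a b _ _ /oppr_inj /(mulIf (invr_neq0 N0)) /eqP.
  by rewrite eqr_nat => /eqP.
have uxs : uniq xs by rewrite map_inj_in_uniq ?iota_uniq.
have hxs : {in xs &, forall x y, x != y -> t (x - y) != 0}.
  move=> _ _ /mapP[a + ->] /mapP[b + ->]; rewrite !mem_iota /= !add0n => aN bN.
  have [ab|ba|->] := ltngtP a b; last by rewrite eqxx.
  - rewrite (_ : _ - _ = (b - a)%N%:R / NC) => [_|].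
      by apply: th_rat_neq0; rewrite ?subn_gt0 // ltn_subLR ?(leq_trans bN) ?leq_addl // ltnW.
    by rewrite natrB ?(ltnW ab) //; ring.
  - rewrite (_ : _ - _ = - ((a - b)%N%:R / NC)) => [_|].
      rewrite thN // oppr_eq0; apply: th_rat_neq0; rewrite ?subn_gt0 //.
      by rewrite ltn_subLR ?(leq_trans aN) ?leq_addl // ltnW.
    by rewrite natrB ?(ltnW ba) //; ring.
have sz : size xs = size ys by rewrite !size_map.
have iE (F : nat -> C) : \sum_(k <- iota 0 N) F k = \sum_(k < N) F k.
  by rewrite -(big_mkord xpredT) /index_iota subn0.
have pE (P : pred nat) (F : nat -> C) :
    \prod_(k <- iota 0 N | P k) F k = \prod_(k < N | P k) F k.
  by rewrite -(big_mkord P) /index_iota subn0.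
have hz' : {in xs, forall x, t (z - x) != 0}.
  by move=> _ /mapP[k + ->]; rewrite mem_iota /= add0n opprK; apply: hz.
have := partial_fractions (th0 tau0) th_fay (thN tau0) th_zeroB sz uxs hxs hz'.
rewrite /= !big_map !iE.
have -> : \sum_(k < N) - (k%:R / NC) - \sum_(k < N) - ((v + k%:R) / NC) = v.
  rewrite -sumrB (eq_bigr (fun=> v / NC)); last by move=> i _; ring.
  by rewrite sumr_const card_ord -[LHS]mulr_natr divfK.
rewrite !pE => e.
have num (w : C) : \prod_(l < N) t (w - - ((v + l%:R) / NC)) = hth (w + v / NC).
  by apply: eq_bigr => l _; congr t; ring.
rewrite num in e.
have -> : hth z = \prod_(k < N) t (z - - (k%:R / NC)).
  by apply: eq_bigr => k _; rewrite opprK.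
rewrite e !mulr_sumr; apply: eq_bigr => k _.
rewrite /ys /xs !big_map !pE num.
rewrite (_ : \prod_(l < N | - (l%:R / NC) != - (k%:R / NC))
  t (- (k%:R / NC) - - (l%:R / NC)) = hthD k); last first.
  apply: eq_big => [l|l _]; last by congr t; ring.
  rewrite eqr_opp (inj_eq (mulIf (invr_neq0 N0))) eqr_nat //.
rewrite (hthD_E (ltn_ord k)) (addrC (- _)) hthB !opprK.
have s0 : (-1) ^+ k != 0 :> C by rewrite expf_neq0 // oppr_eq0 oner_eq0.
by field; rewrite hthD0_neq0 s0 hz.
Qed.

End EquallySpaced.
End ThetaDuality.

(** * Fourier duality of the W coefficients *)

Section FourierDuality.
Context {R : realType}.
Local Notation C := R[i].
Variable tau : C.
Local Notation p := (epi (2 * tau)).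
Hypothesis p1 : `|p| < 1.
Local Notation t := (th tau).
Variable N : nat.
Hypothesis N_gt0 : (0 < N)%N.
Local Notation om := (@omega R N).
Local Notation NC := (N%:R : C).

Let tau0 : 0 < complex.Im tau. Proof. exact: epi_lt1_Im. Qed.
Let N0 : NC != 0 := NC_neq0 N_gt0.

Definition off_lattice (x : C) : Prop := forall k : int, epi (2 * x) != p ^ k.

Lemma off_latticeN x : off_lattice x -> off_lattice (- x).
Proof.
move=> h k; rewrite mulrN epiN; apply: contra (h (- k)) => /eqP e.
by rewrite -invr_expz -e invrK.
Qed.

(** [W] in terms of [th], extended to integer characteristics; it is periodic modulo [N] in both, so
    it lives on pairs of residues. *)
Definition Wz (a c : int) (xi zeta : C) : C :=
  NC^-1 * (epi (2 * (a%:~R / NC) * xi) *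
    (t ((zeta + tau * a%:~R + c%:~R) / NC + xi) / t ((zeta + tau * a%:~R + c%:~R) / NC))).

Lemma W_Wz (a c : nat) xi zeta : W N a c xi zeta tau = Wz a c xi zeta.
Proof.
rewrite /W /Wz !theta_char //; congr (_ * _).
set A := epi _; set B := epi _.
have -> : A = epi (2 * (a%:~R / NC) * xi) * B by rewrite /A /B -epiD; congr epi; ring.
have B0 : B != 0 by apply: epi_neq0.
have E (x : C) : x + zeta / NC + a%:R / NC * tau + c%:R / NC =
   (zeta + tau * a%:~R + c%:~R) / NC + x by ring.
have -> : zeta / NC + a%:R / NC * tau + c%:R / NC =
   (zeta + tau * a%:~R + c%:~R) / NC by ring.
have E' (D : C) : D = D * (B / B) by rewrite divff // mulr1.
by rewrite E [RHS]E' invfM; ring.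
Qed.

Lemma Wz_addl a c xi zeta : Wz (a + N%:Z) c xi zeta = Wz a c xi zeta.
Proof.
rewrite /Wz; congr (_ * _).
set y := (zeta + tau * a%:~R + c%:~R) / NC.
have -> : (zeta + tau * (a + N%:Z)%:~R + c%:~R) / NC = y + tau.
  by rewrite /y intrD; field.
rewrite addrAC !thtau //.
have -> : 2 * ((a + N%:Z)%:~R / NC) * xi = 2 * (a%:~R / NC) * xi + 2 * xi.
  by rewrite intrD; field.
rewrite !mulNr invrN !mulrN opprK epiD invfM.
rewrite (_ : - tau - 2 * (y + xi) = (- tau - 2 * y) - 2 * xi); last by ring.
rewrite (epiD (- tau - _)) epiN.
have e1 := epi_neq0 (- tau - 2 * y); have e2 := epi_neq0 (2 * xi).
set u := epi (- tau - 2 * y) in e1 *; set v := epi (2 * xi) in e2 *.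
have E (B : C) : B = B * (u / u) * (v / v) by rewrite !divff // !mulr1.
by rewrite [RHS]E; ring.
Qed.

Lemma Wz_addr a c xi zeta : Wz a (c + N%:Z) xi zeta = Wz a c xi zeta.
Proof.
rewrite /Wz; congr (_ * (_ * _)).
set y := (zeta + tau * a%:~R + c%:~R) / NC.
have -> : (zeta + tau * a%:~R + (c + N%:Z)%:~R) / NC = y + 1.
  by rewrite /y intrD; field.
by rewrite addrAC !th1 // invrN mulrNN.
Qed.

Lemma WzN a c xi zeta : Wz (- a) (- c) (- xi) (- zeta) = Wz a c xi zeta.
Proof.
rewrite /Wz !intrN; congr (_ * (epi _ * _)); first by ring.
set y := (zeta + tau * a%:~R + c%:~R) / NC.
have -> : (- zeta + tau * - a%:~R + - c%:~R) / NC = - y by rewrite /y; ring.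
by rewrite -opprD !thN // invrN mulrNN.
Qed.

Lemma Wz_den_neq0 a c zeta : off_lattice zeta ->
  t ((zeta + tau * a%:~R + c%:~R) / NC) != 0.
Proof. exact: th_divN_neq0. Qed.

Lemma off_lattice_th x : off_lattice x -> t x != 0.
Proof. exact: th_neq0. Qed.

Lemma hth_neq0 zeta (a : nat) : off_lattice zeta ->
  hth tau N ((zeta + tau * a%:R) / NC) != 0.
Proof.
move=> hz; apply/prodf_neq0 => l _.
by rewrite -mulrDl; apply: (Wz_den_neq0 a%:Z l%:Z hz).
Qed.

(** This is [th_partial_fractions] at the point [(zeta + tau * a) / N] with [v = xi + tau * e]: the
    [e] quasi-periods contained in [v] multiply the [c]-th term by the character [om ^- (c * e)], up
    to factors independent of [c]. *)
Lemma W_fourier (a e : nat) xi zeta : off_lattice xi -> off_lattice zeta ->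
  \sum_(c < N) Wz a c%:Z xi zeta * (om ^+ (c * e))^-1 =
  t xi * (NC^-1 * hthD tau N 0 *
  epi (2 * (a%:R * xi + e%:R * zeta + a%:R * e%:R * tau) / NC) *
  hth tau N ((zeta + tau * a%:R) / NC + (xi + tau * e%:R) / NC) /
  (hth tau N ((zeta + tau * a%:R) / NC) * hth tau N ((xi + tau * e%:R) / NC))).
Proof.
move=> hxi hzeta; pose x := (zeta + tau * a%:R) / NC.
pose v := xi + tau * e%:R.
have hx (k : nat) : t (x + k%:R / NC) != 0.
  by rewrite /x -mulrDl; apply: (Wz_den_neq0 a%:Z k%:Z hzeta).
have := th_partial_fractions p1 N_gt0 v (fun k _ => hx k).
have hv0 : hth tau N (v / NC) != 0 by apply: hth_neq0.
rewrite -/x -/v; set S := \sum_(k < N) _ => hS.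
have -> : \sum_(c < N) Wz a c%:Z xi zeta * (om ^+ (c * e))^-1 =
    NC^-1 * epi (2 * (a%:R / NC) * xi) * ((-1) ^+ e *
    epi (e%:R ^+ 2 * tau + 2 * e%:R * (x + xi)) * S).
  rewrite /S !mulr_sumr; apply: eq_bigr => c _; rewrite /Wz.
  have -> : (zeta + tau * a%:~R + c%:~R) / NC = x + c%:R / NC by rewrite /x mulrDl.
  have -> : x + c%:R / NC + v = x + c%:R / NC + xi + tau * e%:R by rewrite /v; ring.
  rewrite thtauMn // omegaX // -epiN.
  rewrite [X in _ * X = _](_ : _ = epi (e%:R ^+ 2 * tau + 2 * e%:R * (x + xi)) *
    epi (- (e%:R ^+ 2 * tau) - 2 * e%:R * (x + c%:R / NC + xi))); last first.
    by rewrite -epiD natrM; congr epi; ring.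
  have ss : (-1) ^+ e * (-1) ^+ e = 1 :> C by rewrite -expr2 sqrr_sign.
  have E (B : C) : B = ((-1) ^+ e * (-1) ^+ e) * B by rewrite ss mul1r.
  by rewrite [LHS]E; ring.
have -> : S = hthD tau N 0 * (t v * (hth tau N (x + v / NC) / hth tau N x)) / hth tau N (v / NC).
  by rewrite hS mulrC mulKf.
rewrite /v thtauMn // -/v.
rewrite (_ : epi (2 * (a%:R * xi + e%:R * zeta + a%:R * e%:R * tau) / NC) =
  epi (2 * (a%:R / NC) * xi) * epi (e%:R ^+ 2 * tau + 2 * e%:R * (x + xi)) *
  epi (- (e%:R ^+ 2 * tau) - 2 * e%:R * xi)); last first.
  by rewrite -!epiD; congr epi; rewrite /x; field.
have ss : (-1) ^+ e * (-1) ^+ e = 1 :> C by rewrite -expr2 sqrr_sign.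
have E (B : C) : B = ((-1) ^+ e * (-1) ^+ e) * B by rewrite ss mul1r.
by rewrite invfM [RHS]E; ring.
Qed.

(** Apart from [t xi], the closed form in [W_fourier] is symmetric under the exchange of [(a, xi)]
    with [(e, zeta)]. *)
Lemma W_duality (a e : nat) xi zeta : off_lattice xi -> off_lattice zeta ->
  \sum_(c < N) Wz a c%:Z xi zeta * (om ^+ (c * e))^-1 =
  t xi / t zeta * \sum_(c < N) Wz e c%:Z zeta xi * (om ^+ (c * a))^-1.
Proof.
move=> hxi hzeta; rewrite !W_fourier // mulrA divfK ?off_lattice_th //.
congr (_ * _); rewrite (addrC ((xi + _) / _)) !invfM.
rewrite (_ : e%:R * zeta + a%:R * xi + e%:R * a%:R * tau =
  a%:R * xi + e%:R * zeta + a%:R * e%:R * tau); by ring.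
Qed.

End FourierDuality.

(** * Entries of the elliptic R-matrix and their symmetries *)

Section BelavinMatrix.
Context {R : realType}.
Local Notation C := R[i].
Variable tau : C.
Local Notation p := (epi (2 * tau)).
Hypothesis p1 : `|p| < 1.
Local Notation t := (th tau).
Variable n : nat.
Local Notation N := n.+2.
Local Notation om := (@omega R N).
Local Notation NC := (N%:R : C).
Local Notation I := 'I_N.
Local Notation good := (off_lattice tau).
Local Notation Wz := (Wz tau N).

Let tau0 : 0 < complex.Im tau. Proof. exact: epi_lt1_Im. Qed.
Let N_gt0 : (0 < N)%N. Proof. by []. Qed.
Let N0 : NC != 0 := NC_neq0 N_gt0.

Definition chi (a : I) : C := om ^+ a.

Lemma chiD a b : chi (a + b) = chi a * chi b.
Proof. by rewrite /chi /= expr_mod ?omegaXN // exprD. Qed.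

Lemma chiM a b : chi (a * b) = om ^+ (a * b)%N.
Proof. by rewrite /chi /= expr_mod ?omegaXN. Qed.

Lemma chi0 : chi 0 = 1. Proof. exact: expr0. Qed.

Lemma chi_neq0 a : chi a != 0.
Proof. by rewrite /chi omegaX // epi_neq0. Qed.

Lemma chiN a : chi (- a) = (chi a)^-1.
Proof. by apply: (mulIf (chi_neq0 a)); rewrite -chiD addNr chi0 mulVf ?chi_neq0. Qed.

Lemma sum_shift (T : nmodType) (F : I -> T) (d : I) :
  \sum_a F (a + d) = \sum_a F a.
Proof. by rewrite [RHS](reindex_inj (addIr d)). Qed.

Lemma sum_opp (T : nmodType) (F : I -> T) : \sum_a F (- a) = \sum_a F a.
Proof. by rewrite [RHS](reindex_inj oppr_inj). Qed.

Lemma chi_sum (d : I) : \sum_m chi (m * d) = NC * (d == 0)%:R.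
Proof.
have [->|d0] := eqVneq d 0.
  under eq_bigr do rewrite mulr0 chi0.
  by rewrite sumr_const card_ord mulr1.
rewrite mulr0; set s := \sum_m _.
have : chi d * s = s.
  rewrite -[RHS](sum_shift _ 1) mulr_sumr; apply: eq_bigr => m _.
  by rewrite -chiD mulrDl mul1r addrC.
have d1 : chi d != 1.
  by apply: omega_neq1 => //; rewrite lt0n; apply: contra d0 => /eqP e; apply/eqP/val_inj.
move/eqP; rewrite -subr_eq0 -[X in _ - X]mul1r -mulrBl mulf_eq0 subr_eq0 (negbTE d1).
by move=> /eqP.
Qed.

Lemma Wz_mod (k l a c : int) xi zeta :
  Wz (a + N%:Z * k) (c + N%:Z * l) xi zeta = Wz a c xi zeta.
Proof.
have Hl (m : nat) a' c' : Wz (a' + N%:Z * m%:Z) c' xi zeta = Wz a' c' xi zeta.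
  elim: m => [|m ih]; first by rewrite mulr0 addr0.
  rewrite (_ : a' + N%:Z * m.+1%:Z = a' + N%:Z * m%:Z + N%:Z); last by lia.
  by rewrite Wz_addl.
have Hr (m : nat) a' c' : Wz a' (c' + N%:Z * m%:Z) xi zeta = Wz a' c' xi zeta.
  elim: m => [|m ih]; first by rewrite mulr0 addr0.
  rewrite (_ : c' + N%:Z * m.+1%:Z = c' + N%:Z * m%:Z + N%:Z); last by lia.
  by rewrite Wz_addr.
have Hl' (k' : int) a' c' : Wz (a' + N%:Z * k') c' xi zeta = Wz a' c' xi zeta.
  case: k' => m; first exact: Hl.
  rewrite -(Hl m.+1 (a' + N%:Z * Negz m)).
  rewrite (_ : a' + N%:Z * Negz m + N%:Z * m.+1%:Z = a') //.
  by rewrite NegzE mulrN subrK.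
have Hr' (k' : int) a' c' : Wz a' (c' + N%:Z * k') xi zeta = Wz a' c' xi zeta.
  case: k' => m; first exact: Hr.
  rewrite -(Hr m.+1 a' (c' + N%:Z * Negz m)).
  rewrite (_ : c' + N%:Z * Negz m + N%:Z * m.+1%:Z = c') //.
  by rewrite NegzE mulrN subrK.
by rewrite Hl' Hr'.
Qed.

Definition wcoef (a c : I) (xi zeta : C) : C := Wz a%:Z c%:Z xi zeta.

Let val_sub (a b : I) : exists k : int, (val (a - b))%:Z = a%:Z - b%:Z + N%:Z * k.
Proof.
have e1 := divn_eq (a + (N - b) %% N) N; have e2 := divn_eq (N - b) N.
have bN : (b <= N)%N by apply: ltnW.
rewrite /=; set q1 := (_ %/ N)%N in e1; set q2 := (_ %/ N)%N in e2.
exists (1 - q1%:Z - q2%:Z).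
rewrite mulrBr mulrBr mulr1 -!PoszM !(mulnC N).
move: e1 e2; set x := (_ %% N)%N; set y := ((_ + _) %% N)%N.
set P := (q1 * N)%N; set Q := (q2 * N)%N; lia.
Qed.

Lemma w_sub (a b c d : I) xi zeta :
  wcoef (a - b) (c - d) xi zeta = Wz (a%:Z - b%:Z) (c%:Z - d%:Z) xi zeta.
Proof.
rewrite /wcoef; have [k ->] := val_sub a b; have [l ->] := val_sub c d.
exact: Wz_mod.
Qed.

Lemma wN a c xi zeta : wcoef (- a) (- c) (- xi) (- zeta) = wcoef a c xi zeta.
Proof.
rewrite -{1}(sub0r a) -{1}(sub0r c) w_sub /= !sub0r.
by rewrite WzN.
Qed.

Lemma wNN a c xi zeta : wcoef (- a) (- c) xi zeta = wcoef a c (- xi) (- zeta).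
Proof. by rewrite -[LHS]wN !opprK. Qed.

Lemma w_duality (a e : I) xi zeta : good xi -> good zeta ->
  \sum_c wcoef a c xi zeta * chi (- (c * e)) =
  t xi / t zeta * \sum_c wcoef e c zeta xi * chi (- (c * a)).
Proof.
move=> hxi hzeta; have := W_duality p1 N_gt0 a e hxi hzeta.
under eq_bigr do rewrite -chiM -chiN.
by move=> ->; congr (_ * _); apply: eq_bigr => c _; rewrite -chiM -chiN.
Qed.

(* The entries of the R-matrix, up to its scalar prefactor and the conjugation
   by g^(1/2). *)
Definition Sent (xi zeta : C) (i k j l : I) : C :=
  (i + k == j + l)%:R * \sum_c wcoef (j - i) c xi zeta * chi (- (c * (l - i))).

(** The duality of the Fourier transforms at [e = l - i]. For matrices it says that exchanging [xi]
    with [zeta] amounts, up to a scalar, to a multiplication by the permutation of the two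
    spaces. *)
Lemma S_duality xi zeta i k j l : good xi -> good zeta ->
  Sent xi zeta i k j l = t xi / t zeta * Sent zeta xi i k l j.
Proof.
by move=> hxi hzeta; rewrite /Sent w_duality // (addrC j l) mulrCA.
Qed.

(* The entries of R12(z) R21(1/z), up to the scalar prefactors. *)
Definition Upair (xi zeta : C) (i k j l : I) : C :=
  \sum_a \sum_b Sent xi zeta i k a b * Sent (- xi) zeta b a l j.

Lemma S_flip xi zeta i k j l : Sent zeta (- xi) i k j l = Sent (- zeta) xi k i l j.
Proof.
rewrite /Sent (addrC k i) (addrC l j); have [e|_] := eqVneq (i + k) (j + l); last first.
  by rewrite !mul0r.
rewrite !mul1r -[LHS](sum_opp _); apply: eq_bigr => c _.
have -> : j - i = - (l - k).
  by apply/eqP; rewrite opprB subr_eq -addrA (addrC _ i) addrA eq_sym subr_eq addrC e addrC.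
rewrite wNN opprK; congr (_ * chi _).
have -> : l - i = - (j - k).
  by apply/eqP; rewrite opprB subr_eq -addrA (addrC _ i) addrA eq_sym subr_eq addrC e addrC.
by rewrite mulrNN.
Qed.

(** Duality is applied to both factors and [S_flip] restores the order of the spaces. The sign
    arises because one factor is taken at [- xi] and [t] is odd. *)
Lemma U_antisym xi zeta i k j l : good xi -> good zeta ->
  Upair xi zeta i k j l = - (t xi / t zeta) ^+ 2 * Upair zeta xi i k j l.
Proof.
move=> hxi hzeta; rewrite /Upair [in RHS]exchange_big mulr_sumr; apply: eq_bigr => a _.
rewrite mulr_sumr; apply: eq_bigr => b _.
rewrite (S_duality i k a b hxi hzeta) (S_duality _ _ _ _ (off_latticeN hxi) hzeta).
by rewrite S_flip thN //; ring.
Qed.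

Lemma U_diag zeta i k j l : good zeta -> Upair zeta zeta i k j l = 0.
Proof.
move=> hz; have := U_antisym i k j l hz hz.
rewrite divff ?off_lattice_th // expr1n mulN1r => /eqP.
by rewrite -addr_eq0 -mulr2n mulrn_eq0 => /eqP.
Qed.

(** In the product of R12 at [xi] and R21 at [- xi], a pair of terms with labels [(a, c)] and
    [(a - g1, c - g2)] is a multiple of the matrix labelled [(g1, g2)]. [Gpair] collects these
    terms; [chi] records the phase from reordering the [g]'s and [h]'s. *)
Definition Gpair (g1 g2 : I) (xi zeta : C) : C :=
  \sum_a \sum_c chi (g2 * a - g1 * c) * (wcoef a c xi zeta * wcoef (a - g1) (c - g2) (- xi) zeta).

Lemma U_G xi zeta i k j l : Upair xi zeta i k j l =
  (i + k == j + l)%:R * \sum_g chi (- (g * (k - j))) * Gpair (j - i) g xi zeta.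
Proof.
have [e|ne] := eqVneq (i + k) (j + l); last first.
  rewrite mul0r /Upair big1 // => a _; rewrite big1 // => b _; rewrite /Sent.
  have [e1|_] := eqVneq (i + k) (a + b); last by rewrite !mul0r.
  by rewrite (addrC b a) -e1 (addrC l j) (negbTE ne) mul0r mulr0.
rewrite mul1r.
transitivity (\sum_a \sum_c \sum_d wcoef (a - i) c xi zeta * wcoef (a - j) d (- xi) zeta *
    chi (- (c * (k - a)) - d * (j - i - k + a))).
  apply: eq_bigr => a _; rewrite (bigD1 (i + k - a)) //= [X in _ + X]big1 => [|b ba].
    rewrite addr0 /Sent subrKC eqxx subrK (addrC l j) e eqxx !mul1r.
    rewrite mulr_suml; apply: eq_bigr => c _; rewrite mulr_sumr; apply: eq_bigr => d _.
    have -> : j + l - a - i = k - a by rewrite -e; ring.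
    have -> : l - (j + l - a) = a - j by ring.
    have -> : j - (j + l - a) = a - l by ring.
    have -> : j - i - k + a = a - l.
      by rewrite -[j - i - k]addrA -opprD e; ring.
    by rewrite chiD mulrACA.
  rewrite /Sent; case: eqP => [e1|_]; last by rewrite !mul0r.
  by case/eqP: ba; rewrite e1; ring.
rewrite -(sum_shift _ i).
under [RHS]eq_bigr do rewrite /Gpair mulr_sumr.
rewrite [RHS]exchange_big; apply: eq_bigr => a _ /=.
under [RHS]eq_bigr do rewrite mulr_sumr.
rewrite [RHS]exchange_big; apply: eq_bigr => c _ /=.
rewrite -(sum_opp _) -(sum_shift _ (- c)); apply: eq_bigr => g _.
rewrite mulrA -chiD mulrC; congr (chi _ * (wcoef _ _ _ _ * wcoef _ _ _ _)); by ring.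
Qed.

End BelavinMatrix.

Section BelavinIdentities.
Context {R : realType}.
Local Notation C := R[i].
Variable tau : C.
Local Notation p := (epi (2 * tau)).
Hypothesis p1 : `|p| < 1.
Local Notation t := (th tau).
Variable n : nat.
Local Notation N := n.+2.
Local Notation NC := (N%:R : C).
Local Notation I := 'I_N.
Local Notation good := (off_lattice tau).
Local Notation chi := (@chi R n).
Local Notation w := (wcoef tau (n := n)).
Local Notation S := (Sent tau (n := n)).
Local Notation U := (Upair tau (n := n)).
Local Notation G := (Gpair tau (n := n)).

Let tau0 : 0 < complex.Im tau. Proof. exact: epi_lt1_Im. Qed.
Let N0 : NC != 0. Proof. exact: NC_neq0. Qed.

(** Fourier inversion of [U_G]; it transfers antisymmetry and vanishing on the diagonal from the
    entries to the coefficients [G]. *)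
Lemma G_inv g1 g2 xi zeta :
  \sum_k U xi zeta 0 k g1 (k - g1) * chi (g2 * (k - g1)) = NC * G g1 g2 xi zeta.
Proof.
under eq_bigr => k _.
  rewrite U_G // add0r subrKC eqxx mul1r subr0 mulr_suml.
  over.
rewrite /= exchange_big /= (bigD1 g2) //= [X in _ + X]big1 => [|g gg2].
  rewrite addr0 (eq_bigr (fun=> G g1 g2 xi zeta)); last first.
    by move=> k _; rewrite mulrAC -chiD addNr chi0 mul1r.
  by rewrite sumr_const card_ord -[LHS]mulr_natl.
rewrite (eq_bigr (fun k => G g1 g xi zeta * chi ((k - g1) * (g2 - g)))); last first.
  by move=> k _; rewrite mulrAC -chiD mulrC; congr (_ * chi _); ring.
rewrite -mulr_sumr (sum_shift (fun k => chi (k * (g2 - g)))) chi_sum.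
by rewrite subr_eq0 eq_sym (negbTE gg2) !mulr0.
Qed.

Lemma G_antisym g1 g2 xi zeta : good xi -> good zeta ->
  G g1 g2 xi zeta = - (t xi / t zeta) ^+ 2 * G g1 g2 zeta xi.
Proof.
move=> hxi hz; apply: (mulfI N0); rewrite mulrCA -!G_inv mulr_sumr.
by apply: eq_bigr => k _; rewrite U_antisym // mulrA.
Qed.

Lemma G_diag g1 g2 zeta : good zeta -> G g1 g2 zeta zeta = 0.
Proof.
move=> hz; apply: (mulfI N0); rewrite -G_inv mulr0 big1 // => k _.
by rewrite U_diag // mul0r.
Qed.

Section FixedShift.
Variables g1 g2 : I.
Let gam : C := (tau * g1%:R + g2%:R) / NC.
Let pt (zeta : C) (a c : I) : C := (zeta + tau * a%:R + c%:R) / NC.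
Let h (y v : C) : C := t (y + v) * t (y - gam - v).
Let gsum (v zeta : C) : C :=
  \sum_a \sum_c chi (g2 * a - g1 * c) * (h (pt zeta a c) v / h (pt zeta a c) 0).

Let pt_neq0 zeta a c : good zeta -> h (pt zeta a c) 0 != 0.
Proof.
move=> hz; rewrite /h addr0 subr0 mulf_neq0 //.
  exact: (Wz_den_neq0 p1 (ltn0Sn _) a%:Z c%:Z hz).
have := Wz_den_neq0 p1 (ltn0Sn n.+1) (a%:Z - g1%:Z) (c%:Z - g2%:Z) hz.
by congr (t _ != 0); rewrite /pt /gam !intrB; move: N0; generalize NC => M M0; field.
Qed.

Let G_gsum xi zeta :
  G g1 g2 xi zeta = NC^-1 ^+ 2 * epi (2 * (g1%:R / NC) * xi) * gsum xi zeta.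
Proof.
rewrite /G /gsum !mulr_sumr; apply: eq_bigr => a _; rewrite mulr_sumr.
apply: eq_bigr => c _; rewrite w_sub // /wcoef /Wz.
have -> : (zeta + tau * (a%:Z - g1%:Z)%:~R + (c%:Z - g2%:Z)%:~R) / NC = pt zeta a c - gam.
  by rewrite /pt /gam !intrB; move: N0; generalize NC => M M0; field.
have -> : 2 * ((a%:Z - g1%:Z)%:~R / NC) * - xi =
    2 * (g1%:R / NC) * xi - 2 * (a%:R / NC) * xi.
  by rewrite intrB; move: N0; generalize NC => M M0; field.
rewrite epiB /h addr0 subr0 invfM.
have E := epi_neq0 (2 * (a%:R / NC) * xi).
set e := epi (2 * (a%:R / NC) * xi) in E *.
have e1 (B : C) : B = B * (e / e) by rewrite divff // mulr1.
by rewrite [RHS]e1 /pt; ring.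
Qed.

(** The coefficients do not involve [y]. After division by [h y 0] the relation can therefore be
    summed over all the points [pt zeta a c] against the characters. *)
Let h_three y xi v :
  h y xi * (t (v + gam) * t v) =
  h y v * (t (xi + gam) * t xi) - h y 0 * (t (xi + v + gam) * t (xi - v)).
Proof.
have := th_three_term tau0 (y - gam / 2) (xi + gam / 2) (gam / 2) (v + gam / 2).
rewrite (_ : y - gam / 2 + (xi + gam / 2) = y + xi); last by field.
rewrite (_ : y - gam / 2 - (xi + gam / 2) = y - gam - xi); last by field.
rewrite (_ : gam / 2 + (v + gam / 2) = v + gam); last by field.
rewrite (_ : gam / 2 - (v + gam / 2) = - v); last by field.
rewrite (_ : y - gam / 2 + gam / 2 = y + 0); last by field.
rewrite (_ : y - gam / 2 - gam / 2 = y - gam - 0); last by field.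
rewrite (_ : xi + gam / 2 + (v + gam / 2) = xi + v + gam); last by field.
rewrite (_ : xi + gam / 2 - (v + gam / 2) = xi - v); last by field.
rewrite (_ : y - gam / 2 + (v + gam / 2) = y + v); last by field.
rewrite (_ : y - gam / 2 - (v + gam / 2) = y - gam - v); last by field.
rewrite (_ : xi + gam / 2 + gam / 2 = xi + gam); last by field.
rewrite (_ : xi + gam / 2 - gam / 2 = xi); last by field.
rewrite thN // -/(h y xi) -/(h y v) -/(h y 0) => e.
by apply: subr0_eq; rewrite -[RHS]oppr0 -[X in _ = - X]e; ring.
Qed.

Let chi_tot : \sum_a \sum_c chi (g2 * a - g1 * c) =
  NC ^+ 2 * ((g1 == 0) && (g2 == 0))%:R.
Proof.
transitivity (\sum_a \sum_c chi (a * g2) * chi (c * - g1)).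
  by apply: eq_bigr => a _; apply: eq_bigr => c _; rewrite -chiD; congr chi; ring.
under eq_bigr do rewrite -mulr_sumr chi_sum oppr_eq0.
rewrite -mulr_suml chi_sum.
by case: (g1 == 0); case: (g2 == 0); rewrite /= ?mulr1 ?mulr0 ?mul0r.
Qed.

(** The terms with [h y 0] reduce to a bare sum of characters, whence the Kronecker delta. At
    [v = zeta] the first term on the right vanishes by [G_diag], and this determines [gsum] for all
    [xi]. *)
Let gsum_three xi v zeta : good zeta ->
  gsum xi zeta * (t (v + gam) * t v) =
  gsum v zeta * (t (xi + gam) * t xi) -
  NC ^+ 2 * ((g1 == 0) && (g2 == 0))%:R * (t (xi + v + gam) * t (xi - v)).
Proof.
move=> hz; rewrite -chi_tot !mulr_suml -sumrB; apply: eq_bigr => a _.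
rewrite !mulr_suml -sumrB; apply: eq_bigr => c _.
have h0 := pt_neq0 a c hz; set y := pt zeta a c in h0 *.
have e := h_three y xi v.
have -> : chi (g2 * a - g1 * c) * (h y xi / h y 0) * (t (v + gam) * t v) =
  chi (g2 * a - g1 * c) * (h y xi * (t (v + gam) * t v)) / h y 0 by ring.
by rewrite e; field; rewrite h0.
Qed.

Let G_neq_gsum xi zeta : G g1 g2 xi zeta = 0 -> gsum xi zeta = 0.
Proof.
rewrite G_gsum => /eqP; rewrite !mulf_eq0 (negbTE (epi_neq0 _)) invr_eq0.
by rewrite (negbTE N0) /= => /eqP.
Qed.

Lemma G_eq0 xi zeta : good xi -> good zeta -> good (xi - zeta) ->
  ~~ ((g1 == 0) && (g2 == 0)) -> G g1 g2 xi zeta = 0.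
Proof.
move=> hxi hz hxz /negbTE g0.
have txi := off_lattice_th p1 hxi; have tz := off_lattice_th p1 hz.
have [z0|z0] := eqVneq (t (zeta + gam)) 0; last first.
  have := gsum_three xi zeta hz; rewrite g0 mulr0 mul0r subr0.
  rewrite (G_neq_gsum (G_diag _ _ hz)) mul0r => /eqP.
  rewrite mulf_eq0 mulf_eq0 (negbTE z0) (negbTE tz) !orbF => /eqP e.
  by rewrite G_gsum e mulr0.
(* The three-term identity no longer determines the sum; exchange [xi] and [zeta]. *)
rewrite G_antisym // G_gsum.
have := gsum_three zeta xi hxi; rewrite g0 mulr0 mul0r subr0 z0 mul0r mulr0 => /eqP.
rewrite mulf_eq0 mulf_eq0 (negbTE txi) orbF => /orP[/eqP ->|/eqP x0].
  by rewrite !mulr0.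
have := th_zeroB p1 x0 z0; rewrite opprD addrACA subrr addr0 => /eqP.
by rewrite (negbTE (off_lattice_th p1 hxz)).
Qed.

Lemma G_eq1 xi zeta : good zeta -> g1 = 0 -> g2 = 0 ->
  G g1 g2 xi zeta = t (zeta + xi) * t (zeta - xi) / t zeta ^+ 2.
Proof.
move=> hz e1 e2; have tz := off_lattice_th p1 hz.
have gam0 : gam = 0 by rewrite /gam e1 e2 /= mulr0 addr0 mul0r.
have := gsum_three xi zeta hz; rewrite (G_neq_gsum (G_diag _ _ hz)) mul0r sub0r.
move=> three; rewrite gam0 !addr0 e1 e2 eqxx mulr1 in three.
have -> : zeta - xi = - (xi - zeta) by rewrite opprB.
rewrite thN // G_gsum e1 /= mul0r mulr0 mul0r epi0 mulr1.
have -> : gsum xi zeta = - (NC ^+ 2 * (t (xi + zeta) * t (xi - zeta))) / t zeta ^+ 2.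
  by rewrite -three -expr2 mulfK // expf_neq0.
have N2 : NC ^+ 2 != 0 by rewrite expf_neq0.
rewrite (addrC zeta) exprVn; move: N2; set A := NC ^+ 2; set B := (t zeta ^+ 2)^-1.
by move=> A0; rewrite -[RHS](mulKf A0); ring.
Qed.

End FixedShift.

Lemma U_unitarity xi zeta i k j l : good xi -> good zeta -> good (xi - zeta) ->
  U xi zeta i k j l =
  (i == j)%:R * (k == l)%:R * (t (zeta + xi) * t (zeta - xi) / t zeta ^+ 2).
Proof.
move=> hxi hz hxz; rewrite U_G //.
have [<-|ij] := eqVneq i j; last first.
  rewrite !mul0r big1 ?mulr0 // => g _; rewrite G_eq0 ?mulr0 //.
  by rewrite negb_and subr_eq0 eq_sym ij.
rewrite (inj_eq (addrI i)) mul1r; have [_|_] := eqVneq k l; last by rewrite !mul0r.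
rewrite !mul1r (bigD1 0) //= big1 => [|g g0]; last first.
  by rewrite G_eq0 ?mulr0 // negb_and g0 orbT.
by rewrite addr0 mul0r oppr0 chi0 mul1r G_eq1 // subrr.
Qed.

(** After duality [d] occurs only in a character; its sum forces [c = c']. Then [prodw] makes the
    remaining coefficients constant, and the sum over [c] gives the second Kronecker delta. *)
Lemma S_crossing xi zeta i k e b' : good xi -> good zeta ->
  good (xi + NC * zeta) ->
  \sum_d \sum_b S xi zeta d k i b * S (- xi - NC * zeta) zeta b e b' d =
  (k == b')%:R * (e == i)%:R * (t xi * t (- xi - NC * zeta) / t zeta ^+ 2).
Proof.
move=> hxi hz hx; set xi' := - xi - NC * zeta.
have xi'E : - xi' = xi + NC * zeta by rewrite /xi' opprB opprK addrC.
have hxi' : good xi' by rewrite -[xi']opprK xi'E; apply: off_latticeN.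
(* The theta arguments are divided by [N], so replacing [xi] by [xi + N zeta] moves them by exactly
   [zeta]: the numerator of each factor is the denominator of the other. This is the origin of the
   crossing shift [q^N]. *)
have prodw r c : w r c zeta xi * w r c (- zeta) (- xi') = NC^-1 ^+ 2.
  rewrite xi'E /wcoef /Wz.
  have := Wz_den_neq0 p1 (ltn0Sn n.+1) r%:Z c%:Z hxi.
  have := Wz_den_neq0 p1 (ltn0Sn n.+1) r%:Z c%:Z hx.
  have -> : (xi + NC * zeta + tau * r%:~R + c%:~R) / NC =
    (xi + tau * r%:~R + c%:~R) / NC + zeta.
    by move: N0; generalize NC => M M0; field.
  rewrite addrK mulrN epiN; have E := epi_neq0 (2 * (r%:~R / NC) * zeta).
  move: N0 E; generalize NC => M M0; set v := epi _ => E.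
  by set x := t _; set y := t _ => y0 x0; field; rewrite M0 E x0 y0.
pose r := k - i.
transitivity (t xi * t xi' / t zeta ^+ 2 * ((r + e == b')%:R *
    \sum_c \sum_c' (w r c zeta xi * w r c' (- zeta) (- xi') *
      chi (c' * (b' - r) - c * i) * \sum_d chi (d * (c - c'))))).
  have -> : \sum_d \sum_b S xi zeta d k i b * S xi' zeta b e b' d =
      \sum_d t xi * t xi' / t zeta ^+ 2 * ((r + e == b')%:R *
      \sum_c \sum_c' (w r c zeta xi * w r c' (- zeta) (- xi') *
      chi (c' * (b' - r) - c * i) * chi (d * (c - c')))).
    apply: eq_bigr => d _; rewrite (bigD1 (d + r)) //= [X in _ + X]big1 => [|b bd].
      rewrite addr0 S_duality // (S_duality p1 (d + r) e b' d hxi' hz).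
      rewrite mulrACA mulf_div -expr2; congr (_ * _).
      rewrite /S (_ : d + k == d + r + i) ?mul1r; last by rewrite /r; apply/eqP; ring.
      rewrite -(addrA d r e) (inj_eq (addrI d)) mulrCA; congr (_ * _).
      rewrite mulr_suml; apply: eq_bigr => c _.
      rewrite -[X in _ * X](sum_opp _) mulr_sumr; apply: eq_bigr => c' _.
      have -> : d - (d + r) = - r by ring.
      rewrite (wNN p1) (_ : d + r - d = r); last by ring.
      rewrite mulrACA -[RHS]mulrA; congr (_ * _).
      by rewrite -!chiD; congr chi; ring.
    rewrite /S; case: eqP => [e1|_]; last by rewrite !mul0r.
    by case/eqP: bd; rewrite /r addrA e1; ring.
  rewrite -mulr_sumr -mulr_sumr; congr (_ * (_ * _)).
  rewrite exchange_big; apply: eq_bigr => c _.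
  rewrite exchange_big; apply: eq_bigr => c' _.
  by rewrite mulr_sumr.
have -> : \sum_c \sum_c' (w r c zeta xi * w r c' (- zeta) (- xi') *
      chi (c' * (b' - r) - c * i) * \sum_d chi (d * (c - c'))) = (b' == k)%:R.
  transitivity (\sum_c NC^-1 * chi (c * (b' - k))).
    apply: eq_bigr => c _; rewrite (bigD1 c) //= [X in _ + X]big1 => [|c' cc'].
      rewrite addr0 prodw chi_sum subrr eqxx mulr1 mulrAC expr2 mulrVK ?unitfE //.
      by congr (_ * chi _); rewrite /r; ring.
    by rewrite chi_sum subr_eq0 eq_sym (negbTE cc') !mulr0.
  by rewrite -mulr_sumr chi_sum subr_eq0 mulKf.
have [->|_] := eqVneq b' k; last by rewrite /= !mulr0 !mul0r.
rewrite /= mulr1 mul1r mulrC; congr (_%:R * _).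
by rewrite /r -[X in _ == X]addr0 -addrA (inj_eq (addrI k)) addrC subr_eq0.
Qed.

End BelavinIdentities.

(** * Functional equations of 1/kappa *)

Section ThetaProducts.
Context {R : realType}.
Local Notation C := R[i].

Lemma Theta_inv (a x : C) : `|a| < 1 -> x != 0 -> Theta a x^-1 = - x^-1 * Theta a x.
Proof.
move=> a1 x0; rewrite /Theta invrK (qpochS x a1) (qpochS x^-1 a1).
rewrite (mulrC x a) (mulrC x^-1 a).
by rewrite -[X in X - x^-1](mulfV x0); field.
Qed.

Lemma Theta_neq0 (a x : C) : `|a| < 1 -> a != 0 -> x != 0 ->
  (forall k : int, x != a ^ k) -> Theta a x != 0.
Proof.
move=> a1 a0 x0 hx; rewrite /Theta !mulf_neq0 //; apply: qpoch_neq0 => // m.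
- apply: contra (hx (- m%:Z)) => /eqP e; apply/eqP.
  have am : a ^+ m != 0 by rewrite expf_neq0.
  by apply: (mulIf am); rewrite e -exprnN mulVf.
- apply: contra (hx m.+1%:Z) => /eqP e; apply/eqP.
  by rewrite -[LHS]mulr1 -e -exprnP exprS mulrAC mulrCA mulfV // mulr1.
- rewrite -exprS; apply/eqP => /(congr1 (@normc R)); rewrite normcX normc1 => /eqP.
  by rewrite lt_eqF // exprn_ilt1 ?normc_ge0 // -ltr_norm1.
Qed.

Lemma th_Theta (tau x : C) : `|epi (2 * tau)| < 1 ->
  th tau x = - epi (tau / 4 + 2^-1) * (epi (- x) * Theta (epi (2 * tau)) (epi (2 * x))).
Proof.
move=> p1; rewrite -[LHS]opprK -(thN (epi_lt1_Im p1)) th_product // /Theta mulrN (epiN (2 * x)) invrK.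
by rewrite (addrAC (tau / 4)) epiD; ring.
Qed.

Section Kappa.
Variables (q p : C) (N : nat).
Local Notation Q := (q ^+ (2 * N)).
Hypotheses (q0 : q != 0) (p0 : p != 0) (p1 : `|p| < 1) (Q1 : `|Q| < 1).
Hypothesis N_gt1 : (1 < N)%N.

Definition avoids (u : C) : Prop := u != 0 /\ forall i j : int, u != q ^ i * p ^ j.

Let Q0 : Q != 0. Proof. by rewrite expf_neq0. Qed.

Let QX k : Q ^ k = q ^ ((2 * N)%:Z * k).
Proof. by rewrite -exprz_exp. Qed.

Lemma avoids_mul u (a b : int) : avoids u -> avoids (q ^ a * p ^ b * u).
Proof.
move=> [u0 h]; have m0 : q ^ a * p ^ b != 0 by rewrite mulf_neq0 // expfz_neq0.
split=> [|i j]; first exact: mulf_neq0.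
apply: contra (h (i - a) (j - b)) => /eqP e; apply/eqP.
apply: (mulfI m0); rewrite e mulrACA -(expfzDr a (i - a) q0) -(expfzDr b (j - b) p0).
by rewrite !subrKC.
Qed.

Lemma avoids_neq0 u : avoids u -> u != 0. Proof. by case. Qed.

Lemma avoidsV u : avoids u -> avoids u^-1.
Proof.
move=> [u0 h]; split=> [|i j]; first by rewrite invr_eq0.
apply: contra (h (- i) (- j)) => /eqP e.
by rewrite -[u]invrK e invfM !invr_expz.
Qed.

Lemma avoids_shift u (a b : nat) : avoids u -> avoids (q ^+ a * p ^+ b * u).
Proof. exact: (@avoids_mul _ a%:Z b%:Z). Qed.

Lemma avoids_Theta_Q u : avoids u -> Theta Q u != 0.
Proof.
move=> [u0 h]; apply: Theta_neq0 => //.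
by move=> k; rewrite QX -[X in _ != X]mulr1 -(expr0z p).
Qed.

Lemma avoids_Theta_p u : avoids u -> Theta p u != 0.
Proof.
move=> [u0 h]; apply: Theta_neq0 => //.
by move=> k; rewrite -[X in _ != X]mul1r -(expr0z q).
Qed.

Lemma avoids_qpoch2 u : avoids u -> qpoch2 u p Q != 0.
Proof.
move=> [u0 h]; apply: qpoch2_neq0 => // m l.
apply: contra (h (- ((2 * N)%:Z * l%:Z)) (- m%:Z)) => /eqP e; apply/eqP.
have m0 : p ^+ m * Q ^+ l != 0 by rewrite mulf_neq0 // expf_neq0.
have e1 : q ^ (- ((2 * N)%:Z * l%:Z)) = (Q ^+ l)^-1 by rewrite -invr_expz -QX.
have e2 : p ^ (- m%:Z) = (p ^+ m)^-1 by rewrite -invr_expz.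
apply: (mulIf m0); rewrite mulrA e e1 e2 -mulrA mulKf ?expf_neq0 //.
by rewrite mulVf ?expf_neq0.
Qed.

Section Functional.
Variable u : C.
Hypothesis hu : avoids u.
Local Notation P2 x := (qpoch2 x p Q).

Let qQ : q ^+ (2 * N - 2) * q ^+ 2 = Q.
Proof. by rewrite -exprD subnK //; lia. Qed.

Let nz (v : C) (a b : nat) : avoids v -> P2 (q ^+ a * p ^+ b * v) != 0.
Proof. by move=> hv; apply: avoids_qpoch2; apply: avoids_shift. Qed.

Lemma kappa_factors_neq0 (v : C) : avoids v ->
  [/\ P2 (Q * v) != 0, P2 (q ^+ 2 * v) != 0, P2 (p * v) != 0 &
      P2 (p * q ^+ (2 * N - 2) * v) != 0].
Proof.
move=> hv; split.
- by have := nz (2 * N) 0 hv; rewrite expr0 mulr1.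
- by have := nz 2 0 hv; rewrite expr0 mulr1.
- by have := nz 0 1 hv; rewrite expr0 mul1r expr1.
- by have := nz (2 * N - 2) 1 hv; rewrite expr1 (mulrC _ p).
Qed.

(** Inverting [u] exchanges the numerator and the denominator factor by factor. *)
Lemma kappa_invV : kappa_inv N q p u * kappa_inv N q p u^-1 = 1.
Proof.
have [a1 a2 a3 a4] := kappa_factors_neq0 hu.
have [b1 b2 b3 b4] := kappa_factors_neq0 (avoidsV hu).
rewrite /kappa_inv /= invrK; field.
by rewrite a1 a2 a3 a4 b1 b2 b3 b4.
Qed.

Lemma kappa_inv_neq0 : kappa_inv N q p u != 0.
Proof.
apply/eqP => h; have := kappa_invV; rewrite h mul0r => /eqP.
by rewrite eq_sym oner_eq0.
Qed.

Let ThetaE (a x y : C) : a = x * y -> x != 0 ->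
  Theta a x = qpoch x a * qpoch y a * qpoch a a.
Proof. by move=> -> x0; rewrite /Theta (mulrAC x y) divff // mul1r. Qed.

Let qpoch_neq0' (a : C) : `|a| < 1 -> qpoch a a != 0.
Proof.
move=> a1; apply: qpoch_neq0 => // m; rewrite -exprS.
apply/eqP => /(congr1 (@normc R)); rewrite normcX normc1 => /eqP.
by rewrite lt_eqF // exprn_ilt1 ?normc_ge0 // -ltr_norm1.
Qed.

(** Capital [N] and [D] are double products at [u], small ones those at the shifted argument; [A]
    and [B] are the single products by which they differ, [T] the resulting thetas, [K] the factor
    [(a; a)_oo] common to them. *)
Let ratio (N1 n1 N2 n2 N3 n3 N4 n4 D1 d1 D2 d2 D3 d3 D4 d4 : C)
    (A1 A2 A3 A4 B1 B2 B3 B4 T1 T2 T3 T4 K : C) :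
  n1 = A1 * N1 -> N2 = A2 * n2 -> n3 = A3 * N3 -> N4 = A4 * n4 ->
  D1 = B1 * d1 -> d2 = B2 * D2 -> D3 = B3 * d3 -> d4 = B4 * D4 ->
  T1 * T2 = A1 * A3 * B1 * B3 * K ^+ 2 -> T3 * T4 = A2 * A4 * B2 * B4 * K ^+ 2 ->
  K != 0 -> N2 != 0 -> N4 != 0 -> D1 != 0 -> d2 != 0 -> D3 != 0 -> d4 != 0 ->
  (n1 * n2 * n3 * n4) / (d1 * d2 * d3 * d4) =
  (N1 * N2 * N3 * N4) / (D1 * D2 * D3 * D4) * (T1 * T2) / (T3 * T4).
Proof.
move=> -> -> -> -> -> -> -> -> -> -> K0.
rewrite !mulf_eq0 !negb_or => /andP[? ?] /andP[? ?] /andP[? ?] /andP[? ?] /andP[? ?] /andP[? ?].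
field; do !(apply/andP; split) => //.
Qed.

Let avpu : avoids (p * u).
Proof. by have := avoids_shift 0 1 hu; rewrite expr0 expr1 mul1r. Qed.

Let avQu : avoids (Q * u).
Proof. by have := avoids_shift (2 * N) 0 hu; rewrite expr0 mulr1. Qed.

(** Each of the eight double products gains or loses one single product at base [Q]; these combine
    into four thetas. This scalar governs the quasi-periodicity of [Rhat]. *)
Lemma kappa_inv_p : kappa_inv N q p (p * u) =
  kappa_inv N q p u * (Theta Q u^-1 * Theta Q (p * u)) /
    (Theta Q (q ^+ 2 * u) * Theta Q (q ^+ 2 * (p * u)^-1)).
Proof.
have [a1 a2 a3 a4] := kappa_factors_neq0 hu.
have [d1 d2 d3 d4] := kappa_factors_neq0 (avoidsV avpu).
have u0 := avoids_neq0 hu; have pu0 := avoids_neq0 avpu.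
have sh x y : y = x * p -> P2 x = qpoch x Q * P2 y by move=> ->; apply: qpoch2Sl.
have QQ := qpoch_neq0' Q1.
have q2 : q ^+ 2 != 0 by rewrite expf_neq0.
rewrite /kappa_inv /=; apply: (ratio (K := qpoch Q Q)).
- by apply: sh; field; rewrite u0 p0.
- by apply: sh; ring.
- by apply: sh; field; rewrite u0 p0.
- by apply: sh; ring.
- by apply: sh; ring.
- by apply: sh; field; rewrite u0 p0.
- by apply: sh; ring.
- by apply: sh; field; rewrite u0 p0.
- rewrite (@ThetaE Q u^-1 (Q * u)) ?invr_eq0 //; last by field.
  rewrite (@ThetaE Q (p * u) (Q * (p * u)^-1)) //; last by field; rewrite u0 p0.
  have -> : p * (p * u)^-1 = u^-1 by field; rewrite u0 p0.
  ring.
- rewrite (@ThetaE Q (q ^+ 2 * u) (p * q ^+ (2 * N - 2) * (p * u)^-1)); first last.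
  + by rewrite mulf_neq0.
  + by rewrite -qQ; field; rewrite u0 p0.
  rewrite (@ThetaE Q (q ^+ 2 * (p * u)^-1) (p * q ^+ (2 * N - 2) * u)); first last.
  + by rewrite mulf_neq0 // invr_eq0.
  + by rewrite -qQ; field; rewrite u0 p0.
  ring.
- exact: QQ.
- exact: a2.
- exact: a4.
- exact: a1.
- exact: d2.
- exact: a3.
- exact: d4.
Qed.

(** The same with the two bases exchanged. The thetas now have base [p], so they are values of [th]
    by [th_Theta] and cancel the theta quotients that occur in crossing. *)
Lemma kappa_inv_Q : kappa_inv N q p (Q * u) =
  kappa_inv N q p u * (Theta p u^-1 * Theta p (Q * u)) /
    (Theta p (q ^+ 2 * u) * Theta p (q ^+ 2 * (Q * u)^-1)).
Proof.
have [a1 a2 a3 a4] := kappa_factors_neq0 hu.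
have [d1 d2 d3 d4] := kappa_factors_neq0 (avoidsV avQu).
have u0 := avoids_neq0 hu; have Qu0 := avoids_neq0 avQu.
have sh x y : y = x * Q -> P2 x = qpoch x p * P2 y by move=> ->; apply: qpoch2Sr.
have pp := qpoch_neq0' p1.
have q2 : q ^+ 2 != 0 by rewrite expf_neq0.
rewrite /kappa_inv /=; apply: (ratio (K := qpoch p p)).
- by apply: sh; field; rewrite u0 Q0.
- by apply: sh; ring.
- by apply: sh; field; rewrite u0 Q0.
- by apply: sh; ring.
- by apply: sh; ring.
- by apply: sh; field; rewrite u0 Q0.
- by apply: sh; ring.
- by apply: sh; field; rewrite u0 Q0.
- rewrite (@ThetaE p u^-1 (p * u)) ?invr_eq0 //; last by field.
  rewrite (@ThetaE p (Q * u) (p * (Q * u)^-1)) //; last by field; rewrite u0 Q0.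
  have -> : Q * (Q * u)^-1 = u^-1 by field; rewrite u0 Q0.
  ring.
- rewrite (@ThetaE p (q ^+ 2 * u) (p * q ^+ (2 * N - 2) * (Q * u)^-1)); first last.
  + by rewrite mulf_neq0.
  + by rewrite -qQ; field; rewrite u0 q0 expf_neq0.
  rewrite (@ThetaE p (q ^+ 2 * (Q * u)^-1) (p * q ^+ (2 * N - 2) * u)); first last.
  + by rewrite mulf_neq0 // invr_eq0.
  + by rewrite -qQ; field; rewrite u0 q0 expf_neq0.
  ring.
- exact: pp.
- exact: a2.
- exact: a4.
- exact: a1.
- exact: d2.
- exact: a3.
- exact: d4.
Qed.

End Functional.

End Kappa.
End ThetaProducts.

(** * The R-matrix *)

Section RMatrixEntries.
Context {R : realType}.
Local Notation C := R[i].
Variable n : nat.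
Local Notation N := n.+2.
Local Notation I := 'I_N.
Local Notation om := (@omega R N).
Local Notation chi := (@chi R n).

(* [i], [j] index the first tensor factor and [k], [l] the second. *)
Definition ent (T : Type) (M : 'M[T]_(N * N)) (i k j l : I) : T :=
  M (mxtens_index (i, k)) (mxtens_index (j, l)).

Lemma ent_eq (T : Type) (M M' : 'M[T]_(N * N)) :
  (forall i k j l, ent M i k j l = ent M' i k j l) -> M = M'.
Proof.
move=> h; apply/matrixP => x y.
by rewrite -[x]mxtens_unindexK -[y]mxtens_unindexK; case: mxtens_unindex => i k;
  case: mxtens_unindex => j l; apply: h.
Qed.

Lemma sum_mxtens (T : nmodType) (F : 'I_(N * N) -> T) :
  \sum_x F x = \sum_i \sum_k F (mxtens_index (i, k)).
Proof.
rewrite pair_big /= (reindex (@mxtens_index N N)) /=; last first.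
  by exists (@mxtens_unindex N N) => x _; rewrite ?mxtens_indexK ?mxtens_unindexK.
by apply: eq_bigr => -[].
Qed.

Lemma ent_mul (T : pzRingType) (M M' : 'M[T]_(N * N)) i k j l :
  ent (M *m M') i k j l = \sum_a \sum_b ent M i k a b * ent M' a b j l.
Proof. by rewrite /ent mxE sum_mxtens. Qed.

Lemma ent_tens (T : pzRingType) (A B : 'M[T]_N) i k j l :
  ent (tensmx A B) i k j l = A i j * B k l.
Proof. by rewrite /ent tensmxE. Qed.

Lemma ent_scale (T : pzRingType) (a : T) (M : 'M[T]_(N * N)) i k j l :
  ent (a *: M) i k j l = a * ent M i k j l.
Proof. by rewrite /ent mxE. Qed.

Lemma ent_id (T : pzRingType) i k j l :
  ent (1%:M : 'M[T]_(N * N)) i k j l = (i == j)%:R * (k == l)%:R.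
Proof.
rewrite /ent mxE (can_eq (@mxtens_indexK N N)) xpair_eqE.
by case: (i == j); rewrite /= ?mul1r ?mul0r.
Qed.

Lemma gmxX k (i j : I) : (gmx N ^+ k) i j = om ^+ (i.+1 * k) *+ (i == j) :> C.
Proof.
elim: k i j => [|k ih] i j; first by rewrite expr0 mxE muln0 expr0.
rewrite exprSr mxE (bigD1 j) //= big1 => [|b bj]; last by rewrite [gmx N b j]mxE (negbTE bj) mulr0.
rewrite addr0 ih mxE eqxx mulr1n mulnS addnC exprD; case: eqP => [->|_]; first by rewrite !mulr1n.
by rewrite !mulr0n mul0r.
Qed.

Lemma ordS_Zp (i : I) : ordS i = i + 1.
Proof. by apply/val_inj; rewrite /= modnDmr addn1. Qed.

Lemma hmxX k (i j : I) : (hmx N ^+ k) i j = (i + k%:R == j)%:R :> C.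
Proof.
elim: k i j => [|k ih] i j; first by rewrite expr0 mxE addr0.
rewrite exprSr mxE (bigD1 (i + k%:R)) //= big1 => [|b bj]; last first.
  by rewrite ih eq_sym (negbTE bj) mul0r.
by rewrite addr0 ih eqxx mul1r mxE ordS_Zp -natr1 addrA.
Qed.

Lemma ImxE (a c i j : I) : Imx N a c i j = chi c ^+ i.+1 * (i + a == j)%:R :> C.
Proof.
rewrite mxE (bigD1 i) //= big1 => [|b bi]; last by rewrite gmxX eq_sym (negbTE bi) mul0r.
by rewrite addr0 gmxX eqxx hmxX natr_Zp -exprM mulnC.
Qed.

Lemma invImxE (a c i j : I) :
  invmx (Imx N a c) i j = (chi c ^+ j.+1)^-1 * (i == j + a)%:R :> C.
Proof.
pose V : 'M[C]_N := \matrix_(i, j) ((chi c ^+ j.+1)^-1 * (i == j + a)%:R).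
have e : Imx N a c *m V = 1%:M.
  apply/matrixP => k l; rewrite !mxE (bigD1 (k + a)) //= big1 => [|b bk]; last first.
    by rewrite ImxE eq_sym (negbTE bk) mulr0 mul0r.
  rewrite addr0 ImxE eqxx mulr1 mxE (inj_eq (addIr a)).
  case: eqP => [->|_]; last by rewrite !mulr0.
  by rewrite mulr1 divff // expf_neq0 // chi_neq0.
have [u _] := mulmx1_unit e.
by have := congr1 (fun M : 'M[C]_N => M i j) (mulKmx u V); rewrite e mulmx1 mxE => ->.
Qed.

Variables (gh : 'M[C]_N).
Hypothesis gh_diag : is_diag_mx gh.
Hypothesis gh_sqr : gh *m gh = gmx N.

Let d (i : I) : C := gh i i.

Let ghE i j : gh i j = d i *+ (i == j).
Proof.
case: eqP => [->|/eqP ij]; first by rewrite mulr1n.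
by have /is_diag_mxP := gh_diag; apply.
Qed.

Let d_sqr i : d i ^+ 2 = om ^+ i.+1.
Proof.
have := congr1 (fun M : 'M[C]_N => M i i) gh_sqr; rewrite !mxE eqxx mulr1n => <-.
rewrite (bigD1 i) //= big1 => [|b bi]; first by rewrite addr0 expr2.
by rewrite ghE eq_sym (negbTE bi) mul0r.
Qed.

Let d_neq0 i : d i != 0.
Proof.
have : d i ^+ 2 != 0 by rewrite d_sqr expf_neq0 // epi_neq0.
by rewrite expf_eq0.
Qed.

Lemma gh_sqrE i : gh i i ^+ 2 = om ^+ i.+1. Proof. exact: d_sqr. Qed.

Lemma gh_neq0 i : gh i i != 0. Proof. exact: d_neq0. Qed.

Let gh_inv : gh *m (\matrix_(i, j) ((d i)^-1 *+ (i == j))) = 1%:M.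
Proof.
apply/matrixP => i j; rewrite !mxE (bigD1 i) //= big1 => [|b bi]; last first.
  by rewrite ghE eq_sym (negbTE bi) mul0r.
rewrite addr0 ghE eqxx mxE; case: eqP => _; rewrite ?mulr1n ?mulr0n ?mulr0 //.
by rewrite divff.
Qed.

Let ghVE i j : invmx gh i j = (d i)^-1 *+ (i == j).
Proof.
have [u _] := mulmx1_unit gh_inv.
have := congr1 (fun M : 'M[C]_N => M i j) (mulKmx u (\matrix_(i, j) ((d i)^-1 *+ (i == j)))).
by rewrite gh_inv mulmx1 mxE => ->.
Qed.

Lemma amxE i j : amx gh i j = d i * d j * (i + 1 == j)%:R.
Proof.
rewrite /amx !mxE (bigD1 j) //= big1 => [|b bj]; last by rewrite ghE (negbTE bj) mulr0.
rewrite addr0 ghE eqxx mulr1n !mxE (bigD1 i) //= big1 => [|b bi]; last first.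
  by rewrite ghE eq_sym (negbTE bi) mul0r.
by rewrite addr0 ghE eqxx mulr1n mxE ordS_Zp mulrAC.
Qed.

Lemma amx_unit : amx gh \in unitmx.
Proof.
have [u _] := mulmx1_unit gh_inv.
rewrite /amx !unitmx_mul u andbT /=.
have : hmx N *m (hmx N)^T = 1%:M :> 'M[C]_N.
  apply/matrixP => i j; rewrite !mxE (bigD1 (i + 1)) //= big1 => [|b bi]; last first.
    by rewrite mxE ordS_Zp eq_sym (negbTE bi) mul0r.
  by rewrite addr0 !mxE !ordS_Zp eqxx mul1r eq_sym (inj_eq (addIr 1)).
by case/mulmx1_unit.
Qed.

Lemma ent_mull (T : pzRingType) (A B : 'M[T]_N) (M : 'M[T]_(N * N)) i k j l i' k' :
  (forall a, a != i' -> A i a = 0) -> (forall b, b != k' -> B k b = 0) ->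
  ent (tensmx A B *m M) i k j l = A i i' * B k k' * ent M i' k' j l.
Proof.
move=> hA hB; rewrite ent_mul (bigD1 i') //= [X in _ + X]big1 => [|a ai]; last first.
  by rewrite big1 // => b _; rewrite ent_tens hA // !mul0r.
rewrite addr0 (bigD1 k') //= [X in _ + X]big1 => [|b bk]; last first.
  by rewrite ent_tens hB // mulr0 mul0r.
by rewrite addr0 ent_tens.
Qed.

Lemma ent_mulr (T : pzRingType) (A B : 'M[T]_N) (M : 'M[T]_(N * N)) i k j l j' l' :
  (forall a, a != j' -> A a j = 0) -> (forall b, b != l' -> B b l = 0) ->
  ent (M *m tensmx A B) i k j l = ent M i k j' l' * (A j' j * B l' l).
Proof.
move=> hA hB; rewrite ent_mul (bigD1 j') //= [X in _ + X]big1 => [|a ai]; last first.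
  by rewrite big1 // => b _; rewrite ent_tens hA // mul0r mulr0.
rewrite addr0 (bigD1 l') //= [X in _ + X]big1 => [|b bk]; last first.
  by rewrite ent_tens hB // !mulr0.
by rewrite addr0 ent_tens.
Qed.

Section RmxEntries.
Variables (zeta tau : C).
Local Notation t := (th tau).
Local Notation q := (epi zeta).
Local Notation p := (epi (2 * tau)).
Hypothesis p1 : `|p| < 1.

Definition Rscal (xi : C) : C :=
  epi (xi * (2 / N%:R - 2)) * kappa_inv N q p (epi xi ^+ 2) * (t zeta / t (xi + zeta)).

(** Only [a = j - i] contributes to an entry. Rows are labelled from 1 in both tensor factors, so
    the offsets of the two powers of [chi c] cancel and [chi (- (c * (l - i)))] remains; conjugation
    by [gh] adds the diagonal prefactor. *)
Lemma ent_Rmx xi i k j l : ent (Rmx gh zeta tau xi) i k j l =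
  d i * d k / (d j * d l) * (Rscal xi * Sent tau xi zeta i k j l).
Proof.
have RtE : ent (Rtilde N zeta tau xi) i k j l = Rscal xi * Sent tau xi zeta i k j l.
  rewrite /Rtilde ent_scale; congr (_ * _).
  have -> : ent (\sum_(a1 < N) \sum_(a2 < N)
       Defs.W N a1 a2 xi zeta tau *: tensmx (Imx N a1 a2) (invmx (Imx N a1 a2))) i k j l =
    \sum_(a : I) \sum_(c : I) wcoef tau a c xi zeta *
      (chi c ^+ i.+1 * (i + a == j)%:R * ((chi c ^+ l.+1)^-1 * (k == l + a)%:R)).
    rewrite /ent summxE; apply: eq_bigr => a _; rewrite summxE; apply: eq_bigr => c _.
    by rewrite mxE tensmxE ImxE invImxE /wcoef W_Wz.
  rewrite (bigD1 (j - i)) //= [X in _ + X]big1 => [|a aji]; last first.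
    rewrite big1 // => c _; rewrite (_ : i + a == j = false) ?mulr0 ?mul0r ?mulr0 //.
    by apply: contraNF aji => /eqP <-; rewrite addrC addKr.
  rewrite addr0 /Sent mulr_sumr; apply: eq_bigr => c _.
  rewrite (_ : (i + (j - i) == j) = true) ?mulr1; last by rewrite subrKC eqxx.
  rewrite (_ : (k == l + (j - i)) = (i + k == j + l)); last first.
    by rewrite addrA -(inj_eq (addrI i)) subrKC (addrC l).
  have chiX (m : I) : chi c ^+ m = chi (c * m) by rewrite chiM exprM.
  rewrite !exprS !chiX mulrBr chiN chiD chiN.
  have c0 := chi_neq0 c; have cl0 := chi_neq0 (c * l); have ci0 := chi_neq0 (c * i).
  by field; rewrite c0 cl0 ci0.
rewrite /Rmx (@ent_mulr _ _ _ _ i k j l j l) => [|a aj|b bl]; last 2 first.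
- by rewrite ghVE (negbTE aj).
- by rewrite ghVE (negbTE bl).
rewrite (@ent_mull _ _ _ _ i k j l i k) => [|a ai|b bk]; last 2 first.
- by rewrite ghE eq_sym (negbTE ai).
- by rewrite ghE eq_sym (negbTE bk).
by rewrite RtE !ghE !ghVE !eqxx !mulr1n invfM mulrAC.
Qed.

End RmxEntries.
End RMatrixEntries.

Section RhatProperties.
Context {R : realType}.
Local Notation C := R[i].
Variable n : nat.
Local Notation N := n.+2.
Local Notation NC := (N%:R : C).
Local Notation I := 'I_N.
Local Notation om := (@omega R N).
Variables (gh : 'M[C]_N).
Hypothesis gh_diag : is_diag_mx gh.
Hypothesis gh_sqr : gh *m gh = gmx N.
Variables (zeta tau : C).
Local Notation t := (th tau).
Local Notation q := (epi zeta).
Local Notation p := (epi (2 * tau)).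
Local Notation Q := (q ^+ (2 * N)).
Hypothesis p1 : `|p| < 1.
Hypothesis q1 : `|q| < 1.
Hypothesis hz : off_lattice tau zeta.
Local Notation Rm := (Rmx gh zeta tau).
Local Notation Rh := (Rhat gh zeta tau).
Local Notation rsc := (Rscal n zeta tau).

Let tau0 : 0 < complex.Im tau. Proof. exact: epi_lt1_Im. Qed.
Let N0 : NC != 0. Proof. exact: NC_neq0. Qed.
Let q0 : q != 0. Proof. exact: epi_neq0. Qed.
Let p0 : p != 0. Proof. exact: epi_neq0. Qed.
Let Q0 : Q != 0. Proof. by rewrite expf_neq0. Qed.
Lemma Q_lt1 : `|Q| < 1.
Proof. by rewrite normrX exprn_ilt1. Qed.
Let Q1 := Q_lt1.
Let RmE := ent_Rmx gh_diag gh_sqr zeta p1.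

(** Conjugation by the permutation of the two tensor factors, which turns R12 into R21. *)
Definition flip (T : Type) (M : 'M[T]_(N * N)) : 'M[T]_(N * N) :=
  \matrix_(x, y) let (i, k) := mxtens_unindex x in let (j, l) := mxtens_unindex y in
    ent M k i l j.

Lemma ent_flip (T : Type) (M : 'M[T]_(N * N)) i k j l : ent (flip M) i k j l = ent M k i l j.
Proof. by rewrite {1}/ent mxE !mxtens_indexK. Qed.

Definition generic (xi : C) : Prop := avoids q p (epi xi ^+ 2).

Lemma genericN xi : generic xi -> generic (- xi).
Proof. by rewrite /generic epiN exprVn => /(avoidsV). Qed.

Lemma generic_shift xi (m : int) : generic xi -> generic (xi + m%:~R * zeta).
Proof.
move=> g; have := avoids_mul q0 p0 (m * 2) 0 g.
rewrite /generic expr0z mulr1 -epiXz -!epi_sqr -epiD; congr (avoids _ _ (epi _)).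
by rewrite intrM; ring.
Qed.

Lemma generic_off xi (m : int) : generic xi -> off_lattice tau (xi + m%:~R * zeta).
Proof.
move=> /(generic_shift m)[_ h] k; rewrite epi_sqr.
by have := h 0 k; rewrite expr0z mul1r.
Qed.

Lemma generic_off0 xi : generic xi -> off_lattice tau xi.
Proof. by move=> /(generic_off 0); rewrite mul0r addr0. Qed.

Lemma Theta_shift (a x : C) : `|a| < 1 -> a != 0 -> x != 0 ->
  Theta a (a * x) = - x^-1 * Theta a x.
Proof.
move=> a1 a0 x0; rewrite /Theta invfM mulVKf //.
rewrite (qpochS x a1) (qpochS x^-1 a1) (mulrC x a) (mulrC x^-1 a).
by field.
Qed.

Lemma Rscal_unitarity xi : generic xi ->
  rsc xi * rsc (- xi) * (t (zeta + xi) * t (zeta - xi) / t zeta ^+ 2) = 1.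
Proof.
move=> g; rewrite /Rscal mulNr !epiN exprVn.
have k1 := kappa_invV q0 p0 p1 Q1 g.
have e1 : epi (xi * (2 / NC - 2)) != 0 by apply: epi_neq0.
have t1 : t (xi + zeta) != 0.
  by apply: off_lattice_th => //; have := generic_off 1 g; rewrite mul1r.
have t2 : t (- xi + zeta) != 0.
  by apply: off_lattice_th => //; have := generic_off 1 (genericN g); rewrite mul1r.
have t0 := off_lattice_th p1 hz.
have -> : zeta + xi = xi + zeta by ring.
have -> : zeta - xi = - xi + zeta by ring.
rewrite -[RHS]k1; field.
by rewrite t0 t2 t1 e1.
Qed.

Lemma Rmx_unitarity xi : generic xi -> Rm xi *m flip (Rm (- xi)) = 1%:M.
Proof.
move=> g; apply: ent_eq => i k j l; rewrite ent_mul ent_id.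
have d0 := gh_neq0 gh_diag gh_sqr.
transitivity (gh i i * gh k k / (gh l l * gh j j) * (rsc xi * rsc (- xi)) *
    Upair tau xi zeta i k j l).
  rewrite /Upair !mulr_sumr; apply: eq_bigr => a _; rewrite mulr_sumr; apply: eq_bigr => b _.
  apply: etrans (congr2 *%R (RmE _ _ _ _ _) (etrans (ent_flip _ _ _ _ _) (RmE _ _ _ _ _))) _.
  move: (Sent _ _ _ _ _ _ _) (Sent _ _ _ _ _ _ _) (rsc _) (rsc _) => s1 s2 s3 s4.
  by field; rewrite !d0.
rewrite U_unitarity //; last first.
- by have := generic_off (-1) g; rewrite mulN1r.
- exact: generic_off0.
have h := Rscal_unitarity g.
have [->|_] := eqVneq i j; last by rewrite !mul0r mulr0.
have [->|_] := eqVneq k l; last by rewrite mulr0 mul0r mulr0.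
rewrite !mulr1 mul1r -[RHS]h (mulrC (gh j j)) divff ?mul1r //.
by rewrite mulf_neq0 // !d0.
Qed.

Lemma Rmx_unit xi : generic xi -> Rm xi \in unitmx.
Proof. by move=> /Rmx_unitarity/mulmx1_unit[]. Qed.

Lemma Rmx_inv xi : generic xi -> invmx (Rm xi) = flip (Rm (- xi)).
Proof.
move=> g; have := mulKmx (Rmx_unit g) (flip (Rm (- xi))).
by rewrite Rmx_unitarity // mulmx1.
Qed.

Lemma Rscal_crossing xi : generic xi ->
  rsc xi * rsc (- xi - NC * zeta) *
    (t xi * t (- xi - NC * zeta) / t zeta ^+ 2) = 1.
Proof.
move=> g; have gN : generic (xi + NC * zeta).
  by have := generic_shift N%:Z g.
have [x' x'E] : exists x', x' = - xi - NC * zeta by eexists.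
have [u ue] : exists u, epi xi ^+ 2 = u by eexists.
rewrite /generic ue in g; rewrite -x'E.
have ux' : epi x' ^+ 2 = (Q * u)^-1.
  rewrite -epi_sqr -ue -epi_sqr -epiXn -epiD -epiN; congr epi.
  by rewrite x'E natrM; ring.
have u0 : u != 0 := avoids_neq0 g.
have Qu : avoids q p (Q * u).
  by have := avoids_shift q0 p0 (2 * N) 0 g; rewrite expr0 mulr1.
have kV := kappa_invV q0 p0 p1 Q1 Qu.
have kQ := kappa_inv_Q q0 p0 p1 Q1 (ltac:(by [])) g.
have k0 := kappa_inv_neq0 q0 p0 p1 Q1 g.
have k0' := kappa_inv_neq0 q0 p0 p1 Q1 Qu.
rewrite /Rscal ux' ue.
have -> : kappa_inv N q p (Q * u)^-1 = (kappa_inv N q p (Q * u))^-1.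
  by apply: (mulfI k0'); rewrite kV divff.
rewrite kQ.
have t0 := off_lattice_th p1 hz.
have T1 := avoids_Theta_p p0 p1 g.
have T2 := avoids_Theta_p p0 p1 Qu.
have h2 := avoids_shift q0 p0 2 0 g; rewrite expr0 mulr1 in h2.
have h3 := avoids_shift q0 p0 2 0 (avoidsV Qu); rewrite expr0 mulr1 in h3.
have T3 := avoids_Theta_p p0 p1 h2.
have T4 := avoids_Theta_p p0 p1 h3.
have tx1 : t (xi + zeta) = - epi (tau / 4 + 2^-1) * (epi (- (xi + zeta)) * Theta p (q ^+ 2 * u)).
  rewrite th_Theta //; congr (_ * (_ * Theta _ _)).
  by rewrite mulrDr epiD !epi_sqr ue mulrC.
have tx2 : t (x' + zeta) = - epi (tau / 4 + 2^-1) * (epi (- (x' + zeta)) * Theta p (q ^+ 2 * (Q * u)^-1)).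
  rewrite th_Theta //; congr (_ * (_ * Theta _ _)).
  by rewrite mulrDr epiD !epi_sqr ux' mulrC.
have tx3 : t xi = - epi (tau / 4 + 2^-1) * (epi (- xi) * Theta p u).
  by rewrite -ue -epi_sqr; apply: th_Theta.
have tx4 : t x' = - epi (tau / 4 + 2^-1) * (epi (- x') * (- (Q * u)^-1 * Theta p (Q * u))).
  have Qu0 : Q * u != 0 := avoids_neq0 Qu.
  by rewrite -(Theta_inv p1 Qu0) -ux' -epi_sqr; apply: th_Theta.
rewrite tx1 tx2 tx3 tx4 (Theta_inv p1 u0).
(* The powers [z^(2/N - 2)] at [xi] and at [- xi - N zeta] multiply to [Q / q^2]; this balances the
   monomials released by [th_Theta] and [Theta_inv]. *)
have ex : epi (x' * (2 / NC - 2)) = (epi (xi * (2 / NC - 2)))^-1 * (Q / q ^+ 2).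
  rewrite -epiN -!epiXn -epiB -epiD; congr epi; rewrite x'E natrM.
  by move: N0; generalize NC => M M0; field.
have e2 := epi_neq0 xi; have e3 := epi_neq0 x'.
rewrite ex !opprD !epiD !epiN; field.
by rewrite t0 u0 Q0 e3 e2 q0 T4 !epi_neq0 T3 T2 T1 k0.
Qed.

Lemma Rmx_crossing xi i k e b' : generic xi ->
  \sum_d \sum_b ent (Rm xi) d k i b * ent (invmx (Rm (xi + NC * zeta))) e b d b' =
  (k == b')%:R * (e == i)%:R.
Proof.
move=> g; have gN : generic (xi + NC * zeta) by have := generic_shift N%:Z g.
have d0 := gh_neq0 gh_diag gh_sqr.
rewrite Rmx_inv //.
transitivity (gh k k * gh e e / (gh i i * gh b' b') *
  (rsc xi * rsc (- xi - NC * zeta)) *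
  \sum_d \sum_b Sent tau xi zeta d k i b * Sent tau (- xi - NC * zeta) zeta b e b' d).
  rewrite mulr_sumr; apply: eq_bigr => d _; rewrite mulr_sumr; apply: eq_bigr => b _.
  rewrite opprD; apply: etrans (congr2 *%R (RmE _ _ _ _ _) (etrans (ent_flip _ _ _ _ _) (RmE _ _ _ _ _))) _.
  move: (Sent _ _ _ _ _ _ _) (Sent _ _ _ _ _ _ _) (rsc _) (rsc _) => s1 s2 s3 s4.
  by field; rewrite !d0.
rewrite S_crossing //; first last.
- exact: generic_off0.
- exact: generic_off0.
have h := Rscal_crossing g.
have [->|_] := eqVneq k b'; last by rewrite !mul0r mulr0.
have [->|_] := eqVneq e i; last by rewrite mulr0 mul0r mulr0.
rewrite !mulr1 mul1r -[RHS]h (mulrC (gh b' b')) divff ?mul1r //.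
by rewrite mulf_neq0 // !d0.
Qed.

End RhatProperties.

(** * Crossing and quasi-periodicity of R-hat *)

Section RhatSymmetries.
Context {R : realType}.
Local Notation C := R[i].
Variable n : nat.
Local Notation N := n.+2.
Local Notation NC := (N%:R : C).
Local Notation I := 'I_N.
Local Notation om := (@omega R N).
Local Notation chi := (@chi R n).
Variables (gh : 'M[C]_N).
Hypothesis gh_diag : is_diag_mx gh.
Hypothesis gh_sqr : gh *m gh = gmx N.
Variables (zeta tau : C).
Local Notation t := (th tau).
Local Notation q := (epi zeta).
Local Notation p := (epi (2 * tau)).
Local Notation Q := (q ^+ (2 * N)).
Hypothesis p1 : `|p| < 1.
Hypothesis q1 : `|q| < 1.
Hypothesis hz : off_lattice tau zeta.
Local Notation Rm := (Rmx gh zeta tau).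
Local Notation Rh := (Rhat gh zeta tau).
Local Notation rsc := (Rscal n zeta tau).
Local Notation T := (Theta Q).
Local Notation am := (amx gh).

Let tau0 : 0 < complex.Im tau. Proof. exact: epi_lt1_Im. Qed.
Let N0 : NC != 0. Proof. exact: NC_neq0. Qed.
Let N0' : 2 + n%:R != 0 :> C. Proof. by rewrite -natrD pnatr_eq0. Qed.
Let q0 : q != 0. Proof. exact: epi_neq0. Qed.
Let p0 : p != 0. Proof. exact: epi_neq0. Qed.
Let Q0 : Q != 0. Proof. by rewrite expf_neq0. Qed.
Let Q1 : `|Q| < 1. Proof. exact: Q_lt1. Qed.
Let RmE := ent_Rmx gh_diag gh_sqr zeta p1.
Let d0 := gh_neq0 gh_diag gh_sqr.
Let d2 := gh_sqrE gh_diag gh_sqr.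
Let aE := amxE gh_diag.

Definition hatscal (xi : C) : C := tauN N zeta (zeta / 2 - xi).

Lemma RhatE xi : Rh xi = hatscal xi *: Rm xi. Proof. by []. Qed.

Lemma hatscalE xi : hatscal xi = epi ((zeta / 2 - xi) * (2 / NC - 2)) *
  (T (q ^+ 2 * (epi xi ^+ 2)^-1) / T (epi xi ^+ 2)).
Proof.
have e : epi (zeta / 2 - xi) ^+ 2 = q / epi xi ^+ 2.
  by rewrite -!epi_sqr -epiB; congr epi; field.
have e1 : q * (q / epi xi ^+ 2) = q ^+ 2 * (epi xi ^+ 2)^-1 by rewrite mulrA expr2.
have e2 : q * (q / epi xi ^+ 2)^-1 = epi xi ^+ 2 by rewrite invfM invrK mulVKf.
by rewrite /hatscal /tauN e e1 e2.
Qed.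

Local Notation generic := (@generic R zeta tau).

Lemma hatscal_neq0 xi : generic xi -> hatscal xi != 0.
Proof.
move=> g; rewrite hatscalE mulf_neq0 ?epi_neq0 // mulf_neq0 ?invr_eq0 //.
  have := avoids_shift q0 p0 2 0 (avoidsV g); rewrite expr0 mulr1.
  exact: avoids_Theta_Q.
exact: (avoids_Theta_Q q0 Q1 g).
Qed.

(** [tauN] has period [q^N]; hence crossing holds for [Rhat] without any extra factor. *)
Lemma hatscal_shift xi : generic xi -> hatscal (xi + NC * zeta) = hatscal xi.
Proof.
move=> g; rewrite !hatscalE; have u0 := avoids_neq0 g.
have -> : epi (xi + NC * zeta) ^+ 2 = Q * epi xi ^+ 2.
  by rewrite -!epi_sqr -epiXn -epiD; congr epi; rewrite natrM; ring.
rewrite (Theta_shift Q1 Q0 u0).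
have y0 : q ^+ 2 * (Q * epi xi ^+ 2)^-1 != 0.
  by rewrite mulf_neq0 ?expf_neq0 // invr_eq0 mulf_neq0.
have e : q ^+ 2 * (epi xi ^+ 2)^-1 = Q * (q ^+ 2 * (Q * epi xi ^+ 2)^-1).
  by rewrite (invfM Q) [RHS]mulrCA mulVKf.
have := Theta_shift Q1 Q0 y0; rewrite -e => ->.
have -> : epi ((zeta / 2 - (xi + NC * zeta)) * (2 / NC - 2)) =
   epi ((zeta / 2 - xi) * (2 / NC - 2)) * (Q / q ^+ 2).
  rewrite -!epiXn -epiB -epiD; congr epi; rewrite natrM.
  by field; rewrite N0'.
have T1 := avoids_Theta_Q q0 Q1 g.
move: (T _) (T _) (epi (_ * (2 / NC - 2))) T1 => T2 T3 E T1.
move: (epi xi ^+ 2) u0 T1 => u u0 T1.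
field; rewrite ?T1 ?u0 ?Q0 ?q0 //.
Qed.

Lemma Rhat_unit xi : generic xi -> Rh xi \in unitmx.
Proof.
move=> g; rewrite RhatE unitmxZ; last by rewrite unitfE hatscal_neq0.
exact: (Rmx_unit gh_diag gh_sqr p1 q1 hz g).
Qed.

Lemma Rhat_crossing xi i k e b' : generic xi ->
  \sum_d \sum_b ent (Rh xi) d k i b * ent (invmx (Rh (xi + NC * zeta))) e b d b' =
  (k == b')%:R * (e == i)%:R.
Proof.
move=> g; have gN : generic (xi + NC * zeta) by have := generic_shift N%:Z g.
have h0 := hatscal_neq0 g.
rewrite -(Rmx_crossing gh_diag gh_sqr p1 q1 hz _ _ _ _ g).
apply: eq_bigr => d _; apply: eq_bigr => b _.
rewrite !RhatE invmxZ; last first.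
  by rewrite unitmxZ ?unitfE ?hatscal_neq0 //; apply: (Rmx_unit gh_diag gh_sqr p1 q1 hz gN).
rewrite !ent_scale hatscal_shift //; move: (ent _ _ _ _ _) (ent _ _ _ _ _) => x y.
by field.
Qed.

Let RhE xi i k j l : ent (Rh xi) i k j l = hatscal xi *
  (gh i i * gh k k / (gh j j * gh l l) * (rsc xi * Sent tau xi zeta i k j l)).
Proof. exact: etrans (ent_scale _ _ _ _ _ _) (congr1 _ (RmE _ _ _ _ _)). Qed.

Let d2' i : gh i i ^+ 2 = om * chi i.
Proof. by rewrite d2 exprS. Qed.

(** With [u = z^2] this is the inverse of [tauN(q^(1/2) z) * tauN(q^(1/2) / z)]. That is the scalar
    left when, in the quasi-periodicity, the inverse of R21-hat at [1/z] is rewritten by unitarity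
    as a multiple of R12-hat at [z]. *)
Definition qfactor (u : C) : C := epi (zeta * (2 - 2 / NC)) *
  ((T u^-1 * T u) / (T (q ^+ 2 * u) * T (q ^+ 2 * u^-1))).

Lemma w_quasi (a c : I) xi : wcoef tau a c (xi + tau + 1) zeta =
  wcoef tau a c xi zeta * (epi (- tau - 2 * xi - 2 * zeta / NC) * (chi a / chi c)).
Proof.
rewrite /wcoef /Wz; set y := (zeta + _ + _) / NC.
have -> : y + (xi + tau + 1) = y + xi + tau + 1 by ring.
rewrite th1 // thtau // !mulNr opprK.
rewrite (_ : epi (- tau - 2 * xi - 2 * zeta / NC) * (chi a / chi c) =
  epi (2 * (a%:R / NC) * (tau + 1)) * epi (- tau - 2 * (y + xi))); last first.
  rewrite /chi !omegaX // -epiB -!epiD; congr epi; rewrite /y -!pmulrn.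
  by field; rewrite N0'.
rewrite (_ : epi (2 * (a%:~R / NC) * (xi + tau + 1)) =
  epi (2 * (a%:~R / NC) * xi) * epi (2 * (a%:R / NC) * (tau + 1))); last first.
  by rewrite -epiD; congr epi; ring.
ring.
Qed.

(** The phase [1 / chi c] from [w_quasi] moves [i] by one inside the Fourier sum, which accounts for
    the matrix [h] in [a]; the phase [chi a] stays as a prefactor and is absorbed by [g^(1/2)]. *)
Lemma S_quasi xi i k j l : Sent tau (xi + tau + 1) zeta (i + 1) k j l =
  epi (- tau - 2 * xi - 2 * zeta / NC) * chi (j - (i + 1)) * Sent tau xi zeta i k (j - 1) l.
Proof.
rewrite /Sent; have -> : (i + k == j - 1 + l) = (i + 1 + k == j + l).
  by rewrite -(inj_eq (addIr 1)) addrAC; congr (_ == _); ring.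
rewrite mulrCA; congr (_ * _); rewrite mulr_sumr; apply: eq_bigr => c _.
rewrite w_quasi (_ : j - 1 - i = j - (i + 1)); last by ring.
have -> : chi (- (c * (l - i))) = (chi c)^-1 * chi (- (c * (l - (i + 1)))).
  by rewrite -chiN -chiD; congr chi; ring.
ring.
Qed.

Lemma Rscal_quasi xi : generic xi ->
  hatscal (xi + tau + 1) * rsc (xi + tau + 1) * epi (- tau - 2 * xi - 2 * zeta / NC) =
  qfactor (epi xi ^+ 2) * (hatscal xi * rsc xi).
Proof.
move=> g; rewrite !hatscalE /Rscal.
have -> : epi (xi + tau + 1) ^+ 2 = p * epi xi ^+ 2.
  by rewrite -!epi_sqr -epiD; apply: (@epi_mod2 _ 1); ring.
have -> : xi + tau + 1 + zeta = xi + zeta + tau + 1 by ring.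
rewrite th1 // thtau // mulNr opprK.
have gp : avoids q p (p * epi xi ^+ 2).
  by have := avoids_shift q0 p0 0 1 g; rewrite expr0 expr1 mul1r.
have kp := kappa_inv_p q0 p0 p1 Q1 (isT : (1 < N)%N) g.
rewrite kp /qfactor.
have T1 := avoids_Theta_Q q0 Q1 g.
have T2 := avoids_Theta_Q q0 Q1 gp.
have h3 := avoids_shift q0 p0 2 0 g; rewrite expr0 mulr1 in h3.
have h4 := avoids_shift q0 p0 2 0 (avoidsV gp); rewrite expr0 mulr1 in h4.
have h5 := avoids_shift q0 p0 2 0 (avoidsV g); rewrite expr0 mulr1 in h5.
have T3 := avoids_Theta_Q q0 Q1 h3.
have T4 := avoids_Theta_Q q0 Q1 h4.
have T5 := avoids_Theta_Q q0 Q1 h5.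
have t1 : t (xi + zeta) != 0.
  by apply: off_lattice_th => //; have := generic_off 1 g; rewrite mul1r.
have e2 := epi_neq0 (- tau - 2 * (xi + zeta)).
have E : epi ((zeta / 2 - (xi + tau + 1)) * (2 / NC - 2)) *
    epi ((xi + tau + 1) * (2 / NC - 2)) * epi (- tau - 2 * xi - 2 * zeta / NC) =
  epi (zeta * (2 - 2 / NC)) * (epi ((zeta / 2 - xi) * (2 / NC - 2)) * epi (xi * (2 / NC - 2)))
    * epi (- tau - 2 * (xi + zeta)).
  by rewrite -!epiD; congr epi; field; rewrite N0'.
move: (epi (- tau - 2 * (xi + zeta))) e2 E => E2 e2.
move: (epi ((zeta / 2 - (xi + tau + 1)) * (2 / NC - 2))) => E3.
move: (epi ((xi + tau + 1) * (2 / NC - 2))) => E4.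
move: (epi (- tau - 2 * xi - 2 * zeta / NC)) => E5.
move: (epi (zeta * (2 - 2 / NC))) (epi ((zeta / 2 - xi) * (2 / NC - 2))) (epi (xi * (2 / NC - 2))).
move=> E6 E7 E8 E.
move: (kappa_inv _ _ _ _) (t zeta) (t (xi + zeta)) t1 => k z x x0.
move: T1 T2 T3 T4 T5; move: (T (epi xi ^+ 2)) (T (p * _)) (T (q ^+ 2 * epi xi ^+ 2)).
move: (T (q ^+ 2 * (p * _)^-1)) (T (q ^+ 2 * (epi xi ^+ 2)^-1)) (T (epi xi ^+ 2)^-1).
move=> A4 A5 A6 A1 A2 A3 T1 T2 T3 T4 T5.
transitivity ((E3 * E4 * E5) * (A4 / A2 * (k * (A6 * A2) / (A3 * A4)) * (z / (E2 * x)))).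
  by ring.
by rewrite E; field; rewrite T1 T2 T3 T4 T5 x0 e2.
Qed.

Lemma Rhat_quasi xi : generic xi ->
  tensmx am 1%:M *m Rh (xi + tau + 1) =
  qfactor (epi xi ^+ 2) *: (Rh xi *m tensmx am 1%:M).
Proof.
move=> g; apply: ent_eq => i k j l.
have id_offl b : b != k -> (1%:M : 'M[C]_N) k b = 0.
  by rewrite eq_sym mxE => /negbTE ->.
have id_offr b : b != l -> (1%:M : 'M[C]_N) b l = 0.
  by rewrite mxE => /negbTE ->.
have a_offl a : a != i + 1 -> am i a = 0.
  by rewrite aE eq_sym => /negbTE ->; rewrite mulr0.
have a_offr a : a != j - 1 -> am a j = 0.
  by rewrite aE -(inj_eq (addIr 1)) subrK => /negbTE ->; rewrite mulr0.
apply: etrans (ent_mull _ _ _ a_offl id_offl) _.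
apply: etrans _ (esym (ent_scale _ _ _ _ _ _)).
apply: etrans _ (congr1 _ (esym (ent_mulr _ _ _ a_offr id_offr))).
rewrite !aE subrK !eqxx !mulr1.
have one_diag (b : I) : (1%:M : 'M[C]_N) b b = 1 by rewrite mxE eqxx.
rewrite !one_diag !mulr1.
apply: etrans (congr1 _ (RhE _ _ _ _ _)) _.
apply: etrans _ (congr1 _ (congr1 ( *%R^~ _) (esym (RhE _ _ _ _ _)))).
rewrite S_quasi; have := Rscal_quasi g.
(* The entry of [a] contains [g^(1/2)] on both sides of [h], so the square of a diagonal entry
   appears, and [g_(i+1) * chi (j - (i + 1)) = g_j] uses up the phase left by [S_quasi]. *)
have key : gh (i + 1) (i + 1) ^+ 2 * chi (j - (i + 1)) = gh j j ^+ 2.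
  by rewrite !d2' -mulrA -chiD subrKC.
move: (Sent _ _ _ _ _ _ _) (hatscal (xi + tau + 1)) (rsc (xi + tau + 1)).
move: (epi (- tau - _ - _)) (qfactor _) (hatscal xi) (rsc xi).
move=> E f h s s0 h' s' r.
transitivity ((h' * s' * E) * (gh (i + 1) (i + 1) ^+ 2 * chi (j - (i + 1))) *
  (s0 * gh i i * gh k k / (gh j j * gh l l))); first by ring.
by rewrite r key; field; rewrite !d0.
Qed.

Lemma th_periodic x delta : epi delta = 1 -> t (x + delta) = t x.
Proof.
move=> e1; apply: (zlim_unique (theta_zlim tau0 _ _ _)).
apply: zlim_eq (theta_zlim tau0 _ _ _) => m; rewrite /theta_term.
have e : epi (delta * m%:~R + delta * m%:~R + delta) = 1.
  by rewrite !epiD epiXz e1 exp1rz !mulr1.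
apply: etrans (esym (mulr1 _)) _; apply: etrans (congr1 _ (esym e)) _.
by rewrite -epiD; congr epi; field.
Qed.

(** The first condition gives invariance of [z] and, through [th_periodic], of the thetas; the
    second handles [z^(2/N)], which enters the scalar prefactors and the exponentials of [Wz]. *)
Lemma Rhat_periodic xi delta : epi delta = 1 -> epi (delta * (2 / NC)) = 1 ->
  Rh (xi + delta) = Rh xi.
Proof.
move=> e1 e2.
have ex : epi (xi + delta) = epi xi by rewrite epiD e1 mulr1.
have ec x : epi ((x + delta) * (2 / NC - 2)) = epi (x * (2 / NC - 2)).
  have ed : epi (delta * (2 / NC - 2)) = 1.
    by rewrite mulrBr epiB e2 mulr_natr epiMn e1 expr1n divr1.
  by rewrite mulrDl epiD ed mulr1.
have eh : hatscal (xi + delta) = hatscal xi.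
  rewrite !hatscalE ex; congr (_ * _).
  by rewrite -[in LHS](ec (zeta / 2 - (xi + delta))); congr epi; ring.
have es : rsc (xi + delta) = rsc xi.
  rewrite /Rscal ex ec (_ : xi + delta + zeta = xi + zeta + delta); last by ring.
  by rewrite th_periodic.
have ew (a c : I) : wcoef tau a c (xi + delta) zeta = wcoef tau a c xi zeta.
  have e3 : epi (2 * (a%:~R / NC) * (xi + delta)) = epi (2 * (a%:~R / NC) * xi).
    rewrite (_ : _ * (xi + delta) = 2 * (a%:~R / NC) * xi + delta * (2 / NC) * a%:R).
      by rewrite epiD epiXn e2 expr1n mulr1.
    by ring.
  have e4 y : t (y + (xi + delta)) = t (y + xi) by rewrite addrA; apply: th_periodic.
  by rewrite /wcoef /Wz e3 e4.
apply: ent_eq => i k j l.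
have eS : Sent tau (xi + delta) zeta i k j l = Sent tau xi zeta i k j l.
  by rewrite /Sent; congr (_ * _); apply: eq_bigr => c _; rewrite ew.
have h1 := RhE (xi + delta) i k j l; rewrite eh es eS in h1.
exact: etrans h1 (esym (RhE xi i k j l)).
Qed.

End RhatSymmetries.

(** * Exchange of traces *)

Section TraceExchange.
Context {R : realType} {A : algType R[i]}.
Local Notation C := R[i].
Variable n : nat.
Local Notation N := n.+2.
Local Notation I := 'I_N.
Local Notation sc := (@scal R A _ _).

Lemma scalM m k l (M : 'M[C]_(m, k)) (M' : 'M[C]_(k, l)) :
  sc (M *m M') = sc M *m sc M'.
Proof.
apply/matrixP => i j; rewrite !mxE scaler_suml; apply: eq_bigr => a _.
by rewrite !mxE mulr_algl scalerA.
Qed.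

Lemma scal1 m : sc (1%:M : 'M[C]_m) = 1%:M.
Proof.
by apply/matrixP => i j; rewrite !mxE; case: (i == j); rewrite ?scale1r ?scale0r.
Qed.

Lemma ent_scal (M : 'M[C]_(N * N)) i k j l : ent (sc M) i k j l = (ent M i k j l)%:A.
Proof. by rewrite /ent mxE. Qed.

Lemma sum_delta_l (F : I -> A) i : \sum_a (i == a)%:R * F a = F i.
Proof.
rewrite (bigD1 i) //= eqxx mul1r big1 ?addr0 // => a ai.
by rewrite eq_sym (negbTE ai) mul0r.
Qed.

Lemma sum_delta_r (F : I -> A) i : \sum_a F a * (a == i)%:R = F i.
Proof.
rewrite (bigD1 i) //= eqxx mulr1 big1 ?addr0 // => a ai.
by rewrite (negbTE ai) mulr0.
Qed.

Lemma ent_sp1_mul (X : 'M[A]_N) (M : 'M[A]_(N * N)) i k j l :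
  ent (sp1 X *m M) i k j l = \sum_a X i a * ent M a k j l.
Proof.
rewrite ent_mul; apply: eq_bigr => a _.
rewrite -[RHS](sum_delta_l (fun b => X i a * ent M a b j l)); apply: eq_bigr => b _.
by rewrite ent_tens mxE; case: (k == b); rewrite /= ?mulr1 ?mul1r ?mulr0 ?mul0r.
Qed.

Lemma ent_sp2_mul (Y : 'M[A]_N) (M : 'M[A]_(N * N)) i k j l :
  ent (sp2 Y *m M) i k j l = \sum_b Y k b * ent M i b j l.
Proof.
rewrite ent_mul exchange_big /=; apply: eq_bigr => b _.
rewrite -[RHS](sum_delta_l (fun a => Y k b * ent M a b j l)); apply: eq_bigr => a _.
by rewrite ent_tens mxE; case: (i == a); rewrite /= ?mul1r ?mul0r.
Qed.

Lemma ent_mul_sp1 (X : 'M[A]_N) (M : 'M[A]_(N * N)) i k j l :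
  ent (M *m sp1 X) i k j l = \sum_a ent M i k a l * X a j.
Proof.
rewrite ent_mul; apply: eq_bigr => a _.
rewrite -[RHS](sum_delta_r (fun b => ent M i k a b * X a j)); apply: eq_bigr => b _.
by rewrite ent_tens mxE; case: (b == l); rewrite /= ?mulr1 ?mulr0.
Qed.

Lemma ent_mul_sp2 (Y : 'M[A]_N) (M : 'M[A]_(N * N)) i k j l :
  ent (M *m sp2 Y) i k j l = \sum_b ent M i k j b * Y b l.
Proof.
rewrite ent_mul exchange_big /=; apply: eq_bigr => b _.
rewrite -[RHS](sum_delta_r (fun a => ent M i k a b * Y b l)); apply: eq_bigr => a _.
by rewrite ent_tens mxE; case: (a == j); rewrite /= ?mulr1 ?mulr0 ?mul1r ?mul0r ?mulr0.
Qed.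

Lemma ent_sp1 (X : 'M[A]_N) i k j l : ent (sp1 X) i k j l = X i j * (k == l)%:R.
Proof. by rewrite ent_tens mxE. Qed.

Lemma ent_sp2 (X : 'M[A]_N) i k j l : ent (sp2 X) i k j l = (i == j)%:R * X k l.
Proof. by rewrite ent_tens mxE. Qed.

Lemma ent_sp12 (X Y : 'M[A]_N) i k j l :
  ent (sp1 X *m sp2 Y) i k j l = X i j * Y k l.
Proof.
rewrite ent_sp1_mul -[RHS](sum_delta_r (fun a => X i a * Y k l)).
apply: eq_bigr => a _; rewrite ent_sp2.
by case: (a == j); rewrite /= ?mul1r ?mulr1 // mul0r !mulr0.
Qed.

Lemma ent_sp21 (X Y : 'M[A]_N) i k j l :
  ent (sp2 Y *m sp1 X) i k j l = Y k l * X i j.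
Proof.
rewrite ent_sp2_mul -[RHS](sum_delta_r (fun b => Y k b * X i j)).
apply: eq_bigr => b _; rewrite ent_sp1.
by case: (b == l); rewrite /= ?mulr1 // !mulr0.
Qed.

Lemma sp1M (X Y : 'M[A]_N) : sp1 (X *m Y) = sp1 X *m sp1 Y.
Proof.
apply: ent_eq => i k j l; rewrite ent_sp1 ent_sp1_mul mxE mulr_suml.
by apply: eq_bigr => a _; rewrite ent_sp1 mulrA.
Qed.

Lemma sp2M (X Y : 'M[A]_N) : sp2 (X *m Y) = sp2 X *m sp2 Y.
Proof.
apply: ent_eq => i k j l; rewrite ent_sp2 ent_sp2_mul mxE mulr_sumr.
apply: eq_bigr => a _; rewrite ent_sp2.
by case: (i == j); rewrite /= ?mul1r // !mul0r mulr0.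
Qed.

Lemma sp1_1 : sp1 (1%:M : 'M[A]_N) = 1%:M.
Proof. by apply: ent_eq => i k j l; rewrite ent_sp1 ent_id mxE. Qed.

Lemma sp2_1 : sp2 (1%:M : 'M[A]_N) = 1%:M.
Proof. by apply: ent_eq => i k j l; rewrite ent_sp2 ent_id mxE. Qed.

Lemma sp1_scal (D : 'M[C]_N) : sp1 (sc D) = sc (tensmx D 1%:M).
Proof.
apply: ent_eq => i k j l; rewrite ent_sp1 ent_scal ent_tens !mxE.
by case: (k == l); rewrite /= ?mulr1 ?mulr0 ?scale0r.
Qed.

Lemma sp2_scal (D : 'M[C]_N) : sp2 (sc D) = sc (tensmx 1%:M D).
Proof.
apply: ent_eq => i k j l; rewrite ent_sp2 ent_scal ent_tens !mxE.
by case: (i == j); rewrite /= ?mul1r ?mul0r ?scale0r.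
Qed.

Lemma sp12_scalC (X : 'M[A]_N) (D : 'M[C]_N) :
  sc (tensmx 1%:M D) *m sp1 X = sp1 X *m sc (tensmx 1%:M D).
Proof.
apply: ent_eq => i k j l; rewrite -sp2_scal ent_sp12 ent_sp21 mxE.
by rewrite mulr_algl mulr_algr.
Qed.

Lemma sp21_scalC (X : 'M[A]_N) (D : 'M[C]_N) :
  sc (tensmx D 1%:M) *m sp2 X = sp2 X *m sc (tensmx D 1%:M).
Proof.
apply: ent_eq => i k j l; rewrite -sp1_scal ent_sp12 ent_sp21 mxE.
by rewrite mulr_algl mulr_algr.
Qed.

(** For matrices over the noncommutative [A] the trace is not cyclic; a matrix with central entries
    can still be carried around it. *)
Lemma mxtrace_scalC m (M : 'M[C]_m) (X : 'M[A]_m) : \tr (sc M *m X) = \tr (X *m sc M).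
Proof.
rewrite /mxtrace (eq_bigr (fun i => \sum_j M i j *: X j i)); last first.
  by move=> i _; rewrite mxE; apply: eq_bigr => j _; rewrite mxE mulr_algl.
rewrite exchange_big; apply: eq_bigr => i _; rewrite mxE; apply: eq_bigr => j _.
by rewrite mxE mulr_algr.
Qed.

Section Exchange.
Variables (l m : 'M[A]_N) (K Ri Rs : 'M[C]_(N * N)).
Hypothesis rel : sp1 m *m sc Ri *m sp2 l = sp2 l *m sc Rs *m sp1 m.
(* [K] and [Ri] become inverse to each other after transposing one space. *)
Hypothesis cross : forall i k e b',
  \sum_d \sum_b ent K d k i b * ent Ri e b d b' = (k == b')%:R * (e == i)%:R.

Let quad := (I * I * (I * I))%type.

(** The entries of [rel] are contracted with [K]; as [K] inverts [Ri] after partial transposition, a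
    single product [m * l] is isolated on one side. *)
Let exchange j i k h : m j i * l k h =
  \sum_(x : quad) (ent K x.1.1 k i x.1.2 * ent Rs j x.2.2 x.2.1 h) *:
    (l x.1.2 x.2.2 * m x.2.1 x.1.1).
Proof.
have rel_ent b d : \sum_e \sum_b' ent Ri e b d b' *: (m j e * l b' h) =
    \sum_a \sum_c ent Rs j c a h *: (l b c * m a d).
  have := congr1 (fun M => ent M j b d h) rel.
  rewrite -!mulmxA ent_sp1_mul ent_sp2_mul => e.
  transitivity (\sum_a m j a * ent (sc Ri *m sp2 l) a b d h).
    apply: eq_bigr => a _; rewrite ent_mul_sp2 mulr_sumr; apply: eq_bigr => b' _.
    by rewrite ent_scal mulr_algl scalerAr.
  rewrite e exchange_big; apply: eq_bigr => c _.
  rewrite ent_mul_sp1 mulr_sumr; apply: eq_bigr => a _.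
  by rewrite ent_scal mulr_algl scalerAr.
transitivity (\sum_d \sum_b ent K d k i b *: \sum_a \sum_c ent Rs j c a h *: (l b c * m a d)).
  under eq_bigr do under eq_bigr do rewrite -rel_ent scaler_sumr.
  under eq_bigr do rewrite exchange_big /=.
  rewrite exchange_big /=.
  transitivity (\sum_e \sum_b' ((k == b')%:R * (e == i)%:R : C) *: (m j e * l b' h)).
    rewrite (bigD1 i) //= [X in _ + X]big1 => [|e ei]; last first.
      by rewrite big1 // => b' _; rewrite (negbTE ei) mulr0 scale0r.
    rewrite addr0 (bigD1 k) //= [X in _ + X]big1 => [|b' bk]; last first.
      by rewrite eq_sym (negbTE bk) mul0r scale0r.
    by rewrite !eqxx mulr1 scale1r addr0.
  apply: eq_bigr => e _.
  under [RHS]eq_bigr do under eq_bigr do rewrite scaler_sumr.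
  under [RHS]eq_bigr do rewrite exchange_big /=.
  rewrite [RHS]exchange_big /=; apply: eq_bigr => b' _.
  rewrite -cross scaler_suml; apply: eq_bigr => d _.
  by rewrite scaler_suml; apply: eq_bigr => b _; rewrite scalerA.
rewrite pair_bigA -[RHS](pair_bigA _ (fun x y : I * I => (ent K x.1 k i x.2 *
  ent Rs j y.2 y.1 h) *: (l x.2 y.2 * m y.1 x.1))) /=; apply: eq_bigr => x _.
rewrite pair_bigA scaler_sumr; apply: eq_bigr => y _.
by rewrite scalerA.
Qed.


Variables (D a : 'M[C]_N).

(* The two twists only act on the second space, so the exchange of [m] with
   [l] carries over to [D l a]. *)
Let exchange_twist j i k h : m j i * (sc D *m l *m sc a) k h =
  \sum_(x : quad) (ent (tensmx 1%:M D *m K) x.1.1 k i x.1.2 *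
      ent (Rs *m tensmx 1%:M a) j x.2.2 x.2.1 h) *:
    (l x.1.2 x.2.2 * m x.2.1 x.1.1).
Proof.
have entK d i' b : ent (tensmx 1%:M D *m K) d k i' b = \sum_v D k v * ent K d v i' b.
  rewrite ent_mul exchange_big; apply: eq_bigr => v _ /=.
  rewrite (bigD1 d) //= big1 ?addr0 => [|d' dd]; last first.
    by rewrite ent_tens mxE eq_sym (negbTE dd) !mul0r.
  by rewrite ent_tens mxE eqxx mul1r.
have entR c b : ent (Rs *m tensmx 1%:M a) j c b h = \sum_w ent Rs j c b w * a w h.
  rewrite ent_mul exchange_big; apply: eq_bigr => v _ /=.
  rewrite (bigD1 b) //= big1 ?addr0 => [|d' dd]; last first.
    by rewrite ent_tens mxE (negbTE dd) mul0r mulr0.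
  by rewrite ent_tens mxE eqxx mul1r.
transitivity (\sum_w \sum_v (D k v * a w h) *: (m j i * l v w)).
  rewrite mxE mulr_sumr; apply: eq_bigr => w _.
  rewrite !mxE mulr_suml mulr_sumr; apply: eq_bigr => v _.
  by rewrite !mxE mulr_algl mulr_algr -!scalerAr scalerA mulrC.
under eq_bigr do under eq_bigr do rewrite exchange scaler_sumr.
under eq_bigr do rewrite exchange_big /=.
rewrite exchange_big /=; apply: eq_bigr => x _.
rewrite entK entR mulr_sumr scaler_suml; apply: eq_bigr => w _.
rewrite mulr_suml scaler_suml; apply: eq_bigr => v _.
by rewrite scalerA; congr (_ *: _); ring.
Qed.

Lemma mxtrace_ent (M : 'M[A]_(N * N)) : \tr M = \sum_(x : I * I) ent M x.1 x.2 x.1 x.2.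
Proof.
rewrite /mxtrace (reindex (fun x : I * I => mxtens_index x)) //=.
  by apply: eq_bigr => -[x1 x2] _.
exists (@mxtens_unindex _ _) => x _; first by rewrite mxtens_indexK.
by rewrite mxtens_unindexK.
Qed.

(** The product of the two traces has [m] next to the twisted [l]. Exchanging them puts [X] and [l]
    to the left of [m] and [m'], and [K] and [Rs] link the two auxiliary spaces into a single
    trace. *)
Lemma mxtrace_exchange (X m' : 'M[A]_N) :
  \tr (X *m m) * \tr (sc D *m l *m sc a *m m') =
  \tr (sc (tensmx 1%:M D *m K) *m (sp1 X *m sp2 l) *m
       (sc (Rs *m tensmx 1%:M a) *m (sp1 m *m sp2 m'))).
Proof.
set K' := tensmx 1%:M D *m K; set B := Rs *m tensmx 1%:M a.
pose F i j k h (x : quad) := (ent K' x.1.1 k i x.1.2 * ent B j x.2.2 x.2.1 h) *: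
  (X i j * l x.1.2 x.2.2 * (m x.2.1 x.1.1 * m' h k)).
transitivity (\sum_(y : quad) \sum_(x : quad) F y.1.1 y.1.2 y.2.1 y.2.2 x).
  rewrite -(pair_bigA _ (fun y z : I * I => \sum_x F y.1 y.2 z.1 z.2 x)) /=.
  rewrite -(pair_bigA _ (fun i j => \sum_(z : I * I) \sum_x F i j z.1 z.2 x)) /=.
  rewrite mulr_suml; apply: eq_bigr => i _; rewrite mxE mulr_suml.
  apply: eq_bigr => j _.
  rewrite -(pair_bigA _ (fun k h => \sum_x F i j k h x)) /= mulr_sumr.
  apply: eq_bigr => k _; rewrite mxE mulr_sumr; apply: eq_bigr => h _.
  rewrite -mulrA (mulrA (m j i)) exchange_twist mulr_suml mulr_sumr.
  apply: eq_bigr => x _; rewrite -scalerAl -scalerAr /F; congr (_ *: _).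
  by rewrite !mulrA.
transitivity (\sum_(x : I * I) \sum_(z : I * I) \sum_(y : I * I) \sum_(t : I * I)
   F y.1 z.1 x.2 t.2 ((x.1, y.2), (t.1, z.2))); last first.
  rewrite mxtrace_ent; apply: eq_bigr => -[d k] _ /=.
  have entP (M M' : 'M[A]_(N * N)) i1 i2 j1 j2 : ent (M *m M') i1 i2 j1 j2 =
      \sum_(z : I * I) ent M i1 i2 z.1 z.2 * ent M' z.1 z.2 j1 j2.
    rewrite ent_mul.
    exact: (pair_bigA _ (fun b c => ent M i1 i2 b c * ent M' b c j1 j2)).
  have lhs j c : ent (sc K' *m (sp1 X *m sp2 l)) d k j c =
      \sum_(z : I * I) ent K' d k z.1 z.2 *: (X z.1 j * l z.2 c).
    by rewrite entP; apply: eq_bigr => z _; rewrite ent_scal ent_sp12 mulr_algl.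
  have rhs j c : ent (sc B *m (sp1 m *m sp2 m')) j c d k =
      \sum_(y : I * I) ent B j c y.1 y.2 *: (m y.1 d * m' y.2 k).
    by rewrite entP; apply: eq_bigr => z _; rewrite ent_scal ent_sp12 mulr_algl.
  rewrite [RHS]entP.
  under [RHS]eq_bigr do rewrite lhs rhs big_distrlr /=.
  apply: eq_bigr => z _; apply: eq_bigr => y _; apply: eq_bigr => t _.
  by rewrite /F /= -scalerAl -scalerAr scalerA.
rewrite !pair_bigA /=.
(* Both sides are sums over the same eight indices; [f] and its inverse [g] match their order of
   nesting. *)
pose f (x : (I * I) * (I * I) * (I * I) * (I * I)) : quad * quad :=
  ((x.1.2.1, x.1.1.2.1, (x.1.1.1.2, x.2.2)), (x.1.1.1.1, x.1.2.2, (x.2.1, x.1.1.2.2))).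
pose g (y : quad * quad) : (I * I) * (I * I) * (I * I) * (I * I) :=
  (((y.2.1.1, y.1.2.1), (y.1.1.2, y.2.2.2), (y.1.1.1, y.2.1.2)), (y.2.2.1, y.1.2.2)).
rewrite (reindex f) //=; exists g => x _.
  by case: x => -[-[[? ?] [? ?]] [? ?]] [? ?].
by case: x => -[[? ?] [? ?]] [[? ?] [? ?]].
Qed.

End Exchange.

Lemma flip_scal (M : 'M[C]_(N * N)) : flip (sc M) = sc (flip M).
Proof. by apply: ent_eq => i k j l; rewrite ent_flip !ent_scal ent_flip. Qed.

Lemma flip_mul (T : pzRingType) (M M' : 'M[T]_(N * N)) : flip (M *m M') = flip M *m flip M'.
Proof.
apply: ent_eq => i k j l; rewrite ent_flip !ent_mul exchange_big.
by apply: eq_bigr => a _; apply: eq_bigr => b _; rewrite !ent_flip.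
Qed.

Lemma flip_flip (T : Type) (M : 'M[T]_(N * N)) : flip (flip M) = M.
Proof. by apply: ent_eq => i k j l; rewrite !ent_flip. Qed.

Lemma flip_sp1 (X : 'M[A]_N) : flip (sp1 X) = sp2 X.
Proof.
apply: ent_eq => i k j l; rewrite ent_flip ent_sp1 ent_sp2.
by case: (i == j); rewrite /= ?mul1r ?mul0r ?mulr1 ?mulr0.
Qed.

Lemma flip_sp2 (X : 'M[A]_N) : flip (sp2 X) = sp1 X.
Proof. by rewrite -flip_sp1 flip_flip. Qed.

Lemma flip_tens (D D' : 'M[C]_N) : flip (tensmx D D') = tensmx D' D.
Proof. by apply: ent_eq => i k j l; rewrite ent_flip !ent_tens mulrC. Qed.

Lemma mxtrace_flip (M : 'M[A]_(N * N)) : \tr (flip M) = \tr M.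
Proof.
rewrite !mxtrace_ent -!(pair_bigA _ (fun i k => ent _ i k i k)) exchange_big.
by apply: eq_bigr => i _; apply: eq_bigr => k _; rewrite ent_flip.
Qed.

End TraceExchange.

Section TraceRatio.
Context {R : realType} {A : algType R[i]}.
Local Notation C := R[i].
Variable n : nat.
Local Notation N := n.+2.
Local Notation sc := (@scal R A _ _).

Lemma sc_tens12 (D : 'M[C]_N) : tensmx D 1%:M *m tensmx 1%:M D = tensmx D D.
Proof. by rewrite tensmx_mul mul1mx mulmx1. Qed.

Lemma sc_tens21 (D : 'M[C]_N) : tensmx 1%:M D *m tensmx D 1%:M = tensmx D D.
Proof. by rewrite tensmx_mul mul1mx mulmx1. Qed.

Variables (l l' m m' : 'M[A]_N) (a D : 'M[C]_N).
Variables (R0 Rs K K' Ri Ris Ri' Ris' : 'M[C]_(N * N)) (F F' f f' : C).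
Local Notation a1 := (tensmx a 1%:M).
Local Notation D1 := (tensmx D 1%:M).
Hypothesis R0_unit : R0 \in unitmx.
Hypothesis Rs_unit : Rs \in unitmx.
Hypothesis rel_ll : sc R0 *m sp1 l *m sp2 l' = sp2 l' *m sp1 l *m sc Rs.
Hypothesis rel_mm : sp1 m *m sp2 m' *m sc R0 = sc Rs *m sp2 m' *m sp1 m.
Hypothesis rel_ml : sp1 m *m sc Ri *m sp2 l' = sp2 l' *m sc Ris *m sp1 m.
Hypothesis rel_lm : sp2 m' *m sc Ri' *m sp1 l = sp1 l *m sc Ris' *m sp2 m'.
Hypothesis cross : forall i k e b',
  \sum_d \sum_b ent K d k i b * ent Ri e b d b' = (k == b')%:R * (e == i)%:R.
Hypothesis cross' : forall i k e b',
  \sum_d \sum_b ent (flip K') d k i b * ent (flip Ri') e b d b' =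
  (k == b')%:R * (e == i)%:R.
Hypothesis KE : K *m D1 = F *: (D1 *m R0).
Hypothesis K'E : D1 *m K' = F' *: (invmx R0 *m D1).
Hypothesis RisE : a1 *m Ris = f *: (invmx Rs *m a1).
Hypothesis Ris'E : Ris' *m a1 = f' *: (a1 *m Rs).

Let Z := \tr (sc (tensmx D D) *m sp2 l' *m sp1 l *m sc (tensmx a a) *m sp1 m *m sp2 m').

Let scalZ_mid k (c : C) (M : 'M[C]_k) (X Y : 'M[A]_k) :
  \tr (X *m sc (c *: M) *m Y) = c *: \tr (X *m sc M *m Y).
Proof.
have -> : X *m sc (c *: M) = (c%:A)%:M *m (X *m sc M).
  apply/matrixP => i j; rewrite mul_scalar_mx !mxE mulr_algl scaler_sumr.
  by apply: eq_bigr => b _; rewrite !mxE !mulr_algr scalerA.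
rewrite -(mulmxA _%:M) /mxtrace scaler_sumr; apply: eq_bigr => i _.
by rewrite mul_scalar_mx [LHS]mxE mulr_algl.
Qed.

(** [KE] moves [K] past [D1] and leaves [R0] before [l_1 l'_2]; the relation [rel_ll] turns it into
    [Rs] behind them. There it meets the inverse of [Rs] that [RisE] leaves, and both disappear. *)
Lemma mxtrace_product :
  \tr (sc D *m l *m sc a *m m) * \tr (sc D *m l' *m sc a *m m') = (F * f) *: Z.
Proof.
rewrite (mxtrace_exchange rel_ml cross) !sp1M !sp1_scal.
have eK : tensmx 1%:M D *m K *m D1 = F *: (tensmx D D *m R0).
  apply: etrans (esym (mulmxA _ _ _)) _.
  apply: etrans (congr1 (mulmx (tensmx 1%:M D)) KE) _.
  apply: etrans (esym (scalemxAr _ _ _)) (congr1 ( *:%R F) _).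
  exact: etrans (mulmxA _ _ _) (congr1 (mulmx^~ _) (sc_tens21 D)).
have eR : a1 *m (Ris *m tensmx 1%:M a) = f *: (invmx Rs *m tensmx a a).
  apply: etrans (mulmxA _ _ _) _; apply: etrans (congr1 (mulmx^~ _) RisE) _.
  apply: etrans (esym (scalemxAl _ _ _)) (congr1 ( *:%R f) _).
  exact: etrans (esym (mulmxA _ _ _)) (congr1 (mulmx _) (sc_tens12 a)).
transitivity (\tr (sc (tensmx 1%:M D *m K *m D1) *m sp1 l *m sp2 l' *m
    sc (a1 *m (Ris *m tensmx 1%:M a)) *m sp1 m *m sp2 m')).
  congr (\tr _); rewrite !scalM !mulmxA; do 4! congr (_ *m _).
  by rewrite -!mulmxA sp21_scalC.
rewrite eK eR -(mulmxA _ (sp1 m)) scalZ_mid -[X in \tr (X *m _ *m _ *m _ *m _)]mul1mx.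
rewrite -!(mulmxA (_ *m sc (F *: _))) scalZ_mid scalerA (mulrC f).
congr (_ *: \tr _); rewrite mul1mx !mulmxA.
rewrite !scalM !mulmxA.
rewrite -(mulmxA (sc (tensmx D D)) (sc R0)) -(mulmxA _ (_ *m _) (sp2 l')) rel_ll !mulmxA.
by rewrite -(mulmxA _ (sc Rs)) -scalM mulmxV // scal1 mulmx1.
Qed.

(** The exchange is applied with the spaces swapped and then flipped back, which yields the inverse
    of [R0] on the left and [Rs] before [m'_2 m_1]. *)
Lemma mxtrace_product_flip :
  \tr (sc D *m l' *m sc a *m m') * \tr (sc D *m l *m sc a *m m) = (F' * f') *: Z.
Proof.
have rel : sp1 m' *m sc (flip Ri') *m sp2 l = sp2 l *m sc (flip Ris') *m sp1 m'.
  by have := congr1 (@flip _ _) rel_lm; rewrite !flip_mul !flip_scal !flip_sp1 !flip_sp2.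
rewrite (mxtrace_exchange rel cross') -mxtrace_flip !flip_mul !flip_scal.
rewrite !flip_mul !flip_tens !flip_flip !flip_sp1 !flip_sp2 !sp2M !sp2_scal.
have eK : D1 *m K' *m tensmx 1%:M D = F' *: (invmx R0 *m tensmx D D).
  apply: etrans (congr1 (mulmx^~ _) K'E) _.
  apply: etrans (esym (scalemxAl _ _ _)) (congr1 ( *:%R F') _).
  exact: etrans (esym (mulmxA _ _ _)) (congr1 (mulmx _) (sc_tens12 D)).
have eR : tensmx 1%:M a *m (Ris' *m a1) = f' *: (tensmx a a *m Rs).
  apply: etrans (congr1 (mulmx _) Ris'E) _.
  apply: etrans (esym (scalemxAr _ _ _)) (congr1 ( *:%R f') _).
  exact: etrans (mulmxA _ _ _) (congr1 (mulmx^~ _) (sc_tens21 a)).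
transitivity (\tr (sc (D1 *m K' *m tensmx 1%:M D) *m sp2 l' *m sp1 l *m
    sc (tensmx 1%:M a *m (Ris' *m a1)) *m sp2 m' *m sp1 m)).
  congr (\tr _); rewrite !scalM !mulmxA; do 4! congr (_ *m _).
  by rewrite -!mulmxA sp12_scalC.
rewrite eK eR -(mulmxA _ (sp2 m')) scalZ_mid -[X in \tr (X *m _ *m _ *m _ *m _)]mul1mx.
rewrite -!(mulmxA (_ *m sc (F' *: _))) scalZ_mid scalerA (mulrC f').
congr (_ *: _); rewrite mul1mx !mulmxA.
(* The inverse of [R0] is carried around the trace to the far right; [rel_mm] turns [Rs] into an
   [R0] that arrives there too. *)
rewrite scalM -!mulmxA mxtrace_scalC.
congr (\tr _); rewrite scalM !mulmxA.
rewrite -(mulmxA _ (sc Rs)) -(mulmxA _ (_ *m sp2 m') (sp1 m)) -rel_mm !mulmxA.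
by rewrite -(mulmxA _ (sc R0)) -scalM mulmxV // scal1 mulmx1.
Qed.

End TraceRatio.

(** * Iterated quasi-periodicity *)

Section Intertwine.
Variables (F : fieldType) (m : nat).
Implicit Types X Y B M : 'M[F]_m.

Lemma intertwine_inv c X Y B M : X *m Y = 1%:M -> Y *m X = 1%:M ->
  X *m M = c *: (B *m X) -> M *m Y = c *: (Y *m B).
Proof.
move=> XY YX e; transitivity (Y *m (X *m M) *m Y); first by rewrite mulmxA YX mul1mx.
by rewrite e -scalemxAr -scalemxAl mulmxA -(mulmxA _ X Y) XY mulmx1.
Qed.

Lemma intertwine_invmx c X B M : M \in unitmx -> B \in unitmx ->
  M *m X = c *: (X *m B) -> X *m invmx B = c *: (invmx M *m X).
Proof.
move=> uM uB e; transitivity (invmx M *m (M *m X) *m invmx B).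
  by rewrite mulmxA mulVmx // mul1mx.
by rewrite e -scalemxAr -scalemxAl mulmxA -(mulmxA _ B) mulmxV // mulmx1.
Qed.

Lemma intertwine_sym c X Y : c != 0 -> X = c *: Y -> Y = c^-1 *: X.
Proof. by move=> c0 ->; rewrite scalerK. Qed.

Lemma tensmxX (a : nat) (M : 'M[F]_a) k :
  tensmx (M ^+ k) (1%:M : 'M[F]_m) *m tensmx M 1%:M = tensmx (M ^+ k.+1) 1%:M.
Proof. by rewrite tensmx_mul mulmx1 exprSr. Qed.

Lemma expmx_invmx (M : 'M[F]_m) k : M \in unitmx -> M ^+ k *m invmx M ^+ k = 1%:M.
Proof.
move=> uM; elim: k => [|k IH]; first exact: mulmx1.
rewrite exprSr exprS; change ((M ^+ k *m M) *m (invmx M *m invmx M ^+ k) = 1%:M).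
by rewrite -mulmxA (mulmxA M) mulmxV // mul1mx.
Qed.

Lemma prod_pow_rev (f : F -> F) (x u : F) k : x != 0 ->
  \prod_(j < k) f (x ^+ j * (x ^- k * u)) = \prod_(j < k) f (x ^- j.+1 * u).
Proof.
move=> x0; rewrite (reindex_inj rev_ord_inj); apply: eq_bigr => j _ /=.
rewrite mulrA; congr (f (_ * _)).
have -> : x ^+ k = x ^+ (k - j.+1) * x ^+ j.+1 by rewrite -exprD subnK.
by rewrite invfM mulVKf // expf_neq0.
Qed.

End Intertwine.

Section RhatIterate.
Context {R : realType}.
Local Notation C := R[i].
Variable n : nat.
Local Notation N := n.+2.
Variables (gh : 'M[C]_N).
Hypothesis gh_diag : is_diag_mx gh.
Hypothesis gh_sqr : gh *m gh = gmx N.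
Variables (zeta tau : C).
Local Notation q := (epi zeta).
Local Notation p := (epi (2 * tau)).
Local Notation Q := (q ^+ (2 * N)).
Hypothesis p1 : `|p| < 1.
Hypothesis q1 : `|q| < 1.
Hypothesis hz : off_lattice tau zeta.
Local Notation Rh := (Rhat gh zeta tau).
Local Notation am := (amx gh).
Local Notation tens1 M := (tensmx M (1%:M : 'M[C]_N)).
Local Notation f := (@qfactor R n zeta).
Local Notation generic := (@generic R zeta tau).

Let q0 : q != 0. Proof. exact: epi_neq0. Qed.
Let p0 : p != 0. Proof. exact: epi_neq0. Qed.
Let Q0 : Q != 0. Proof. by rewrite expf_neq0. Qed.
Let Q1 : `|Q| < 1. Proof. exact: Q_lt1. Qed.
Let am_unit : am \in unitmx. Proof. exact: (amx_unit gh_diag gh_sqr). Qed.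

Lemma epi_sqr_shift xi (k : int) :
  epi (xi + k%:~R * (tau + 1)) ^+ 2 = p ^ k * epi xi ^+ 2.
Proof.
rewrite -!epi_sqr -epiXz -epiD; apply: (@epi_mod2 _ k).
by ring.
Qed.

Lemma generic_tau xi (k : int) : generic xi -> generic (xi + k%:~R * (tau + 1)).
Proof.
move=> g; suff: avoids q p (epi (xi + k%:~R * (tau + 1)) ^+ 2) by [].
rewrite epi_sqr_shift; by have := avoids_mul q0 p0 0 k g; rewrite expr0z mul1r.
Qed.

Lemma qfactor_neq0 u : avoids q p u -> f u != 0.
Proof.
move=> g; have h := avoids_shift q0 p0 2 0 g; rewrite expr0 mulr1 in h.
have h' := avoids_shift q0 p0 2 0 (avoidsV g); rewrite expr0 mulr1 in h'.
have T1 := avoids_Theta_Q q0 Q1 h; have T2 := avoids_Theta_Q q0 Q1 h'.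
have T3 := avoids_Theta_Q q0 Q1 g; have T4 := avoids_Theta_Q q0 Q1 (avoidsV g).
rewrite /qfactor; apply: mulf_neq0; first exact: epi_neq0.
apply: mulf_neq0; first exact: (mulf_neq0 T4 T3).
by rewrite invr_eq0; exact: (mulf_neq0 T1 T2).
Qed.

Lemma qfactorV (u : C) : f u^-1 = f u.
Proof.
rewrite /qfactor invrK.
exact: (congr2 (fun x y => _ * (x / y)) (mulrC _ _) (mulrC _ _)).
Qed.

(** The monomials produced by [Theta_shift] cancel between numerator and denominator. This discards
    the crossing shift [q^N] inside the scalars. *)
Lemma qfactor_shift u : avoids q p u -> f (Q * u) = f u.
Proof.
move=> g; have u0 := avoids_neq0 g.
have h := avoids_shift q0 p0 2 0 g; rewrite expr0 mulr1 in h.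
have h' := avoids_shift q0 p0 2 0 (avoidsV g); rewrite expr0 mulr1 in h'.
have T1 := avoids_Theta_Q q0 Q1 h; have T2 := avoids_Theta_Q q0 Q1 h'.
have e1 := Theta_shift Q1 Q0 u0.
have e2 := Theta_shift Q1 Q0 (avoids_neq0 h).
have v0 : (Q * u)^-1 != 0 by rewrite invr_eq0 mulf_neq0.
have e3 := Theta_shift Q1 Q0 v0.
have w0 : q ^+ 2 * (Q * u)^-1 != 0 by rewrite mulf_neq0 ?expf_neq0.
have e4 := Theta_shift Q1 Q0 w0.
rewrite (_ : Q * (Q * u)^-1 = u^-1) in e3; last by rewrite invfM mulVKf.
rewrite (_ : Q * (q ^+ 2 * (Q * u)^-1) = q ^+ 2 * u^-1) in e4; last first.
  by rewrite mulrCA invfM mulVKf.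
rewrite /qfactor (_ : q ^+ 2 * (Q * u) = Q * (q ^+ 2 * u)); last by rewrite mulrCA.
rewrite e1 e2 e3; rewrite e4 in T2 *.
move: T1 T2; move: (Theta _ _) (Theta _ _) (Theta _ _) (Theta _ _) => A B D E.
move=> E0; rewrite mulf_eq0 => /norP[_ D0]; congr (_ * _).
by move: u0 q0 Q0; move: q Q => x y u0 x0 y0; field; rewrite ?E0 ?D0 ?u0 ?x0 ?y0.
Qed.

Lemma tensmx11 : tens1 (1%:M : 'M[C]_N) = 1%:M.
Proof. by apply: ent_eq => i k j l; rewrite ent_tens ent_id !mxE -natrM mulnb. Qed.

Lemma Rhat_iter xi k : generic xi ->
  tens1 (am ^+ k) *m Rh (xi + k%:R * (tau + 1)) =
  (\prod_(j < k) f (p ^+ j * epi xi ^+ 2)) *: (Rh xi *m tens1 (am ^+ k)).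
Proof.
move=> g; elim: k => [|k IH].
  by rewrite big_ord0 scale1r mul0r addr0 expr0 tensmx11 mul1mx mulmx1.
have gk : generic (xi + k%:R * (tau + 1)) by have := generic_tau k%:Z g.
have e : xi + k.+1%:R * (tau + 1) = xi + k%:R * (tau + 1) + tau + 1.
  by rewrite -natr1; ring.
have := Rhat_quasi gh_diag gh_sqr p1 q1 gk.
rewrite -e (epi_sqr_shift xi k%:Z) -exprnP => h.
have aS := tensmxX n.+2 am k.
apply: etrans (congr1 (mulmx^~ _) (esym aS)) _.
apply: etrans (esym (mulmxA _ _ _)) _; apply: etrans (congr1 (mulmx _) h) _.
apply: etrans (esym (scalemxAr _ _ _)) _.
apply: etrans (congr1 _ (mulmxA _ _ _)) _.
apply: etrans (congr1 (fun M => _ *: (M *m _)) IH) _.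
apply: etrans (congr1 _ (esym (scalemxAl _ _ _))) _.
rewrite scalerA big_ord_recr /= mulrC; congr (_ *: _).
exact: etrans (esym (mulmxA _ _ _)) (congr1 (mulmx _) aS).
Qed.

Let tens1V k : tens1 (am ^+ k) *m tens1 (invmx am ^+ k) = 1%:M.
Proof. by rewrite tensmx_mul mulmx1 (expmx_invmx k am_unit) tensmx11. Qed.

Let tens1Vl k : tens1 (invmx am ^+ k) *m tens1 (am ^+ k) = 1%:M.
Proof. by rewrite tensmx_mul mulmx1 (mulmx1C (expmx_invmx k am_unit)) tensmx11. Qed.

(** The power [a^(-r-1)]: the extra inverse of [a] is brought to the front of the trace from the
    conjugation inside [L^-]. *)
Definition twist (r : int) : 'M[C]_N := invmx am *m mxpowz am (- r).

Lemma twist_pos k : twist (Posz k) = invmx am ^+ k.+1.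
Proof.
rewrite /twist; case: k => [|k]; first by rewrite oppr0 /= expr0 expr1 mulmx1.
by rewrite -NegzE /= [in RHS]exprS.
Qed.

(** [Negz k] stands for [-(k + 1)], so the exponent [-r - 1] is [k]. *)
Lemma twist_neg k : twist (Negz k) = am ^+ k.
Proof. by rewrite /twist NegzE opprK /= exprS mulKmx. Qed.

(* Factors produced by moving [xi] by [r + 1] and [- (r + 1)] steps of the
   quasi-period [tau + 1]. *)
Definition fup (r : int) (u : C) : C :=
  match r with
  | Posz k => \prod_(j < k.+1) f (p ^+ j * u)
  | Negz k => (\prod_(j < k) f (p ^- j.+1 * u))^-1
  end.

Definition fdown (r : int) (u : C) : C :=
  match r with
  | Posz k => \prod_(j < k.+1) f (p ^- j.+1 * u)
  | Negz k => (\prod_(j < k) f (p ^+ j * u))^-1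
  end.

Lemma Rhat_iter_down xi k : generic xi ->
  tens1 (am ^+ k) *m Rh xi =
  (\prod_(j < k) f (p ^- j.+1 * epi xi ^+ 2)) *:
     (Rh (xi - k%:R * (tau + 1)) *m tens1 (am ^+ k)).
Proof.
move=> g; have e : xi - k%:R * (tau + 1) = xi + (- k%:Z)%:~R * (tau + 1).
  by rewrite mulrNz -pmulrn mulNr.
have g' : generic (xi - k%:R * (tau + 1)) by rewrite e; exact: (generic_tau (- k%:Z) g).
have e0 := subrK (k%:R * (tau + 1)) xi.
apply: etrans (congr1 (fun y => _ *m Rh y) (esym e0)) _.
apply: etrans (Rhat_iter k g') (congr1 ( *:%R^~ _) _).
have -> : epi (xi - k%:R * (tau + 1)) ^+ 2 = p ^- k * epi xi ^+ 2.
  apply: etrans (congr1 (fun y => epi y ^+ 2) e) _.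
  exact: etrans (epi_sqr_shift _ _) (congr1 ( *%R^~ _) (esym (exprnN _ _))).
exact: prod_pow_rev p0.
Qed.

Lemma prod_up_neq0 xi k : generic xi ->
  \prod_(j < k) f (p ^+ j * epi xi ^+ 2) != 0.
Proof.
move=> g; rewrite prodf_seq_neq0; apply/allP => j _ /=; apply: qfactor_neq0.
by have := avoids_shift q0 p0 0 j g; rewrite expr0 mul1r.
Qed.

Lemma prod_down_neq0 xi k : generic xi ->
  \prod_(j < k) f (p ^- j.+1 * epi xi ^+ 2) != 0.
Proof.
move=> g; rewrite prodf_seq_neq0; apply/allP => j _ /=; apply: qfactor_neq0.
by have := avoids_mul q0 p0 0 (- j.+1%:Z) g; rewrite expr0z mul1r.
Qed.

(** For [r >= 0] the twist is an inverse power of [a], and [Rhat_iter] is multiplied by it on both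
    sides; for [r < 0] the shift is downwards by [k] steps and [Rhat_iter_down] is solved for the
    shifted matrix. *)
Lemma Rhat_twist_up (r : int) xi : generic xi ->
  Rh (xi + (r + 1)%:~R * (tau + 1)) *m tens1 (twist r) =
  fup r (epi xi ^+ 2) *: (tens1 (twist r) *m Rh xi).
Proof.
move=> g; case: r => k.
  rewrite twist_pos; have -> : (Posz k + 1)%:~R = k.+1%:R :> C by rewrite addrC -intS.
  exact: (intertwine_inv (tens1V _) (tens1Vl _) (Rhat_iter k.+1 g)).
rewrite twist_neg; have -> : (Negz k + 1)%:~R = - k%:R :> C.
  by rewrite NegzE intS opprD addrAC addNr sub0r mulrNz.
rewrite mulNr; exact: (intertwine_sym (prod_down_neq0 k g) (Rhat_iter_down k g)).
Qed.

Lemma Rhat_twist_down (r : int) xi : generic xi ->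
  tens1 (twist r) *m invmx (Rh (xi - (r + 1)%:~R * (tau + 1))) =
  fdown r (epi xi ^+ 2) *: (invmx (Rh xi) *m tens1 (twist r)).
Proof.
move=> g; have g' : generic (xi - (r + 1)%:~R * (tau + 1)).
  have -> : xi - (r + 1)%:~R * (tau + 1) = xi + (- (r + 1))%:~R * (tau + 1).
    by rewrite mulrNz mulNr.
  exact: (generic_tau (- (r + 1)) g).
have u := Rhat_unit gh_diag gh_sqr p1 q1 hz g.
have u' := Rhat_unit gh_diag gh_sqr p1 q1 hz g'.
case: r g' u' => k.
  have -> : (Posz k + 1)%:~R = k.+1%:R :> C by rewrite addrC -intS.
  rewrite twist_pos => g' u'.
  apply: (intertwine_invmx u u').
  exact: (intertwine_inv (tens1V _) (tens1Vl _) (Rhat_iter_down k.+1 g)).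
have -> : (Negz k + 1)%:~R = - k%:R :> C.
  by rewrite NegzE intS opprD addrAC addNr sub0r mulrNz.
rewrite mulNr opprK twist_neg => g' u'.
have e := intertwine_sym (prod_up_neq0 k g) (Rhat_iter k g).
exact: (intertwine_invmx u u' e).
Qed.

End RhatIterate.

(** * The structure function *)

Section ShiftRatio.
Variables (F : fieldType) (f : F -> F) (x u : F).
Hypothesis f_up : forall k, f (x ^+ k * u) != 0.
Hypothesis f_down : forall k, f (x ^- k * u) != 0.

Let f0 : f u != 0. Proof. by have := f_up 0; rewrite expr0 mul1r. Qed.

(** On the left [f u] removes the index 0, on the right the last factor removes the index [k + 1];
    what survives has indices 1 to [k]. This is the range of the product in [YN] for [r > 0]. *)
Lemma shift_ratio_pos k : (\prod_(j < k.+1) f (x ^+ j * u)) / f u =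
  \prod_(j < k) (f (x ^+ j.+1 * u) / f (x ^- j.+1 * u)) *
  ((\prod_(j < k.+1) f (x ^- j.+1 * u)) / f (x ^- k.+1 * u)).
Proof.
rewrite big_ord_recl expr0 mul1r mulrAC mulfV // mul1r.
rewrite [in RHS]big_ord_recr /= mulfK // -big_split; apply: eq_bigr => j _.
by rewrite /= divfK.
Qed.

(** Here the products are inverted, so the extra factors add indices instead of removing them: 0 on
    the left, [k] on the right. Hence the range from 0 to [k = |r| - 1] for [r < 0]. *)
Lemma shift_ratio_neg k : (\prod_(j < k) f (x ^- j.+1 * u))^-1 / f u =
  \prod_(j < k.+1) (f (x ^+ j * u) / f (x ^- j * u)) *
  ((\prod_(j < k) f (x ^+ j * u))^-1 / f (x ^+ k * u)).
Proof.
rewrite big_split /= big_ord_recr /= prodfV big_ord_recl expr0 invr1 mul1r.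
rewrite (eq_bigr (fun j : 'I_k => f (x ^- j.+1 * u))) //.
have P0 : \prod_(j < k) f (x ^+ j * u) != 0.
  by rewrite prodf_seq_neq0; apply/allP => j _ /=.
have P0' : \prod_(j < k) f (x ^- j.+1 * u) != 0.
  by rewrite prodf_seq_neq0; apply/allP => j _ /=.
by field; rewrite P0 P0' f0 f_up.
Qed.

End ShiftRatio.

Section YFactor.
Context {R : realType}.
Local Notation C := R[i].
Variable n : nat.
Local Notation N := n.+2.
Variables (zeta tau : C).
Local Notation q := (epi zeta).
Local Notation p := (epi (2 * tau)).
Local Notation Q := (q ^+ (2 * N)).
Hypothesis p1 : `|p| < 1.
Hypothesis q1 : `|q| < 1.
Local Notation f := (@qfactor R n zeta).
Local Notation T := (Theta Q).

Let q0 : q != 0. Proof. exact: epi_neq0. Qed.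
Let p0 : p != 0. Proof. exact: epi_neq0. Qed.
Let Q0 : Q != 0. Proof. by rewrite expf_neq0. Qed.
Let Q1 : `|Q| < 1. Proof. exact: Q_lt1. Qed.

Lemma qfactorE (u : C) : avoids q p u ->
  f u = epi (zeta * (2 - 2 / N%:R)) * q ^- 2 * (T u ^+ 2 / (T (u * q ^+ 2) * T (u * q ^- 2))).
Proof.
move=> g; have u0 := avoids_neq0 g.
have h := avoids_mul q0 p0 (- 2%:Z) 0 g.
rewrite expr0z mulr1 -exprnN (mulrC _ u) in h.
have T1 := avoids_Theta_Q q0 Q1 h.
have h' := avoids_mul q0 p0 2%:Z 0 g.
rewrite expr0z mulr1 -exprnP (mulrC _ u) in h'.
have T2 := avoids_Theta_Q q0 Q1 h'.
have e1 := Theta_inv Q1 u0.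
have e2 := Theta_inv Q1 (avoids_neq0 h).
have e3 : (u * q ^- 2)^-1 = q ^+ 2 * u^-1 by rewrite [LHS]invfM invrK mulrC.
rewrite e3 in e2; rewrite /qfactor e1 e2 (mulrC (q ^+ 2) u).
move: T1 T2; move: (Theta _ _) (Theta _ _) (Theta _ _) => A B D.
move: (epi (zeta * _)) => e T1 T2.
by move: u0 q0; move: q => x u0 x0; field; rewrite ?T1 ?T2 ?u0 ?x0.
Qed.

(** [Yfactor] is written in [x = w/z], whereas the scalars are values of [f] near [(z/w)^2].
    Invariance of [f] under inversion changes [p^k] into [p^(-k)], and the constant in [qfactorE]
    drops out of the ratio. *)
Lemma Yfactor_qfactor (x : C) k : avoids q p (x ^+ 2) ->
  f (p ^+ k * x ^- 2) / f (p ^- k * x ^- 2) = Yfactor zeta tau N k x.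
Proof.
move=> g.
have e1 : p ^+ k * x ^- 2 = (x ^+ 2 * p ^- k)^-1 by rewrite [RHS]invfM invrK mulrC.
have e2 : p ^- k * x ^- 2 = (x ^+ 2 * p ^+ k)^-1 by rewrite [RHS]invfM mulrC.
have g1 := avoids_mul q0 p0 0 (- k%:Z) g.
have g2 := avoids_mul q0 p0 0 k%:Z g.
rewrite expr0z mul1r (mulrC _ (x ^+ 2)) -exprnN in g1.
rewrite expr0z mul1r (mulrC _ (x ^+ 2)) -exprnP in g2.
rewrite e1 e2 !qfactorV (qfactorE g1) (qfactorE g2) /Yfactor.
have c0 : epi (zeta * (2 - 2 / N%:R)) * q ^- 2 != 0.
  by rewrite mulf_neq0 ?epi_neq0 // invr_eq0 expf_neq0.
have side u : avoids q p u -> (T u != 0) * (T (u * q ^+ 2) != 0) * (T (u * q ^- 2) != 0).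
  move=> h; have h1 := avoids_mul q0 p0 (- 2%:Z) 0 h.
  rewrite expr0z mulr1 -exprnN (mulrC _ u) in h1.
  have h2 := avoids_mul q0 p0 2%:Z 0 h; rewrite expr0z mulr1 -exprnP (mulrC _ u) in h2.
  split; last exact: (avoids_Theta_Q q0 Q1 h1).
  by split; [exact: (avoids_Theta_Q q0 Q1 h) | exact: (avoids_Theta_Q q0 Q1 h2)].
have [[s1 s2] s3] := side _ g1; have [[s4 s5] s6] := side _ g2.
rewrite (mulrAC (x ^+ 2) (q ^+ 2) (p ^+ k)) (mulrAC (x ^+ 2) (q ^- 2) (p ^+ k)).
rewrite (mulrAC (x ^+ 2) (q ^+ 2) (p ^- k)) (mulrAC (x ^+ 2) (q ^- 2) (p ^- k)).
move: c0 s1 s2 s3 s4 s5 s6; move: (epi _ * _).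
move: (T (x ^+ 2 * p ^- k)) (T (x ^+ 2 * p ^+ k)).
move: (T (x ^+ 2 * p ^- k * q ^+ 2)) (T (x ^+ 2 * p ^- k * q ^- 2)).
move: (T (x ^+ 2 * p ^+ k * q ^+ 2)) (T (x ^+ 2 * p ^+ k * q ^- 2)).
move=> A1 A2 A3 A4 A5 A6 e e0 s1 s2 s3 s4 s5 s6.
by field; rewrite ?s1 ?s2 ?s3 ?s4 ?s5 ?s6 ?e0.
Qed.

Lemma YN_ratio (r : int) (x : C) : avoids q p (x ^+ 2) -> let u := x ^- 2 in
  fup n zeta tau r u / f u =
  YN zeta tau N r x * (fdown n zeta tau r u / f (p ^ (- (r + 1)) * u)).
Proof.
move=> g u; have gu : avoids q p u by apply: avoidsV.
have fp k : f (p ^+ k * u) != 0.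
  have h := avoids_shift q0 p0 0 k gu; rewrite expr0 mul1r in h.
  exact: (qfactor_neq0 n q1 h).
have fm k : f (p ^- k * u) != 0.
  have h := avoids_mul q0 p0 0 (- k%:Z) gu; rewrite expr0z mul1r -exprnN in h.
  exact: (qfactor_neq0 n q1 h).
rewrite /YN; case: r => k /=.
  have -> : (if 0 < Posz k then \prod_(1 <= j < k.+1) Yfactor zeta tau N j x
      else \prod_(0 <= j < k) Yfactor zeta tau N j x) =
    \prod_(j < k) (f (p ^+ j.+1 * u) / f (p ^- j.+1 * u)).
    (* At [r = 0] the second branch of [YN] is taken; both products are then empty. *)
    case: ltP => [_|k0]; last first.
      by case: k k0 => // _; rewrite big_geq // big_ord0.
    by rewrite big_add1 big_mkord; apply: eq_bigr => j _; rewrite Yfactor_qfactor.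
  have -> : p ^ (- (Posz k + 1)) = p ^- k.+1 by rewrite addrC -intS -exprnN.
  exact: (shift_ratio_pos fp fm).
have -> : \prod_(0 <= j < k.+1) Yfactor zeta tau N j x =
    \prod_(j < k.+1) (f (p ^+ j * u) / f (p ^- j * u)).
  by rewrite big_mkord; apply: eq_bigr => j _; rewrite Yfactor_qfactor.
have -> : - (Negz k + 1) = k%:Z by rewrite NegzE; lia.
exact: (shift_ratio_neg fp fm).
Qed.

End YFactor.

Section InverseRelations.
Variables (A : pzRingType) (k : nat) (X X' Y Y' P P' S S' : 'M[A]_k).
Hypothesis XX' : X *m X' = 1%:M.
Hypothesis X'X : X' *m X = 1%:M.

Lemma exchange_inv_both : Y *m Y' = 1%:M -> Y' *m Y = 1%:M ->
  P *m X *m Y = Y *m X *m S -> X' *m Y' *m P = S *m Y' *m X'.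
Proof.
move=> YY' Y'Y e.
transitivity (X' *m (Y' *m (P *m X *m Y) *m Y') *m X').
  by rewrite -!mulmxA (mulmxA Y) YY' mul1mx XX' mulmx1.
by rewrite e !mulmxA -(mulmxA X') Y'Y mulmx1 X'X mul1mx.
Qed.

Lemma exchange_inv_left : P' *m P = 1%:M -> S *m S' = 1%:M ->
  P *m X *m Y = Y *m X *m S -> X' *m P' *m Y = Y *m S' *m X'.
Proof.
move=> P'P SS' e.
have e' : X *m Y *m S' = P' *m Y *m X.
  transitivity (P' *m (P *m X *m Y) *m S').
    by rewrite !mulmxA P'P mul1mx.
  by rewrite e -!mulmxA SS' mulmx1.
transitivity (X' *m (P' *m Y *m X) *m X').
  by rewrite -!mulmxA XX' mulmx1.
by rewrite -e' !mulmxA X'X mul1mx.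
Qed.

Lemma exchange_inv_right : P *m Y *m X = X *m Y *m S -> X' *m P *m Y = Y *m S *m X'.
Proof.
move=> e; transitivity (X' *m (P *m Y *m X) *m X').
  by rewrite -!mulmxA XX' mulmx1.
by rewrite e !mulmxA X'X mul1mx.
Qed.

End InverseRelations.

Section ScalInverse.
Context {R : realType} (A : algType R[i]).

Lemma scal_mulVmx k (M : 'M[R[i]]_k) : M \in unitmx ->
  scal (A := A) (invmx M) *m scal M = 1%:M.
Proof. by move=> uM; rewrite -scalM mulVmx // scal1. Qed.

Lemma scal_mulmxV k (M : 'M[R[i]]_k) : M \in unitmx ->
  scal (A := A) M *m scal (invmx M) = 1%:M.
Proof. by move=> uM; rewrite -scalM mulmxV // scal1. Qed.

End ScalInverse.

(** * The exchange relation on the surface *)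

Section Surface.
Context {R : realType} {A : algType R[i]}.
Local Notation C := R[i].
Variable n : nat.
Local Notation N := n.+2.
Local Notation sc := (@scal R A _ _).
Variables (zeta tau c : C).
Hypothesis hpar : admissible zeta tau c.
Variables (gh : 'M[C]_N).
Hypothesis gh_diag : is_diag_mx gh.
Hypothesis gh_sqr : gh *m gh = gmx N.
Variable r : int.
Hypothesis hsurf : on_surface N r zeta tau c.
Local Notation ts := (taustar zeta tau c).
Local Notation q := (epi zeta).
Local Notation p := (epi (2 * tau)).
Local Notation ps := (epi (2 * ts)).
Local Notation Q := (q ^+ (2 * N)).
Local Notation am := (amx gh).
Local Notation f := (@qfactor R n zeta).

Let q1 : `|q| < 1. Proof. by case: hpar. Qed.
Let p1 : `|p| < 1. Proof. by case: hpar. Qed.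
Let ps1 : `|ps| < 1. Proof. by case: hpar. Qed.
Let hz : off_lattice tau zeta.
Proof. by case: hpar => _ _ _ h _ k; rewrite epi_sqr; apply/eqP. Qed.
Let hzs : off_lattice ts zeta.
Proof. by case: hpar => _ _ _ _ h k; rewrite epi_sqr; apply/eqP. Qed.
Let am_unit : am \in unitmx. Proof. exact: (amx_unit gh_diag gh_sqr). Qed.

Lemma generic_ratio_tau x : generic_ratio zeta tau c x -> generic zeta tau x.
Proof.
move=> h; split; first by rewrite expf_neq0 // epi_neq0.
by move=> i j; apply/eqP; have := h i j 0; rewrite expr0z mulr1.
Qed.

Lemma generic_ratio_taustar x : generic_ratio zeta tau c x -> generic zeta ts x.
Proof.
move=> h; split; first by rewrite expf_neq0 // epi_neq0.
by move=> i j; apply/eqP; have := h i 0 j; rewrite expr0z mulr1.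
Qed.

Lemma generic_ratio_shift x (k : int) :
  generic_ratio zeta tau c x -> generic_ratio zeta tau c (x + k%:~R * (ts + 1)).
Proof.
move=> h i j l; rewrite epi_sqr_shift => e; apply: (h i j (l - k)).
have s0 : ps != 0 by apply: epi_neq0.
apply: (mulfI (expfz_neq0 k s0)); rewrite e mulrCA; congr (_ * _).
by rewrite -expfzDr // addrC subrK.
Qed.

(** The logarithm of [(-p^(1/2))^r q^(c+N)]. The two equations of the surface are exactly the two
    conditions of [Rhat_periodic] for it. *)
Let delta : C := r%:~R * (tau + 1) + zeta * c + N%:R * zeta.

Let deltaE : delta = (tau + 1) * r%:~R - zeta * (- c - N%:R).
Proof. by rewrite /delta; ring. Qed.

Let epi_delta : epi delta = 1.
Proof. by rewrite deltaE epiB (hsurf.1) mulfV ?epi_neq0. Qed.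

Let epi_delta_root : epi (delta * (2 / N%:R)) = 1.
Proof. by rewrite deltaE mulrBl epiB (hsurf.2) mulfV ?epi_neq0. Qed.

Variables (L Lminv : C -> 'M[A]_N).
Hypothesis hL : Aqp_gl gh zeta tau c L.
Hypothesis hinv : Lminus_inverse gh tau L Lminv.

Let l xi := L (xi + zeta * c).
Let m xi := sc (invmx am) *m Lminv xi *m sc am.

Let mL xi : m xi *m L (xi + tau + 1) = 1%:M.
Proof.
have [_ e] := hinv xi; rewrite /Lminus in e.
transitivity (sc (invmx am) *m (Lminv xi *m (sc am *m L (xi + tau + 1) *m sc (invmx am))) *m sc am).
  by rewrite -!mulmxA -scalM mulVmx // scal1 mulmx1.
by rewrite e mulmx1 -scalM mulVmx // scal1.
Qed.

Let Lm xi : L (xi + tau + 1) *m m xi = 1%:M.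
Proof.
have [e _] := hinv xi; rewrite /Lminus in e.
transitivity (sc (invmx am) *m (sc am *m L (xi + tau + 1) *m sc (invmx am) *m Lminv xi) *m sc am).
  by rewrite !mulmxA -scalM mulVmx // scal1 mul1mx.
by rewrite e mulmx1 -scalM mulVmx // scal1.
Qed.

Let tgenE xi : tgen gh r zeta c L Lminv xi =
  \tr (sc (twist gh r) *m l xi *m sc am *m m xi).
Proof.
have -> : l xi = L (xi + zeta * c / 2 + zeta * c / 2).
  by rewrite /l -addrA -splitr.
rewrite /m /tgen /Lplus /twist scalM -!mulmxA [RHS]mxtrace_scalC -!mulmxA.
rewrite (mulmxA (sc am) (sc (invmx am))) -!(scalM am (invmx am)) mulmxV //.
by rewrite !scal1 mul1mx mulmx1.
Qed.

Lemma tgen_exchange (xi eta : C) : generic_ratio zeta tau c (xi - eta) ->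
  tgen gh r zeta c L Lminv xi * tgen gh r zeta c L Lminv eta =
  YN zeta tau N r (epi (eta - xi)) *:
    (tgen gh r zeta c L Lminv eta * tgen gh r zeta c L Lminv xi).
Proof.
move=> g; rewrite !tgenE.
set x := xi - eta in g.
have gt := generic_ratio_tau g; have gs := generic_ratio_taustar g.
(* The arguments of the mixed relations: [y] for the pair [L(-p^(1/2) z)], [L(q^c w)], and [y'] for
   [L(q^c z)], [L(-p^(1/2) w)]. The shift [tau - zeta c] is [ts], which makes both a single step
   away from [x] at the nome [p']. *)
pose y := x + ts + 1; pose y' := x - ts - 1.
have yE : y = x + (ts + 1) by rewrite /y; ring.
have y'E : y' = x - (ts + 1) by rewrite /y'; ring.
have gy : generic_ratio zeta tau c y.
  by have := @generic_ratio_shift x 1 g; rewrite mul1r -yE.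
have gy' : generic_ratio zeta tau c y'.
  by have := @generic_ratio_shift x (-1) g; rewrite mulN1r -y'E.
have gty := generic_ratio_tau gy; have gsy := generic_ratio_taustar gy.
have gty' := generic_ratio_tau gy'; have gsy' := generic_ratio_taustar gy'.
pose zu := x + (r + 1)%:~R * (tau + 1); pose zd := x - (r + 1)%:~R * (tau + 1).
(* The surface enters here: up to [delta], the crossing shift takes [y] down to [zu] and [y'] up to
   [zd], both at [r + 1] steps in [p] from [x]. *)
have yu : y = zu - delta + N%:R * zeta.
  by rewrite /zu /delta /y /taustar intrD; ring.
have yd : y' + N%:R * zeta = zd + delta.
  by rewrite /zd /delta /y' /taustar intrD; ring.
have gzu : generic zeta tau (zu - delta).
  have := generic_shift (- N%:Z) gty; rewrite yu mulrNz mulNr -pmulrn => h.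
  by rewrite addrK in h.
have Ru : Rhat gh zeta tau (zu - delta) = Rhat gh zeta tau zu.
  rewrite -[in RHS](subrK delta zu); symmetry.
  exact: (Rhat_periodic gh_diag gh_sqr zeta p1 _ epi_delta epi_delta_root).
have Rd : Rhat gh zeta tau (zd + delta) = Rhat gh zeta tau zd.
  exact: (Rhat_periodic gh_diag gh_sqr zeta p1 _ epi_delta epi_delta_root).
have cross_up i k e b' := Rhat_crossing gh_diag gh_sqr p1 q1 hz i k e b' gzu.
have cross_down i k e b' := Rhat_crossing gh_diag gh_sqr p1 q1 hz i k e b' gty'.
rewrite -yu Ru in cross_up; rewrite yd Rd in cross_down.
have rl : sc (Rhat gh zeta tau x) *m sp1 (l xi) *m sp2 (l eta) =
    sp2 (l eta) *m sp1 (l xi) *m sc (Rhat gh zeta ts x).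
  have := @hL (xi + zeta * c) (eta + zeta * c).
  by rewrite (_ : xi + zeta * c - (eta + zeta * c) = x); [apply | rewrite /x; ring].
have ML1 z : sp1 (L (z + tau + 1)) *m sp1 (m z) = 1%:M by rewrite -sp1M Lm sp1_1.
have mL1 z : sp1 (m z) *m sp1 (L (z + tau + 1)) = 1%:M by rewrite -sp1M mL sp1_1.
have ML2 z : sp2 (L (z + tau + 1)) *m sp2 (m z) = 1%:M by rewrite -sp2M Lm sp2_1.
have mL2 z : sp2 (m z) *m sp2 (L (z + tau + 1)) = 1%:M by rewrite -sp2M mL sp2_1.
have rm : sp1 (m xi) *m sp2 (m eta) *m sc (Rhat gh zeta tau x) =
    sc (Rhat gh zeta ts x) *m sp2 (m eta) *m sp1 (m xi).
  apply: (exchange_inv_both (ML1 xi) (mL1 xi) (ML2 eta) (mL2 eta)).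
  have := @hL (xi + tau + 1) (eta + tau + 1).
  by rewrite (_ : xi + tau + 1 - (eta + tau + 1) = x); [apply | rewrite /x; ring].
have uy := Rhat_unit gh_diag gh_sqr p1 q1 hz gty.
have usy := Rhat_unit gh_diag gh_sqr ps1 q1 hzs gsy.
have ux := Rhat_unit gh_diag gh_sqr p1 q1 hz gt.
have usx := Rhat_unit gh_diag gh_sqr ps1 q1 hzs gs.
have rml : sp1 (m xi) *m sc (invmx (Rhat gh zeta tau y)) *m sp2 (l eta) =
    sp2 (l eta) *m sc (invmx (Rhat gh zeta ts y)) *m sp1 (m xi).
  apply: (exchange_inv_left (ML1 xi) (mL1 xi) (P := sc (Rhat gh zeta tau y))
    (S := sc (Rhat gh zeta ts y))).
  - exact: (scal_mulVmx A uy).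
  - exact: (scal_mulmxV A usy).
  have := @hL (xi + tau + 1) (eta + zeta * c).
  rewrite (_ : xi + tau + 1 - (eta + zeta * c) = y); first by apply.
  by rewrite /y /x /taustar; ring.
have rlm : sp2 (m eta) *m sc (Rhat gh zeta tau y') *m sp1 (l xi) =
    sp1 (l xi) *m sc (Rhat gh zeta ts y') *m sp2 (m eta).
  apply: (exchange_inv_right (ML2 eta) (mL2 eta)).
  have := @hL (xi + zeta * c) (eta + tau + 1).
  rewrite (_ : xi + zeta * c - (eta + tau + 1) = y'); first by apply.
  by rewrite /y' /x /taustar; ring.
have av : avoids q p (epi (eta - xi) ^+ 2).
  by have := avoidsV gt; rewrite -exprVn -epiN opprB.
pose u := epi x ^+ 2.
have fu0 : f u != 0 by exact: (qfactor_neq0 n q1 gt).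
have fu'0 : f (epi y' ^+ 2) != 0 by exact: (qfactor_neq0 n q1 gty').
have RysE : tensmx am 1%:M *m invmx (Rhat gh zeta ts y) =
    (f u)^-1 *: (invmx (Rhat gh zeta ts x) *m tensmx am 1%:M).
  apply: (intertwine_invmx usx usy).
  exact: (intertwine_sym fu0 (Rhat_quasi gh_diag gh_sqr ps1 q1 gs)).
have Rys'E : Rhat gh zeta ts y' *m tensmx am 1%:M =
    (f (epi y' ^+ 2))^-1 *: (tensmx am 1%:M *m Rhat gh zeta ts x).
  apply: (intertwine_sym fu'0).
  have e : y' + ts + 1 = x by rewrite /y'; ring.
  apply: etrans (congr1 (fun z => _ *m Rhat gh zeta ts z) (esym e)) _.
  exact: (Rhat_quasi gh_diag gh_sqr ps1 q1 gsy').
have KE := Rhat_twist_up gh_diag gh_sqr p1 q1 r gt.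
have K'E := Rhat_twist_down gh_diag gh_sqr p1 q1 hz r gt.
(* In the reversed product [Rhat] and its inverse trade places, so crossing at [y'] is read with its
   two factors, and by [flip] its two spaces, interchanged. *)
have cross' i k e b' : \sum_d \sum_b
   ent (flip (invmx (Rhat gh zeta tau zd))) d k i b *
   ent (flip (Rhat gh zeta tau y')) e b d b' = (k == b')%:R * (e == i)%:R.
  rewrite exchange_big mulrC; apply: etrans _ (cross_down b' e k i).
  apply: eq_bigr => d _; apply: eq_bigr => b _.
  by rewrite !ent_flip; apply: mulrC.
have t12 := mxtrace_product (m eta) usx rl rml cross_up KE RysE.
have t21 := mxtrace_product_flip (l eta) ux rm rlm cross' K'E Rys'E.
(* The factor obtained from a step in [p'] is rewritten as a value of [f] on the orbit of [u] under
   [p]: [qfactor_shift] inserts [q^(2N)], and then [yd] applies. *)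
have fs : f (epi y' ^+ 2) = f (p ^ (- (r + 1)) * u).
  apply: etrans (esym (qfactor_shift n q1 gty')) (congr1 f _).
  have -> : Q * epi y' ^+ 2 = epi (zd + delta) ^+ 2.
    rewrite -yd -!epi_sqr -epiXn -epiD; congr epi; rewrite natrM; ring.
  rewrite epiD epi_delta mulr1 -epi_sqr_shift /zd mulrNz mulNr //.
have ue : epi (eta - xi) ^- 2 = u by rewrite -exprVn -epiN opprB.
have := YN_ratio n p1 q1 r av; rewrite /= ue -fs => YR.
apply: etrans t12 _; apply: etrans _ (congr1 ( *:%R _) (esym t21)).
by rewrite scalerA; exact: (congr1 ( *:%R^~ _) YR).
Qed.

End Surface.

Theorem corollary1 (R : realType) (N : nat) (hN : (2 <= N)%N)
  (zeta tau c : R[i]) (hpar : admissible zeta tau c)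
  (gh : 'M[R[i]]_N) (gh_diag : is_diag_mx gh) (gh_sqr : gh *m gh = gmx N)
  (n : int) (hn : n <> 0) (hsurf : on_surface N n zeta tau c)
  (A : algType R[i]) (L Lminv : R[i] -> 'M[A]_N)
  (hL : Aqp_sl gh zeta tau c L) (hinv : Lminus_inverse gh tau L Lminv) :
  forall xi eta : R[i], generic_ratio zeta tau c (xi - eta) ->
    tgen gh n zeta c L Lminv xi * tgen gh n zeta c L Lminv eta
    = YN zeta tau N n (epi (eta - xi))
      *: (tgen gh n zeta c L Lminv eta * tgen gh n zeta c L Lminv xi).
Proof.
(* The form [N.+2] gives ['I_N] its ring structure, in which the matrix indices are added modulo
   [N]. *)
case: N hN gh gh_diag gh_sqr hsurf L Lminv hL hinv => [|[|N]] // _.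
move=> gh gh_diag gh_sqr hsurf L Lminv [hL _] hinv xi eta g.
exact: (tgen_exchange hpar gh_diag gh_sqr hsurf hL hinv g).
Qed.
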